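(* Let $(M,\Sigma)$ be a translation cover of $(\mathbb{C}/\mathbb{Z}^2,\{0\})$, with Veech group $\Gamma$ and graph of periodic directions $\mathcal{G}$, and let $\overline{\mathcal{G}}=\mathcal{G}/\Gamma$. Then the number of edges of $\overline{\mathcal{G}}$ is equal to the index $[\mathrm{PSL}(2,\mathbb{Z}):\Gamma]$.
   Context: A translation surface $M$ is a compact connected Riemann surface with a nonzero holomorphic $1$-form $\omega$ (quadratic differential $q=\omega^2$), endowed with the associated flat metric; $\Sigma\subset M$ is a finite non-empty subset containing all zeros of $\omega$. $(M,\Sigma)$ is a translation cover of $(\mathbb{C}/\mathbb{Z}^2,\{0\})$ if there is a ramified covering $f:M\to\mathbb{C}/\mathbb{Z}^2$ branched over $\{0\}$ (all branch values lie in $\{0\}$) with $\Sigma=f^{-1}(0)$ and $q=f^*(dz^2)$. A saddle connection of $(M,\Sigma)$ is a geodesic segment with endpoints in $\Sigma$ and no point of $\Sigma$ in its interior. If its period (integral of $\omega$) is $\pm(a_x+\imath a_y)$, its slope is $a_x/a_y\in\mathbb{R}\cup\{\infty\}=\partial\mathbb{H}$. An embedded triangle in $(M,\Sigma)$ is the image of a map $\varphi:\mathrm{T}\to M$, where $\mathrm{T}\subset\mathbb{R}^2$ is a triangle with vertex set $\mathrm{T}^{(0)}$, such that (i) $\varphi(\mathrm{T}^{(0)})\subset\Sigma$; (ii) the restriction of $\varphi$ to $\mathrm{T}\setminus\mathrm{T}^{(0)}$ is an embedding with image in $M\setminus\Sigma$; (iii) $\varphi^*q=dz^2$. $\mathcal{I}$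 is the set of hyperbolic ideal triangles in $\mathbb{H}$ whose vertices are the slopes of the three sides of an embedded triangle, and $\mathcal{C}\subset\mathbb{R}\cup\{\infty\}$ is the set of vertices of elements of $\mathcal{I}$. The graph of periodic directions $\mathcal{G}$ has vertex set $\mathcal{C}\sqcup\mathcal{I}$, with an edge joining $k\in\mathcal{C}$ and $\Delta\in\mathcal{I}$ if and only if $k$ is a vertex of $\Delta$, and no other edges. The Veech group $\Gamma\subset\mathrm{PSL}(2,\mathbb{R})$ is the group of derivatives $\pm A$, $A\in\mathrm{SL}(2,\mathbb{R})$, of the orientation-preserving homeomorphisms $f$ of $M$ with $f(\Sigma)=\Sigma$ that have the form $v\mapsto\pm A v+c$ in the flat charts of $M\setminus\Sigma$. It acts by Möbius transformations on $\mathbb{H}\cup\partial\mathbb{H}$, preserving $\mathcal{I}$ and $\mathcal{C}$, hence acts on $\mathcal{G}$. Edges of $\overline{\mathcal{G}}$ are the $\Gamma$-orbits of edges of $\mathcal{G}$. *)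

(* Defs.v *)
From HB Require Import structures.
From mathcomp Require Import all_boot all_order all_algebra.
From mathcomp Require Import all_classical all_reals all_analysis.
From mathcomp Require Import generic_quotient complex.

Set Implicit Arguments.
Unset Strict Implicit.
Unset Printing Implicit Defensive.

Import Order.TTheory GRing.Theory Num.Theory.
Import numFieldNormedType.Exports.

Local Open Scope classical_set_scope.
Local Open Scope ring_scope.
Local Open Scope complex_scope.

(* The regular module [R[i]^o] carries the norm and topology of the complex
   plane; [derivable g z 1] on it is complex differentiability at [z]. *)
Notation Cplx R := (R[i]^o).

(** * Riemann surfaces and translation surfaces *)

(* A coordinate system, with its inverse; the values of [chart_map] off
   [chart_dom] and of [chart_inv] off the image are irrelevant. *)
Record chart (R : realType) (M : Type) := Chart {
  chart_dom : set M;
  chart_map :> M -> Cplx R;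
  chart_inv : Cplx R -> M }.

Definition is_chart (R : realType) (M : topologicalType) (c : chart R M) :=
  [/\ open (chart_dom c),
      {within chart_dom c, continuous c},
      {in chart_dom c, cancel c (chart_inv c)} &
      forall U, open U -> U `<=` chart_dom c -> open (c @` U)].

Definition transition (R : realType) (M : Type) (c c' : chart R M) :
  Cplx R -> Cplx R := c' \o chart_inv c.

Definition holo_transition (R : realType) (M : Type) (c c' : chart R M) :=
  forall p, chart_dom c p -> chart_dom c' p ->
    derivable (transition c c') (c p) 1.

Record riemann_surface (R : realType) := RiemannSurface {
  rs_space :> topologicalType;
  rs_atlas : set (chart R rs_space);
  rs_hausdorff : hausdorff_space rs_space;
  rs_compact : compact [set: rs_space];
  rs_connected : connected [set: rs_space];
  rs_chart : forall c, rs_atlas c -> is_chart c;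
  rs_cover : forall p, exists2 c, rs_atlas c & chart_dom c p;
  rs_holo : forall c c', rs_atlas c -> rs_atlas c' -> holo_transition c c' }.

(* In the coordinate [z] of the chart [c] the form is [form_coef c z * dz]. *)
Record holo_form (R : realType) (M : riemann_surface R) := HoloForm {
  form_coef :> chart R M -> Cplx R -> Cplx R;
  form_holo : forall c, rs_atlas c ->
    forall p, chart_dom c p -> derivable (form_coef c) (c p) 1;
  form_change : forall c c', rs_atlas c -> rs_atlas c' ->
    forall p, chart_dom c p -> chart_dom c' p ->
      form_coef c (c p) = form_coef c' (c' p) * derive1 (transition c c') (c p) }.

Definition form_zero (R : realType) (M : riemann_surface R) (w : holo_form M)
    (p : M) :=
  exists c, [/\ rs_atlas c, chart_dom c p & w c (c p) = 0].

Record translation_surface (R : realType) := TranslationSurface {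
  ts_surface :> riemann_surface R;
  ts_form : holo_form ts_surface;
  ts_form_neq0 : exists p, ~ form_zero ts_form p;
  ts_sing : set ts_surface;
  ts_sing_finite : finite_set ts_sing;
  ts_sing_neq0 : ts_sing !=set0;
  ts_zero_sing : form_zero ts_form `<=` ts_sing }.

Arguments ts_form {R} _.
Arguments ts_sing {R} _ _.

Definition holo_chart (R : realType) (M : riemann_surface R) (u : chart R M) :=
  is_chart u /\
  forall c, rs_atlas c -> holo_transition c u /\ holo_transition u c.

(* A chart [psi] away from the singularities with [d psi = omega]. *)
Definition flat_chart (R : realType) (M : translation_surface R)
    (psi : chart R M) :=
  [/\ is_chart psi,
      chart_dom psi `<=` ~` ts_sing M &
      forall c p, rs_atlas c -> chart_dom c p -> chart_dom psi p ->
        is_derive (c p) 1 (transition c psi) (ts_form M c (c p))].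

(** * Translation covers of the square torus *)

Section Torus.
Variable R : realType.

Definition gauss_int (z : Cplx R) : bool :=
  (complex.Re z \is a Num.int) && (complex.Im z \is a Num.int).

Definition torus_rel (z w : Cplx R) : bool := gauss_int (z - w).

Lemma torus_rel_refl : reflexive torus_rel.
Proof. by move=> z; rewrite /torus_rel /gauss_int subrr rpred0. Qed.

Lemma torus_rel_sym : symmetric torus_rel.
Proof.
move=> z w; rewrite /torus_rel /gauss_int -opprB.
by case: (w - z) => a b /=; rewrite !rpredN.
Qed.

Lemma torus_rel_trans : transitive torus_rel.
Proof.
move=> [w1 w2] [z1 z2] [t1 t2] /andP[/= zw1 zw2] /andP[/= wt1 wt2].
apply/andP; split => /=.
  by rewrite -(subrK w1 z1) -addrA rpredD.
by rewrite -(subrK w2 z2) -addrA rpredD.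
Qed.

Definition torus_equiv : equiv_rel (Cplx R) :=
  EquivRel torus_rel torus_rel_refl torus_rel_sym torus_rel_trans.

(* The quotient of the complex plane by the Gaussian integers. *)
Definition torus : Type := {eq_quot torus_equiv}%qT.

Definition torus_proj (z : Cplx R) : torus := (\pi_({eq_quot torus_equiv}%qT) z)%qT.

End Torus.

(* [f] is a ramified covering with all branch values in [B]: every point
   [torus_proj z0] has a disc neighbourhood whose preimage is a disjoint union
   of (at least one) sheets [s.1], on which [f] is [u |-> z0 + u ^+ s.2] in
   holomorphic coordinates; the exponents are 1 when the point is not in [B].
   As [r < 1/2], [torus_proj] is injective on the disc. *)
Definition ramified_covering (R : realType) (M : riemann_surface R)
    (f : M -> torus R) (B : set (torus R)) :=
  forall z0 : Cplx R, exists (r : R) (S : set (chart R M * nat)),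
    [/\ 0 < r < 2^-1,
        S !=set0,
        f @^-1` (@torus_proj R @` ball z0 r%:C)
          = \bigcup_(s in S) chart_dom s.1,
        trivIset S (fun s => chart_dom s.1) &
        forall s, S s ->
          [/\ holo_chart s.1,
              (0 < s.2)%N,
              s.1 @` chart_dom s.1 = [set w | `|w ^+ s.2| < r%:C],
              forall p, chart_dom s.1 p ->
                f p = torus_proj (z0 + s.1 p ^+ s.2) &
              ~ B (torus_proj z0) -> s.2 = 1%N]].

(* [f^*(dz^2) = omega^2]; [F] is a local holomorphic lift of [f] to the plane
   read in the chart [c]. *)
Definition pullback_dz2 (R : realType) (M : riemann_surface R)
    (f : M -> torus R) (w : holo_form M) :=
  forall c p, rs_atlas c -> chart_dom c p ->
    exists F : Cplx R -> Cplx R, \forall z \near c p,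
      [/\ f (chart_inv c z) = torus_proj (F z),
          derivable F z 1 &
          derive1 F z ^+ 2 = w c z ^+ 2].

Definition translation_cover (R : realType) (M : translation_surface R) :=
  exists f : M -> torus R,
    [/\ ramified_covering f [set torus_proj 0],
        ts_sing M = f @^-1` [set torus_proj 0] &
        pullback_dz2 f (ts_form M)].

(** * Saddle connections and embedded triangles *)

(* The boundary at infinity of the upper half-plane; [None] is infinity. *)
Definition bdH (R : realType) : Type := option R.

Definition slope (R : realType) (v : Cplx R) : bdH R :=
  if complex.Im v == 0 then None else Some (complex.Re v / complex.Im v).

(* A geodesic, parametrised over [0, 1] with constant speed: in flat charts it
   is a straight line with velocity [v], so [v] is its period. *)
Definition saddle_connection (R : realType) (M : translation_surface R)
    (gamma : R -> M) (v : Cplx R) :=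
  [/\ {within `[0, 1], continuous gamma},
      ts_sing M (gamma 0) /\ ts_sing M (gamma 1),
      forall t, 0 < t < 1 -> ~ ts_sing M (gamma t),
      v != 0 &
      forall t psi, 0 < t < 1 -> flat_chart psi -> chart_dom psi (gamma t) ->
        \forall s \near t, psi (gamma s) = psi (gamma t) + (s - t)%:C * v].

Definition triangle (R : realType) (p0 p1 p2 : Cplx R) : set (Cplx R) :=
  [set z | exists a b c : R, [/\ 0 <= a, 0 <= b, 0 <= c, a + b + c = 1 &
     z = a%:C * p0 + b%:C * p1 + c%:C * p2]].

Definition non_collinear (R : realType) (p0 p1 p2 : Cplx R) :=
  complex.Re (p1 - p0) * complex.Im (p2 - p0)
    != complex.Im (p1 - p0) * complex.Re (p2 - p0).

Definition topological_embedding (X Y : topologicalType) (A : set X)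
    (f : X -> Y) :=
  [/\ {within A, continuous f},
      {in A &, injective f} &
      forall U, open U ->
        exists2 V, open V & f @` (A `&` U) = (f @` A) `&` V].

(* The last clause is [phi^* q = dz^2]: the differential is [q = d psi ^ 2] in
   a flat chart [psi], and [T] contains its sides but is not open. *)
Definition embedded_triangle (R : realType) (M : translation_surface R)
    (p0 p1 p2 : Cplx R) (phi : Cplx R -> M) :=
  let T := triangle p0 p1 p2 in
  let T0 := [set p0; p1; p2] in
  [/\ non_collinear p0 p1 p2,
      {within T, continuous phi},
      phi @` T0 `<=` ts_sing M,
      topological_embedding (T `\` T0) phi /\
        phi @` (T `\` T0) `<=` ~` ts_sing M &
      forall z psi, (T `\` T0) z -> flat_chart psi -> chart_dom psi (phi z) ->
        exists e k : Cplx R, (e = 1 \/ e = -1) /\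
          \forall w \near z, T w -> psi (phi w) = e * w + k].

Definition side (R : realType) (M : Type) (phi : Cplx R -> M) (p q : Cplx R)
    (t : R) : M := phi ((1 - t)%:C * p + t%:C * q).

(** * The upper half-plane and its ideal triangles *)

Definition upper_half_plane (R : realType) : set (Cplx R) :=
  [set z | 0 < complex.Im z].

(* A vector whose slope is [k], i.e. homogeneous coordinates of [k]. *)
Definition bdH_vec (R : realType) (k : bdH R) : Cplx R :=
  if k is Some s then s +i* 1 else 1.

Definition bdH_form (R : realType) (k : bdH R) (z : Cplx R) : Cplx R :=
  (complex.Im (bdH_vec k))%:C * z - (complex.Re (bdH_vec k))%:C.

Definition bdH_det (R : realType) (k l : bdH R) : R :=
  complex.Re (bdH_vec k) * complex.Im (bdH_vec l)
    - complex.Im (bdH_vec k) * complex.Re (bdH_vec l).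

(* The closed hyperbolic half-plane containing [c] and bounded by the geodesic
   from [a] to [b]. For [a], [b], [c] finite the geodesic is the half-circle
   Re ((z - a) * conj (z - b)) = 0 of diameter [a, b], and [c] is on the side
   where this expression has the sign of (c - a) * (c - b). *)
Definition half_plane (R : realType) (a b c : bdH R) : set (Cplx R) :=
  [set z | upper_half_plane z /\
    0 <= complex.Re (bdH_form a z * (bdH_form b z)^*)
           * (bdH_det a c * bdH_det b c)].

Definition ideal_triangle (R : realType) (a b c : bdH R) : set (Cplx R) :=
  half_plane a b c `&` half_plane b c a `&` half_plane c a b.

Definition ideal_vertex (R : realType) (k : bdH R) (D : set (Cplx R)) :=
  exists a b, [/\ k <> a, k <> b, a <> b & D = ideal_triangle k a b].

(** * The graph of periodic directions *)

Definition periodic_triangles (R : realType) (M : translation_surface R) :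
    set (set (Cplx R)) :=
  [set D | exists p0 p1 p2 (phi : Cplx R -> M) v0 v1 v2,
    [/\ embedded_triangle p0 p1 p2 phi,
        saddle_connection (side phi p1 p2) v0,
        saddle_connection (side phi p2 p0) v1,
        saddle_connection (side phi p0 p1) v2 &
        D = ideal_triangle (slope v0) (slope v1) (slope v2)]].

Definition periodic_directions (R : realType) (M : translation_surface R) :
    set (bdH R) :=
  [set k | exists2 D, periodic_triangles M D & ideal_vertex k D].

(* The graph is bipartite on the two sets above and has no multiple edges, so
   an edge is the pair of its ends. *)
Definition graph_edges (R : realType) (M : translation_surface R) :
    set (bdH R * set (Cplx R)) :=
  [set e | [/\ periodic_directions M e.1, periodic_triangles M e.2 &
               ideal_vertex e.1 e.2]].

(** * The Veech group and its action *)

Definition mx_act (R : realType) (A : 'M[R]_2) (z : Cplx R) : Cplx R :=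
  (A 0 0 * complex.Re z + A 0 1 * complex.Im z)
    +i* (A 1 0 * complex.Re z + A 1 1 * complex.Im z).

(* The Moebius action (a z + b) / (c z + d) on the upper half-plane and, in
   homogeneous coordinates, on its boundary. *)
Definition mobius (R : realType) (A : 'M[R]_2) (z : Cplx R) : Cplx R :=
  ((A 0 0)%:C * z + (A 0 1)%:C) / ((A 1 0)%:C * z + (A 1 1)%:C).

Definition mobius_bd (R : realType) (A : 'M[R]_2) (k : bdH R) : bdH R :=
  slope (mx_act A (bdH_vec k)).

Definition edge_act (R : realType) (A : 'M[R]_2) (e : bdH R * set (Cplx R)) :
    bdH R * set (Cplx R) :=
  (mobius_bd A e.1, mobius A @` e.2).

Definition homeomorphism (X Y : topologicalType) (f : X -> Y) :=
  continuous f /\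
  exists g : Y -> X, [/\ continuous g, cancel f g & cancel g f].

(* [f] preserves the orientation as soon as [\det A > 0]. *)
Definition affine_homeo (R : realType) (M : translation_surface R)
    (A : 'M[R]_2) (f : M -> M) :=
  [/\ homeomorphism f,
      f @` ts_sing M = ts_sing M &
      forall p psi psi', flat_chart psi -> flat_chart psi' ->
        chart_dom psi p -> chart_dom psi' (f p) ->
        exists e k : Cplx R, (e = 1 \/ e = -1) /\
          \forall x \near p, psi' (f x) = e * mx_act A (psi x) + k].

(* An element of PSL(2, R) is represented by the set {A, -A} of its lifts. *)
Definition psl (R : realType) (A : 'M[R]_2) : set 'M[R]_2 := [set A; - A].

Definition psl_mul (R : realType) (g h : set 'M[R]_2) : set 'M[R]_2 :=
  [set A *m B | A in g & B in h].

Definition PSL2Z (R : realType) : set (set 'M[R]_2) :=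
  [set psl A | A in [set A : 'M[R]_2 |
    \det A = 1 /\ forall i j, A i j \is a Num.int]].

Arguments PSL2Z : clear implicits.

Definition veech_group (R : realType) (M : translation_surface R) :
    set (set 'M[R]_2) :=
  [set psl A | A in [set A : 'M[R]_2 |
    \det A = 1 /\ exists f : M -> M, affine_homeo A f]].

Definition left_cosets (R : realType) (G H : set (set 'M[R]_2)) :
    set (set (set 'M[R]_2)) :=
  [set [set psl_mul g h | h in H] | g in G].

Definition veech_orbit (R : realType) (M : translation_surface R)
    (e : bdH R * set (Cplx R)) : set (bdH R * set (Cplx R)) :=
  [set edge_act A e | A in [set A : 'M[R]_2 | veech_group M (psl A)]].

Definition quotient_edges (R : realType) (M : translation_surface R) :
    set (set (bdH R * set (Cplx R))) :=
  [set veech_orbit M e | e in graph_edges M].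

(* Main.v *)
Require Import Defs.
From HB Require Import structures.
From mathcomp Require Import all_boot all_order all_algebra.
From mathcomp Require Import all_classical all_reals all_analysis.
From mathcomp Require Import complex.
From mathcomp Require Import generic_quotient ring lra.

Set Implicit Arguments.
Unset Strict Implicit.
Unset Printing Implicit Defensive.

Import Order.TTheory GRing.Theory Num.Theory.
Import numFieldNormedType.Exports.
Import Normc.

Local Open Scope classical_set_scope.
Local Open Scope ring_scope.
Local Open Scope complex_scope.

(** Why the theorem holds.

    The covering [f] turns the geometry of [M] into that of the square torus.
    Away from the singularities [f] is a local homeomorphism that pulls [dz] back
    to plus or minus [omega] ([form_sign_near]), so a path of [M] with constant
    velocity [v] in flat charts is mapped by [f] to a straight path with velocity
    [v] or [- v] ([development]). As the singularities are exactly the preimages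
    of 0, such a path from singularity to singularity has its period in Z + iZ.

    Applied to the image of a saddle connection under an affine homeomorphism,
    this shows that the derivative maps 1 and i to Gaussian integers, whence the
    inclusion of the Veech group in PSL(2, Z) ([veech_integral]). Applied to the
    segments issued from a vertex of an embedded triangle, it shows that the
    triangle develops onto a lattice triangle without lattice points other than
    its vertices, hence of determinant 1 or -1
    ([periodic_triangle_unimodular]). Conversely every unimodular lattice
    triangle comes from an embedded one ([unimodular_triangle]): the triangle
    without its vertices is convex and avoids the lattice, so it lifts through
    [f] by lifting along rays; the lift extends to the vertices because [f] is a
    power map there, and it is injective because no two points of a unimodular
    triangle other than its vertices are congruent. The ideal triangles of the
    graph are therefore the triangles of the Farey tessellation
    ([periodic_trianglesP]).

    PSL(2, Z) acts on the flags (vertex, triangle) of that tessellation simply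
    transitively: transitively because a unimodular basis is the image of (1, i)
    by a matrix of SL(2, Z), and because a matrix of order three rotates the
    vertices of the triangle with vertices infinity, 0 and 1
    ([vertex_of_image]); freely because a matrix fixing infinity and preserving
    {0, 1} is plus or minus the identity ([edge0_stab]). Edges of the graph thus
    correspond to elements of PSL(2, Z), orbits of the Veech group to its right
    cosets, and taking inverses turns these into the left cosets
    ([quotient_edges_cosets]). *)

(** * Neighbourhoods, connectedness and the norm of the complex plane *)

Lemma nbhsS (T : topologicalType) (p : T) (P Q : set T) :
  P `<=` Q -> nbhs p P -> nbhs p Q.
Proof. exact: filterS. Qed.

Lemma nbhsI (T : topologicalType) (p : T) (P Q : set T) :
  nbhs p P -> nbhs p Q -> nbhs p (P `&` Q).
Proof. exact: filterI. Qed.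

Lemma nbhsT (T : topologicalType) (p : T) (P : set T) : (forall x, P x) -> nbhs p P.
Proof. by move=> H; apply: filterE. Qed.

Lemma nbhs_nbhs (T : topologicalType) (x : T) (P : set T) :
  nbhs x P -> nbhs x [set y | nbhs y P].
Proof. by move=> /nbhs_interior. Qed.

(** The points of [A] where [P] holds form an open and closed part of [A]. *)
Lemma connected_locally_constant (T : topologicalType) (A : set T) (P : T -> Prop) :
  connected A -> (forall x, A x -> \forall y \near x, A y -> (P y <-> P x)) ->
  forall x y, A x -> A y -> P x -> P y.
Proof.
move=> cA H x y Ax Ay Px.
suff : A `&` P = A by move=> /seteqP[_ /(_ y Ay)[]].
apply: cA; first by exists x.
- exists (interior [set z | A z -> P z]); first exact: open_interior.
  apply/seteqP; split=> [z [Az Pz]|z [Az /interior_subset /(_ Az)]]; last by split.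
  by split=> //; apply: filterS (H z Az) => z' h /h[_ ]; apply.
- exists (closure (A `&` P)); first exact: closed_closure.
  apply/seteqP; split=> [z [Az Pz]|z [Az /(_ _ (H z Az))[z' [[Az' Pz'] /(_ Az')[h _]]]]].
    by split=> //; apply: subset_closure.
  by split=> //; apply: h.
Qed.

Section Plane.
Variable R : realType.
Implicit Types (z w u v h : Cplx R) (g : Cplx R -> Cplx R).

Lemma norm_normc z : `|z| = (normc z)%:C.
Proof. by case: z. Qed.

Lemma normc_ge0 z : 0 <= normc z.
Proof. by case: z => a b /=; apply: sqrtr_ge0. Qed.

Lemma normc_gt0 z : (0 < normc z) = (z != 0).
Proof.
rewrite lt_def normc_ge0 andbT; congr (~~ _); apply/eqP/eqP => [/eq0_normc//|->].
exact: normc0.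
Qed.

Lemma normc_triangle u z w : normc (z - w) <= normc (z - u) + normc (u - w).
Proof. by have := le_normcD (z - u) (u - w); rewrite addrA subrK. Qed.

Lemma normc_Re z : `|complex.Re z| <= normc z.
Proof. by have := normc_ge_Re z; rewrite norm_normc lecR. Qed.

Lemma normc_Im z : `|complex.Im z| <= normc z.
Proof.
by case: z => a b /=; rewrite -sqrtr_sqr ler_wsqrtr // lerDr sqr_ge0.
Qed.

Lemma normc_real (r : R) : normc r%:C = `|r|.
Proof. by rewrite /= expr0n addr0 sqrtr_sqr. Qed.

Lemma normcX z n : normc (z ^+ n) = normc z ^+ n.
Proof. by elim: n => [|n IH]; rewrite ?expr0 ?normc1 // !exprS normcM IH. Qed.

Lemma normc_sign (e z : Cplx R) : e = 1 \/ e = -1 -> normc (e * z) = normc z.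
Proof. by case=> ->; rewrite ?mul1r // mulN1r normcN. Qed.

(** The norm of the complex plane takes its values in the plane itself; this
    lemma and the next ones replace it by the real number [normc]. *)
Lemma nbhs_planeP z (P : set (Cplx R)) :
  nbhs z P <-> exists2 e : R, 0 < e & forall w, normc (w - z) < e -> P w.
Proof.
split=> [/nbhs_normP[e /= e0 eP]|[e e0 eP]].
  have ee : e = (complex.Re e)%:C.
    by case: e e0 {eP} => a b; rewrite ltcE /= => /andP[/eqP -> _].
  move: e0 eP; rewrite ee ltcR => e0 eP; exists (complex.Re e) => // w wz.
  by apply: eP => /=; rewrite /ball_/= -opprB normrN norm_normc ltcR.
apply/(@nbhs_normP _ (Cplx R)); exists e%:C; first by rewrite /= ltcR.
move=> w /=; rewrite -opprB normrN norm_normc ltcR; exact: eP.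
Qed.

Lemma ball_planeP z (r : R) w : ball z r%:C w <-> normc (w - z) < r.
Proof. by rewrite -ball_normE /= -opprB normrN norm_normc ltcR. Qed.

Lemma near_planeW z (e : R) : 0 < e -> \forall w \near z, normc (w - z) < e.
Proof. by move=> e0; apply/nbhs_planeP; exists e. Qed.

Lemma cvg_plane (T : topologicalType) (x : T) (g : T -> Cplx R) z :
  (forall e : R, 0 < e -> \forall y \near x, normc (g y - z) < e) ->
  g y @[y --> x] --> z.
Proof.
move=> H P /nbhs_planeP[e e0 eP].
have K : nbhs x (g @^-1` P) by have := H e e0; apply: nbhsS => y; exact: eP.
exact: K.
Qed.

Lemma cvg_plane_near (T : topologicalType) (x : T) (g : T -> Cplx R) z (e : R) :
  g y @[y --> x] --> z -> 0 < e -> \forall y \near x, normc (g y - z) < e.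
Proof. by move=> gz e0; have K := gz _ (near_planeW z e0); exact: K. Qed.

Lemma derive_planeP z g d :
  is_derive z 1 g d <->
  forall e : R, 0 < e -> exists2 r : R, 0 < r & forall h, normc h < r ->
    normc (g (z + h) - g z - d * h) <= e * normc h.
Proof.
split=> [[gz gd] e e0|H].
  have : (fun h : Cplx R => h^-1 *: ((g \o shift z) (h *: (1 : Cplx R)) - g z)) @ 0^' --> d.
    by rewrite -gd; exact: gz.
  move=> /cvgrPdist_lt /(_ e%:C); rewrite ltcR => /(_ e0).
  rewrite /dnbhs /= => /nbhs_planeP[r r0 rP]; exists r => // h hr.
  have [->|h0] := eqVneq h 0; first by rewrite addr0 subrr mulr0 subr0 normc0 mulr0.
  have /= := rP h; rewrite subr0 => /(_ hr h0).
  rewrite -opprB normrN norm_normc ltcR => /ltW.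
  rewrite -(ler_pM2r (x := normc h)) ?normc_gt0 // -normcM mulrBl.
  rewrite /shift /= /GRing.scale /= mulr1 [h + z]addrC.
  by rewrite mulrAC mulVf // mul1r.
have cv : (fun h : Cplx R => h^-1 *: ((g \o shift z) (h *: (1 : Cplx R)) - g z)) @ 0^' --> d.
  apply/cvgrPdist_lt => -[e e'] /=; rewrite ltcE /= => /andP[/eqP -> e0].
  have [|r r0 rP] := H (e / 2); first by rewrite divr_gt0.
  rewrite /dnbhs; apply/nbhs_planeP; exists r => // h; rewrite subr0 => hr /= h0.
  rewrite -opprB normrN norm_normc -[e +i* 0]/(e%:C) ltcR.
  apply: (@le_lt_trans _ _ (e / 2)); last by rewrite ltr_pdivrMr // ltr_pMr // ltr1n.
  rewrite -(ler_pM2r (x := normc h)) ?normc_gt0 // -normcM mulrBl.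
  rewrite /shift /= /GRing.scale /= mulr1 [h + z]addrC.
  by rewrite [X in normc (X - _)]mulrAC mulVf // mul1r; apply: rP.
by apply: DeriveDef; [apply/cvg_ex; exists d | apply/cvg_lim].
Qed.

(** Restricting to a line and taking the real part of a multiple reduces
    complex derivatives to derivatives of real functions. *)
Lemma derive_along z h g d m (t : R) :
  is_derive (z + t%:C * h) 1 g d ->
  is_derive t (1 : R) (fun s : R => complex.Re (m * g (z + s%:C * h)))
    (complex.Re (m * d * h)).
Proof.
move=> /derive_planeP H.
have cv : (fun s : R => s^-1 *: (((fun s : R => complex.Re (m * g (z + s%:C * h)))
     \o shift t) (s *: (1 : R)) - complex.Re (m * g (z + t%:C * h)))) @ 0^' -->
   complex.Re (m * d * h).
  apply/cvgrPdist_lt => e e0.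
  pose K := normc m * normc h + 1.
  have K0 : 0 < K by rewrite ltr_wpDl // mulr_ge0 ?normc_ge0.
  have [|r r0 rP] := H (e / 2 / K); first by rewrite !divr_gt0.
  have r'0 : 0 < r / (normc h + 1) by rewrite divr_gt0 // ltr_wpDl ?normc_ge0.
  rewrite /dnbhs; apply/nbhs_normP; exists (r / (normc h + 1)) => //= s.
  rewrite /ball_ /= sub0r normrN => sr s0.
  rewrite -(ltr_pM2r (x := `|s|)) ?normr_gt0 // -normrM mulrBl.
  rewrite /shift /= /GRing.scale /= mulr1.
  rewrite [X in _ - X]mulrAC mulVf // mul1r.
  have -> : complex.Re (m * d * h) * s - (complex.Re (m * g (z + (s + t)%:C * h)) -
     complex.Re (m * g (z + t%:C * h))) =
    - complex.Re (m * (g (z + t%:C * h + s%:C * h) - g (z + t%:C * h) - d * (s%:C * h))).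
    have -> : z + (s + t)%:C * h = z + t%:C * h + s%:C * h.
      by rewrite rmorphD /=; ring.
    case: (g (z + t%:C * h + s%:C * h)) => a b; case: (g (z + t%:C * h)) => a' b'.
    case: (m) => m1 m2; case: (d) => d1 d2; case: (h) => h1 h2 /=; ring.
  rewrite normrN; apply: (le_lt_trans (normc_Re _)); rewrite normcM.
  have hr : normc (s%:C * h) < r.
    rewrite normcM normc_real; move: sr; rewrite ltr_pdivlMr ?ltr_wpDl ?normc_ge0 //.
    by apply: le_lt_trans; rewrite mulrDr mulr1 lerDl.
  apply: (le_lt_trans (ler_wpM2l (normc_ge0 _) (rP _ hr))).
  rewrite normcM normc_real mulrCA mulrC.
  rewrite (_ : normc m * _ * _ = e / 2 * (normc m * normc h / K) * `|s|); last by ring.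
  rewrite ltr_pM2r ?normr_gt0 //.
  apply: (@le_lt_trans _ _ (e / 2)); last by rewrite ltr_pdivrMr // ltr_pMr // ltr1n.
  rewrite ler_piMr ?divr_ge0 ?(ltW e0) // ler_pdivrMr // mul1r /K lerDl //.
by apply: DeriveDef; [apply/cvg_ex; exists (complex.Re (m * d * h)) | apply/cvg_lim].
Qed.

End Plane.

(** * Primitives of a square root, by Darboux's property *)

Section Calculus.
Variable R : realType.
Implicit Types (z w u v h : Cplx R) (g : Cplx R -> Cplx R).

Lemma derive_neg_decr (phi : R -> R) (t d : R) :
  is_derive t (1:R) phi d -> d < 0 ->
  exists2 r : R, 0 < r & forall s, `|s| < r -> s != 0 -> (phi (t + s) - phi t) * s < 0.
Proof.
move=> [Dt dE] d0.
have : (fun s : R => s^-1 *: ((phi \o shift t) (s *: (1 : R)) - phi t)) @ 0^' --> d.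
  by rewrite -dE; exact: Dt.
move=> /cvgrPdist_lt/(_ (- d)); rewrite oppr_gt0 => /(_ d0).
rewrite /dnbhs /= => /nbhs_normP[r /= r0 rP]; exists r => // s sr s0.
have := rP s; rewrite /ball_ /= sub0r normrN => /(_ sr s0).
rewrite /shift /= /GRing.scale /= mulr1 [s + t]addrC ltr_norml => /andP[+ _].
rewrite opprK -subr_gt0 addrAC subrr sub0r oppr_gt0 => H.
have -> : (phi (t + s) - phi t) * s = s^-1 * (phi (t + s) - phi t) * s ^+ 2.
  by rewrite expr2; field.
by rewrite pmulr_llt0 // exprn_even_gt0.
Qed.

Lemma is_derive_within (phi dphi : R -> R) (a b : R) :
  (forall t : R, t \in `[a, b] -> is_derive t (1:R) phi (dphi t)) ->
  {within `[a, b], continuous phi}.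
Proof.
move=> H; apply: derivable_within_continuous => t tab.
by have [] := H t tab.
Qed.

(** Darboux's property: if the signs at the ends differed, the minimum on the
    interval would be attained inside, and the derivative would vanish there. *)
Lemma darboux_neg (phi dphi : R -> R) :
  (forall t : R, t \in `[0, 1] -> is_derive t (1:R) phi (dphi t)) ->
  (forall t : R, t \in `[0, 1] -> dphi t != 0) -> dphi 0 < 0 -> dphi 1 < 0.
Proof.
move=> D N d0; rewrite lt_neqAle N ?in_itv/= ?ler01 ?lexx //= leNgt; apply/negP => d1.
have [c c01 cmin] := EVT_min ler01 (is_derive_within D).
have D0 : is_derive (0:R) (1:R) phi (dphi 0) by apply: D; rewrite in_itv /= lexx ler01.
have D1 : is_derive (1:R) (1:R) (fun t => - phi t) (- dphi 1).
  by apply: is_deriveN; apply: D; rewrite in_itv /= lexx ler01.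
have c0 : c != 0.
  apply/eqP => c0; subst c; have [r r0 rP] := derive_neg_decr D0 d0.
  pose s := Num.min (r / 2) 1.
  have s0 : 0 < s by rewrite lt_min ltr01 divr_gt0.
  have s1 : s <= 1 by rewrite ge_min lexx orbT.
  have sr : `|s| < r.
    by rewrite gtr0_norm // gt_min ltr_pdivrMr // ltr_pMr // ltr1n.
  have := rP s sr (lt0r_neq0 s0); rewrite pmulr_llt0 // subr_lt0 add0r ltNge.
  by rewrite cmin // in_itv /= s1 ltW.
have c1 : c != 1.
  apply/eqP => c1; subst c; have [|r r0 rP] := derive_neg_decr D1; first by rewrite oppr_lt0.
  pose s := Num.min (r / 2) 1.
  have s0 : 0 < s by rewrite lt_min ltr01 divr_gt0.
  have s1 : s <= 1 by rewrite ge_min lexx orbT.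
  have sr : `|- s| < r.
    by rewrite normrN gtr0_norm // gt_min ltr_pdivrMr // ltr_pMr // ltr1n.
  have := rP (- s) sr; rewrite oppr_eq0 => /(_ (lt0r_neq0 s0)).
  rewrite mulrN oppr_lt0 pmulr_lgt0 // subr_gt0 ltrN2 ltNge.
  by rewrite cmin // in_itv /= subr_ge0 s1 lerBlDr lerDl ltW.
have cI : c \in `]0, 1[.
  by move: c01; rewrite !in_itv /= !le_eqVlt [0 == c]eq_sym (negbTE c0) (negbTE c1).
have sub t : t \in `]0, 1[ -> t \in `[(0:R), 1] by apply: subset_itvW.
have D' t : t \in `]0, 1[ -> derivable phi t 1 by move=> /sub /D[].
have [_ e0] := derive1_at_min ler01 D' cI (fun t tI => cmin t (sub t tI)).
have [_ e1] := D c c01.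
by have := N c c01; rewrite -e1 e0 eqxx.
Qed.

Lemma segment_ball z0 z (r t : R) :
  normc (z - z0) < r -> t \in `[0, 1] -> normc (z0 + t%:C * (z - z0) - z0) < r.
Proof.
move=> zr; rewrite in_itv /= => /andP[t0 t1].
rewrite [z0 + _]addrC addrK normcM normc_real ger0_norm //.
by apply: le_lt_trans zr; rewrite ler_piMl ?normc_ge0.
Qed.

(** The mean value theorem on the segment from the centre, for the real part
    and, after multiplication by [- i], for the imaginary part. *)
Lemma derive0_cst g z0 (r : R) :
  (forall z, normc (z - z0) < r -> is_derive z 1 g (0 : Cplx R)) ->
  forall z, normc (z - z0) < r -> g z = g z0.
Proof.
move=> H z zr.
have key m : complex.Re (m * g z) = complex.Re (m * g z0).
  pose phi (s : R) := complex.Re (m * g (z0 + s%:C * (z - z0))).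
  have D t : t \in `[0, 1] -> is_derive (t:R) (1:R) phi 0.
    move=> t01; rewrite (_ : 0 = complex.Re (m * 0 * (z - z0))); last by rewrite mulr0 mul0r.
    by apply: derive_along; apply: H; apply: segment_ball.
  have D' t : t \in `]0, 1[ -> is_derive (t:R) (1:R) phi 0.
    by move=> tI; apply: D; apply: subset_itvW tI.
  have [c c01] := @MVT_segment R phi (fun=> 0) 0 1 ler01 D'
    (@is_derive_within phi (fun=> 0) 0 1 D).
  rewrite mul0r => /eqP; rewrite subr_eq0 => /eqP; rewrite /phi.
  have -> : z0 + (1:R)%:C * (z - z0) = z by rewrite mul1r addrC subrK.
  by have -> : z0 + (0:R)%:C * (z - z0) = z0 by rewrite mul0r addr0.
have := key 1; have := key (0 -i* 1); case: (g z) => a b; case: (g z0) => a' b' /=.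
rewrite !mul0r !mul1r !sub0r !mulN1r !opprK ?mul0r ?subr0 ?oppr0 ?add0r ?addr0 => Eb Ea.
by rewrite Ea Eb.
Qed.

(** The derivative of [F] is [w] or [- w] at each point, and [w] hardly turns
    near [z0], so the real part of [F' / w z0] never vanishes; by Darboux's
    property it keeps its sign on each segment from [z0]. *)
Lemma sqrt_derive_sign (F w : Cplx R -> Cplx R) z0 :
  (\forall z \near z0, derivable F z 1 /\ derive1 F z ^+ 2 = w z ^+ 2) ->
  {for z0, continuous w} -> w z0 != 0 ->
  exists2 e : Cplx R, e = 1 \/ e = -1 &
    \forall z \near z0, is_derive (z : Cplx R) 1 F (e * w z).
Proof.
move=> H cw w0.
have := cw; rewrite /continuous_at => /cvgrPdist_lt /(_ (normc (w z0))%:C).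
rewrite ltcR normc_gt0 => /(_ w0) H'.
have [r r0 rP] := (nbhs_planeP _ _).1 (filterI H H').
have sgn z : normc (z - z0) < r -> 0 < complex.Re (w z / w z0).
  move=> /rP[_]; rewrite norm_normc ltcR => wz.
  rewrite -[X in 0 < X](subrK 1) -(opprB 1) -ltrBlDr sub0r ltrN2.
  rewrite -[X in X - _ < _]/(complex.Re (1 : R[i])).
  have -> : complex.Re (1 : R[i]) - complex.Re (w z / w z0) =
     complex.Re ((w z0 - w z) / w z0).
    by rewrite mulrBl divff //; case: (w z / w z0).
  apply: le_lt_trans (ler_norm _) _; apply: le_lt_trans (normc_Re _) _.
  by rewrite normcM normcV ltr_pdivrMr ?normc_gt0 // mul1r.
have dF z : normc (z - z0) < r -> exists2 e : Cplx R, e = 1 \/ e = -1 &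
    is_derive (z : Cplx R) 1 F (e * w z).
  move=> /rP[[Fz +] _] => /eqP; rewrite -subr_eq0 subr_sqr mulf_eq0 subr_eq0 addr_eq0.
  have D : is_derive (z : Cplx R) 1 F (derive1 F z) by rewrite derive1E; apply: derivableP.
  by move=> /orP[]/eqP E; [exists 1; [left|] | exists (-1); [right|]] => //;
    rewrite ?mul1r ?mulN1r -E.
have [e e1 De] : exists2 e : Cplx R, e = 1 \/ e = -1 & is_derive (z0 : Cplx R) 1 F (e * w z0).
  by apply: dF; rewrite subrr normc0.
exists e; first exact: e1.
apply/nbhs_planeP; exists r; [exact: r0|move=> z zr].
have [->//|zz0] := eqVneq z z0.
have [e' e1' De'] := dF z zr.
suff -> : e = e' by [].
have h0 : z - z0 != 0 by rewrite subr_eq0.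
(* With this factor the derivative along the segment is the real part of
   [- e F' / w z0], which is -1 at the centre. *)
pose m := - e / (w z0 * (z - z0)).
pose zt (t : R) := z0 + t%:C * (z - z0).
pose dphi t := complex.Re (m * derive1 F (zt t) * (z - z0)).
have ztr t : t \in `[0, 1] -> normc (zt t - z0) < r by apply: segment_ball.
have dE z' e'' : is_derive (z' : Cplx R) 1 F (e'' * w z') -> derive1 F z' = e'' * w z'.
  by move=> [_ E]; rewrite derive1E.
have ne1 : e * e = 1 by case: e1 => ->; rewrite ?mul1r ?mulN1r ?opprK.
have dphiE t e'' : is_derive (zt t : Cplx R) 1 F (e'' * w (zt t)) ->
    dphi t = complex.Re (- (e * e'') * (w (zt t) / w z0)).
  by move=> /dE E; rewrite /dphi E /m; congr complex.Re; field; apply/andP.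
have D t : t \in `[0, 1] -> is_derive (t:R) (1:R) (fun s : R => complex.Re (m * F (zt s))) (dphi t).
  move=> tI; apply: derive_along; have [[Ft _] _] := rP _ (ztr t tI).
  by rewrite derive1E; apply: derivableP.
have N t : t \in `[0, 1] -> dphi t != 0.
  move=> tI; have [e'' e1'' De''] := dF _ (ztr t tI).
  rewrite (dphiE _ _ De''); have := sgn _ (ztr t tI).
  by case: e1 => ->; case: e1'' => ->; rewrite ?mulN1r ?mul1r ?opprK ?mulN1r ?mul1r;
    case: (w (zt t) / w z0) => a b /=; rewrite ?oppr_eq0; apply: lt0r_neq0.
have zt0 : zt 0 = z0 by rewrite /zt rmorph0 mul0r addr0.
have zt1 : zt 1 = z by rewrite /zt rmorph1 mul1r addrC subrK.
have := darboux_neg D N.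
have -> : dphi 0 = -1.
  have E := dphiE 0 e; rewrite zt0 in E; rewrite (E De) ne1 mulN1r divff //.
have -> : dphi 1 = complex.Re (- (e * e') * (w z / w z0)).
  by have E := dphiE 1 e'; rewrite zt1 in E; rewrite (E De').
move=> /(_ (ltrN10 R)); have := sgn z zr.
case: e1 => ->; case: e1' => -> //; rewrite ?mulN1r ?mul1r ?opprK ?mulN1r ?mul1r;
  by case: (w z / w z0) => a b /= /lt_trans h /h; rewrite ltxx.
Qed.

End Calculus.

(** * The lattice and the torus *)

Section Lattice.
Variable R : realType.
Implicit Types (z w u v : Cplx R) (a b : R).

Lemma torus_projP z w : torus_proj z = torus_proj w <-> gauss_int (z - w).
Proof.
by split=> [/eqmodP|H]; [|apply/eqmodP].
Qed.

Lemma gauss0 : gauss_int (0 : Cplx R).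
Proof. by rewrite /gauss_int !rpred0. Qed.

Lemma gaussN z : gauss_int z -> gauss_int (- z).
Proof. by case: z => a b /andP[/= ha hb]; rewrite /gauss_int /= !rpredN ha hb. Qed.

Lemma gaussD z w : gauss_int z -> gauss_int w -> gauss_int (z + w).
Proof.
case: z => a b; case: w => c d /andP[/= ha hb] /andP[/= hc hd].
by rewrite /gauss_int /= !rpredD.
Qed.

Lemma gaussB z w : gauss_int z -> gauss_int w -> gauss_int (z - w).
Proof. by move=> gz gw; apply: gaussD => //; apply: gaussN. Qed.

Lemma gauss_sign (e : Cplx R) z : e = 1 \/ e = -1 -> gauss_int (e * z) = gauss_int z.
Proof.
case=> ->; rewrite ?mul1r // mulN1r; apply/idP/idP; last exact: gaussN.
by move=> /gaussN; rewrite opprK.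
Qed.

Lemma gaussZ (n : R) z : n \is a Num.int -> gauss_int z -> gauss_int (n%:C * z).
Proof.
move=> nI; case: z => a b /andP[/= ha hb].
by rewrite /gauss_int /= !mul0r subr0 addr0 !rpredM.
Qed.

Lemma int_small a : a \is a Num.int -> `|a| < 1 -> a = 0.
Proof.
move=> aI a1; apply/eqP; apply: contraTT a1 => a0.
by rewrite -leNgt; apply: norm_intr_ge1.
Qed.

Lemma gauss_small z : gauss_int z -> normc z < 1 -> z = 0.
Proof.
move=> /andP[zr zi] z1.
have r0 := int_small zr (le_lt_trans (normc_Re z) z1).
have i0 := int_small zi (le_lt_trans (normc_Im z) z1).
by case: z r0 i0 {zr zi z1} => p q /= -> ->.
Qed.

(** The projection to the torus is injective on discs of radius 1/2. *)
Lemma gauss_close z w : gauss_int (z - w) -> normc z < 2^-1 -> normc w < 2^-1 -> z = w.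
Proof.
move=> g hz hw; apply/eqP; rewrite -subr_eq0; apply/eqP/gauss_small => //.
apply: le_lt_trans (le_normcD _ _) _; rewrite normcN.
have -> : 1 = 2^-1 + 2^-1 :> R by field.
exact: ltrD.
Qed.

Lemma int_limit a :
  (forall e, 0 < e -> exists2 b, b \is a Num.int & `|b - a| < e) -> a \is a Num.int.
Proof.
move=> H; have h2 : (0 : R) < 2^-1 by rewrite invr_gt0.
have [b bI ba] := H _ h2.
suff -> : a = b by [].
apply/eqP; rewrite -subr_eq0 -normr_eq0; apply/negPn/negP => ab0.
have [|c cI ca] := H (`|a - b| / 2); first by rewrite divr_gt0 // lt_def ab0 /=.
have cb : c = b.
  apply/eqP; rewrite -subr_eq0; apply/eqP; apply: int_small; first exact: rpredB.
  rewrite -[c](subrK a) -addrA; apply: le_lt_trans (ler_normD _ _) _.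
  rewrite (_ : 1 = 2^-1 + 2^-1); last by field.
  rewrite ltrD //; last by rewrite distrC.
  apply: lt_trans ca _; rewrite -[X in _ < X]mul1r ltr_pM2r // distrC.
  by apply: lt_trans ba _; rewrite invf_lt1 // ltr1n.
move: ca; rewrite cb distrC ltNge ler_pdivrMr // ler_pMr ?ler1n //.
by rewrite lt_def ab0 /=.
Qed.

Lemma gauss_limit z :
  (forall e, 0 < e -> exists2 w, gauss_int w & normc (w - z) < e) -> gauss_int z.
Proof.
move=> H; apply/andP; split; apply: int_limit => e /H[w /andP[wr wi] wz].
  exists (complex.Re w) => //; apply: le_lt_trans wz.
  by have := normc_Re (w - z); case: w {wr wi} => p q; case: (z).
exists (complex.Im w) => //; apply: le_lt_trans wz.
by have := normc_Im (w - z); case: w {wr wi} => p q; case: (z).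
Qed.

Lemma gauss_avoid (z : Cplx R) : ~ gauss_int z -> exists2 e : R, 0 < e &
  forall w, normc (w - z) < e -> ~ gauss_int w.
Proof.
move=> gz; apply: contrapT => H; apply: gz; apply: gauss_limit => e e0.
apply: contrapT => H'; apply: H; exists e => // w we gw; apply: H'.
by exists w.
Qed.

Lemma torus_proj_surj (t : torus R) : exists z, t = torus_proj z.
Proof. by exists (repr t); rewrite /torus_proj reprK. Qed.

Lemma sign_mul (e e' : Cplx R) : e = 1 \/ e = -1 -> e' = 1 \/ e' = -1 ->
  e * e' = 1 \/ e * e' = -1.
Proof.
case=> ->; case=> ->; rewrite ?mul1r ?mulN1r ?opprK; first [by left|by right].
Qed.

Lemma sign_sqr (e : Cplx R) : e = 1 \/ e = -1 -> e * e = 1.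
Proof. by case=> ->; rewrite ?mul1r ?mulN1r ?opprK. Qed.

(** Moving [s] by [h] changes the expression by [(e - e') h v]; for small [h]
    this is a lattice point only if it is 0. *)
Lemma sign_rigid (v k : Cplx R) (e e' : Cplx R) (y : R) : v != 0 ->
  e = 1 \/ e = -1 -> e' = 1 \/ e' = -1 ->
  (\forall s \near y, gauss_int (e * (s%:C * v) - e' * (s%:C * v) + k)) -> e = e'.
Proof.
move=> v0 e1 e1' /nbhs_normP[r /= r0 rP].
apply/eqP; rewrite -subr_eq0; apply/negPn/negP => ee.
have nv : 0 < normc v by rewrite normc_gt0.
(* The bound [4 |v|] leaves [|(e - e') h v| <= 2 h |v| < 1]. *)
pose h := Num.min (r / 2) (4 * normc v)^-1.
have h0 : 0 < h by rewrite lt_min divr_gt0 //= invr_gt0 mulr_gt0.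
have g1 := rP y _; have g2 := rP (y + h) _.
have /gaussB/(_ (g1 _)) : gauss_int (e * ((y + h)%:C * v) - e' * ((y + h)%:C * v) + k).
  apply: g2; rewrite /ball_ /= opprD addrA subrr add0r normrN gtr0_norm //.
  by rewrite gt_min ltr_pdivrMr // ltr_pMr // ltr1n.
rewrite /ball_ /= subrr normr0 => /(_ r0).
rewrite (_ : _ - _ = (e - e') * (h%:C * v)); last by rewrite rmorphD /=; ring.
have n2 : normc (e - e') <= 2.
  apply: le_trans (le_normcD _ _) _; rewrite normcN -[e]mulr1 -[e']mulr1.
  by rewrite !(normc_sign _ e1) !(normc_sign _ e1') normc1.
move=> /gauss_small; rewrite normcM normcM normc_real (gtr0_norm h0).
have : normc (e - e') * (h * normc v) < 1.
  apply: le_lt_trans (ler_wpM2r _ n2) _; first by rewrite mulr_ge0 // ltW.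
  have hv : h <= (4 * normc v)^-1 by rewrite ge_min lexx orbT.
  apply: le_lt_trans (ler_wpM2l _ (ler_wpM2r _ hv)) _ => //; first exact: ltW.
  rewrite invfM -mulrA mulVf ?gt_eqF // mulr1.
  by rewrite ltr_pdivrMr // mul1r ltr_nat.
move=> h1 /(_ h1) /eqP; rewrite !mulf_eq0 (negbTE ee) (negbTE v0) orbF /=.
by rewrite eq_complex /= gt_eqF.
Qed.

Definition cross u v : R := complex.Re u * complex.Im v - complex.Im u * complex.Re v.

Lemma crossC u v : cross v u = - cross u v.
Proof. by rewrite /cross; ring. Qed.

Lemma cross_comb u v a b : cross (a%:C * u + b%:C * v) v = a * cross u v.
Proof. by case: u => p q; case: v => r s; rewrite /cross /=; ring. Qed.

Lemma cross_comb_r u v a b : cross u (a%:C * u + b%:C * v) = b * cross u v.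
Proof. by case: u => p q; case: v => r s; rewrite /cross /=; ring. Qed.

Lemma cross_decomp u v z : cross u v != 0 ->
  z = (cross z v / cross u v)%:C * u + (cross u z / cross u v)%:C * v.
Proof.
case: u => p q; case: v => r s; case: z => x y; rewrite /cross /= => D0.
by apply/eqP; rewrite eq_complex /= ; apply/andP; split; apply/eqP; field.
Qed.

Lemma cross_int u v : gauss_int u -> gauss_int v -> cross u v \is a Num.int.
Proof. by move=> /andP[ur ui] /andP[vr vi]; rewrite rpredB // rpredM. Qed.

(** Cramer's rule with determinant 1 or -1. *)
Lemma unimodular_coord u v a b : gauss_int u -> gauss_int v ->
  cross u v ^+ 2 = 1 -> gauss_int (a%:C * u + b%:C * v) ->
  a \is a Num.int /\ b \is a Num.int.
Proof.
move=> gu gv D1 gz.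
have aE : a = a * cross u v * cross u v by rewrite -mulrA -expr2 D1 mulr1.
have bE : b = b * cross u v * cross u v by rewrite -mulrA -expr2 D1 mulr1.
have Ha : a * cross u v \is a Num.int by rewrite -(cross_comb _ _ _ b) cross_int.
have Hb : b * cross u v \is a Num.int by rewrite -(cross_comb_r _ _ a) cross_int.
by split; [rewrite aE|rewrite bE]; rewrite rpredM ?cross_int.
Qed.

(** If the coordinates of every lattice point in the basis [(u, v)] are
    integers, those of 1 and i form an integer matrix of determinant [1 / D],
    which forces [D ^+ 2 = 1]. Otherwise some fractional parts give a lattice
    point of the parallelogram, and it or its mirror image lies in the
    triangle. *)
Lemma empty_triangle_unimodular u v : gauss_int u -> gauss_int v ->
  cross u v != 0 ->
  (forall a b, 0 <= a -> 0 <= b -> a + b <= 1 -> gauss_int (a%:C * u + b%:C * v) ->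
     [\/ a = 0 /\ b = 0, a = 1 /\ b = 0 | a = 0 /\ b = 1]) ->
  cross u v ^+ 2 = 1.
Proof.
move=> gu gv D0 H; set D := cross u v in D0 *.
have coord z : gauss_int z ->
    cross z v / D \is a Num.int /\ cross u z / D \is a Num.int.
  move=> gz; have := cross_decomp z D0; rewrite -/D.
  move: (cross z v / D) (cross u z / D) => al be zE.
  pose a := al - (Num.floor al)%:~R; pose b := be - (Num.floor be)%:~R.
  have a0 : 0 <= a by rewrite subr_ge0 floor_le_tmp.
  have b0 : 0 <= b by rewrite subr_ge0 floor_le_tmp.
  have a1 : a < 1 by rewrite ltrBlDl -[X in _ + X]/(1%:~R) -intrD floorD1_gt.
  have b1 : b < 1 by rewrite ltrBlDl -[X in _ + X]/(1%:~R) -intrD floorD1_gt.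
  have gab : gauss_int (a%:C * u + b%:C * v).
    rewrite (_ : _ + _ = z - ((Num.floor al)%:~R : R)%:C * u
       - ((Num.floor be)%:~R : R)%:C * v); last by rewrite zE /a /b !rmorphB /=; ring.
    by apply: gaussB; [apply: gaussB|] => //; apply: gaussZ.
  suff [aE bE] : a = 0 /\ b = 0.
    by split; [move/eqP: aE | move/eqP: bE]; rewrite subr_eq0 => /eqP ->.
  have [ab|ab] := lerP (a + b) 1.
    case: (H a b a0 b0 ab gab) => [//|[a1'] _|[_ b1']].
      by rewrite a1' ltxx in a1.
    by rewrite b1' ltxx in b1.
  (* The mirror image in the centre of the parallelogram. *)
  have : gauss_int ((1 - a)%:C * u + (1 - b)%:C * v).
    rewrite (_ : _ + _ = u + v - (a%:C * u + b%:C * v)); last by rewrite !rmorphB /=; ring.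
    by apply: gaussB => //; apply: gaussD.
  have [ha hb] : 1 - a != 0 /\ 1 - b != 0 by split; rewrite subr_eq0 gt_eqF.
  move/H; rewrite !subr_ge0 (ltW a1) (ltW b1) => /(_ isT isT).
  have -> : 1 - a + (1 - b) <= 1 by lra.
  by move=> /(_ isT)[[/eqP]|[_ /eqP]|[/eqP]]; rewrite ?(negbTE ha) ?(negbTE hb).
have g1 : gauss_int (1 : Cplx R) by rewrite /gauss_int /= rpred0 rpred1.
have gi : gauss_int (0 +i* 1 : Cplx R) by rewrite /gauss_int /= rpred0 rpred1.
have [c1 c2] := coord _ g1; have [c3 c4] := coord _ gi.
have DI : D \is a Num.int by apply: cross_int.
have VE : D^-1 = cross 1 v / D * (cross u (0 +i* 1) / D)
      - cross u 1 / D * (cross (0 +i* 1) v / D).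
  by move: D0; rewrite /D /cross /= => D0; field.
have VI : D^-1 \is a Num.int by rewrite VE; apply: rpredB; apply: rpredM.
have n1 := norm_intr_ge1 DI D0; have := norm_intr_ge1 VI.
rewrite invr_eq0 normfV => /(_ D0); rewrite invf_ge1 ?normr_gt0 // => n2.
by rewrite -real_normK ?num_real // (le_anti (y := 1) (x := `|D|)) ?n1 ?n2 // expr1n.
Qed.

End Lattice.

(** * Charts and the local form of the covering *)

Lemma is_derive_comp_plane (R : realType) (F T : Cplx R -> Cplx R) (z t d : Cplx R) :
  is_derive z 1 T t -> is_derive (T z) 1 F d -> is_derive z 1 (F \o T) (d * t).
Proof.
move=> /derive_planeP HT /derive_planeP HF; apply/derive_planeP => e e0.
have nt0 := normc_ge0 t; have nd0 := normc_ge0 d.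
have t1 : 0 < normc t + 1 by rewrite ltr_wpDl.
have d1 : 0 < normc d + 1 by rewrite ltr_wpDl.
have [|r1 r10 r1P] := HF (e / 2 / (normc t + 1)); first by rewrite !divr_gt0.
have [|r2 r20 r2P] := HT (Num.min 1 (e / 2 / (normc d + 1))).
  by rewrite lt_min ltr01 !divr_gt0.
exists (Num.min r2 (r1 / (normc t + 1))); first by rewrite lt_min r20 divr_gt0.
move=> h; rewrite lt_min => /andP[/r2P]; set k := T (z + h) - T z => hk.
rewrite ltr_pdivlMr // => hr1.
have [hk1 hk2] : normc (k - t * h) <= normc h /\
    normc (k - t * h) <= e / 2 / (normc d + 1) * normc h.
  split; apply: (le_trans hk).
    rewrite -[X in _ <= X](mul1r (normc h)); apply: ler_wpM2r; first exact: normc_ge0.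
    by rewrite ge_min lexx.
  apply: ler_wpM2r; first exact: normc_ge0.
  by rewrite ge_min lexx orbT.
have nk : normc k <= normc h * (normc t + 1).
  rewrite -[k](subrK (t * h)); apply: le_trans (le_normcD _ _) _.
  by rewrite normcM mulrDr mulr1 addrC lerD // mulrC.
have := r1P _ (le_lt_trans nk hr1).
rewrite (_ : T z + k = T (z + h)); last by rewrite /k addrC subrK.
move=> Hk /=.
rewrite (_ : _ - d * t * h = F (T (z + h)) - F (T z) - d * k + d * (k - t * h)); last by ring.
apply: le_trans (le_normcD _ _) _; rewrite normcM.
rewrite [e in X in _ <= X](_ : e = e / 2 + e / 2); last by field.
rewrite mulrDl; apply: lerD.
  apply: le_trans Hk _.
  rewrite -mulrA ler_wpM2l ?divr_ge0 ?(ltW e0) //.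
  by rewrite mulrC ler_pdivrMr.
apply: le_trans (ler_wpM2l nd0 hk2) _.
rewrite mulrA; apply: ler_wpM2r; first exact: normc_ge0.
rewrite mulrA ler_pdivrMr // [normc d * _]mulrC; apply: ler_wpM2l.
  by rewrite divr_ge0 ?ltW.
by rewrite lerDl.
Qed.

Lemma derivable_cont (R : realType) (F : Cplx R -> Cplx R) (z : Cplx R) :
  derivable F z 1 -> {for z, continuous F}.
Proof. by move=> /derivable1_diffP /differentiable_continuous. Qed.

Section Charts.
Variables (R : realType) (M : topologicalType).
Implicit Types (c : chart R M) (p : M).

Lemma chart_dom_near c p : is_chart c -> chart_dom c p ->
  \forall x \near p, chart_dom c x.
Proof. by case=> oc _ _ _ cp; apply: open_nbhs_nbhs. Qed.

Lemma chart_cvg c p : is_chart c -> chart_dom c p -> c x @[x --> p] --> c p.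
Proof.
move=> [oc cc _ _] cp; move: cc; rewrite continuous_open_subspace //.
by apply; rewrite inE.
Qed.

Lemma chart_invK c p : is_chart c -> chart_dom c p -> chart_inv c (c p) = p.
Proof. by move=> [_ _ K _] cp; apply: K; rewrite inE. Qed.

Lemma chart_inv_near c p : is_chart c -> chart_dom c p ->
  \forall z \near c p, chart_dom c (chart_inv c z) /\ c (chart_inv c z) = z.
Proof.
move=> ch cp; have [oc _ K oim] := ch.
have : nbhs (c p) (c @` chart_dom c).
  by apply: open_nbhs_nbhs; split; [apply: oim|exists p].
by apply: nbhsS => _ [x cx <-]; rewrite chart_invK.
Qed.

Lemma chart_inv_cvg c p : is_chart c -> chart_dom c p -> chart_inv c @ c p --> p.
Proof.
move=> ch cp U Up; have [oc _ K oim] := ch.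
have : nbhs (c p) (c @` (interior U `&` chart_dom c)).
  apply: open_nbhs_nbhs; split; last by exists p => //; split.
  by apply: oim; [apply: openI => //; apply: open_interior|move=> x []].
apply: nbhsS => _ [x [Ux cx] <-] /=; rewrite chart_invK //.
exact: interior_subset.
Qed.

Lemma chart_near c p (P : set M) : is_chart c -> chart_dom c p ->
  (\forall x \near p, P x) <-> (\forall z \near c p, P (chart_inv c z)).
Proof.
move=> ch cp; split=> [Pp|Pz]; first exact: chart_inv_cvg Pp.
have H := nbhsI (chart_dom_near ch cp) (chart_cvg ch cp Pz).
by apply: (nbhsS _ H) => x [cx /=]; rewrite chart_invK.
Qed.

End Charts.

Section FlatCharts.
Variables (R : realType) (M : translation_surface R) (f : M -> torus R).
Hypothesis cover_f : ramified_covering f [set torus_proj 0].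
Hypothesis sing_f : ts_sing M = f @^-1` [set torus_proj 0].
Hypothesis pull_f : pullback_dz2 f (ts_form M).
Local Notation Sing := (ts_sing M).

Lemma sing_torus p : Sing p <-> f p = torus_proj 0.
Proof. by rewrite sing_f. Qed.

Lemma open_regular : open (~` Sing).
Proof.
apply: closed_openC; have hM := hausdorff_accessible (@rs_hausdorff R M).
by apply: (accessible_finite_set_closed.1 hM); apply: ts_sing_finite.
Qed.

(** A local lift [F] of [f] satisfies [F' ^+ 2 = omega ^+ 2], hence
    [F' = e omega] with a constant sign [e] by [sqrt_derive_sign]. *)
Lemma primitive_near (c : chart R M) p : rs_atlas c -> chart_dom c p -> ~ Sing p ->
  exists e F, (e = 1 \/ e = -1) /\ exists2 r : R, 0 < r &
    forall z, normc (z - c p) < r ->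
     [/\ chart_dom c (chart_inv c z), c (chart_inv c z) = z,
         f (chart_inv c z) = torus_proj (F z) &
         is_derive z 1 F (e * ts_form M c z)].
Proof.
move=> cA cp pS; have ch := rs_chart cA; have [F HF] := pull_f cA cp.
have w0 : ts_form M c (c p) != 0.
  by apply/eqP => w0; apply: pS; apply: (@ts_zero_sing R M); exists c.
have wc : {for c p, continuous (ts_form M c)}.
  by apply: derivable_cont; apply: form_holo.
have [|e e1 He] := @sqrt_derive_sign R F (ts_form M c) (c p) _ wc w0.
  by apply: nbhsS HF => z [].
exists e, F; split=> //.
have := nbhsI (nbhsI HF He) (chart_inv_near ch cp) => /nbhs_planeP[r r0 rP].
exists r; first exact: r0.
move=> z zr; have [[[h1 h2 h3] h4] [h5 h6]] := rP z zr.
by split; [exact: h5|exact: h6|exact: h1|exact: h4].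
Qed.

(** The covering [f] read in flat charts: [f] pulls [dz] back to [e omega] near
    [p], the sign [e] being the same for every flat chart. *)
Definition form_sign (e : Cplx R) (p : M) :=
  forall psi, flat_chart psi -> chart_dom psi p ->
    exists k, \forall y \near p, f y = torus_proj (e * psi y + k).

(** The primitive [F] of [primitive_near] and [e psi] have the same derivative
    in a coordinate, so that they differ by a constant; [F] serves all the
    points [x] near [p] with one and the same sign. *)
Lemma form_sign_near p : ~ Sing p -> exists2 e : Cplx R, e = 1 \/ e = -1 &
  \forall x \near p, form_sign e x.
Proof.
move=> pS; have [c cA cp] := rs_cover p; have ch := rs_chart cA.
have [e [F [e1 [r r0 rP]]]] := primitive_near cA cp pS.
exists e => //.
have := nbhsI (chart_dom_near ch cp) (chart_cvg ch cp (near_planeW (c p) r0)).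
apply: nbhsS => x [cx /= xr] psi [psich _ psiD] psix.
have : \forall z \near c x, normc (z - c p) < r /\ chart_dom psi (chart_inv c z).
  apply: nbhsI; last exact: (chart_near _ ch cx).1 (chart_dom_near psich psix).
  apply/nbhs_planeP; exists (r - normc (c x - c p)); first by rewrite subr_gt0.
  move=> z; rewrite ltrBrDr; apply: le_lt_trans; exact: normc_triangle.
move=> /nbhs_planeP[s s0 sP].
pose G z := F z - e * transition c psi z.
have DG z : normc (z - c x) < s -> is_derive z 1 G (0 : Cplx R).
  move=> /sP[zr zpsi]; have [cz czE _ DF] := rP z zr.
  have Dpsi := psiD c _ cA cz zpsi; rewrite czE in Dpsi.
  have := is_deriveB DF (is_deriveZ e Dpsi).
  by rewrite /GRing.scale /= subrr.
have Gc := derive0_cst DG.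
exists (G (c x)).
have := nbhsI (chart_dom_near ch cx) (chart_cvg ch cx (near_planeW (c x) s0)).
apply: nbhsS => y [cy /= ys].
have [yr _] := sP _ ys; have [_ _ + _] := rP _ yr.
rewrite chart_invK // => ->; congr torus_proj.
rewrite -(Gc _ ys) /G /transition /= chart_invK //.
by rewrite addrC subrK.
Qed.

Definition sheet_at (p : M) (z0 : Cplx R) (r : R) (s : chart R M) (n : nat) :=
  [/\ is_chart s, chart_dom s p, (0 < n)%N,
      s @` chart_dom s = [set w | normc w ^+ n < r] &
      forall x, chart_dom s x -> f x = torus_proj (z0 + s x ^+ n)].

(** The sheet through [p]. The equation [s p ^+ n = z - z0] holds in the plane,
    not only modulo the lattice, because both sides are shorter than 1/2. *)
Lemma sheets (z0 : Cplx R) : exists2 r : R, 0 < r < 2^-1 & forall z p, normc (z - z0) < r ->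
   f p = torus_proj z -> exists s n, [/\ sheet_at p z0 r s n,
     s p ^+ n = z - z0 & ~ gauss_int z0 -> n = 1%N].
Proof.
have [r [S [/andP[r0 r1] _ SE _ SP]]] := cover_f z0.
exists r; first by rewrite r0.
move=> z p zr fp; have : (f @^-1` (@torus_proj R @` ball (z0 : Cplx R) r%:C)) p.
  by exists z; [apply/ball_planeP|].
rewrite SE => -[[s n] Ssn /= sp]; have [[sch _] n0 sim sf s1] := SP _ Ssn.
have simE : s @` chart_dom s = [set w | normc w ^+ n < r].
  by rewrite sim; apply/seteqP; split=> w /=; rewrite norm_normc normcX ltcR.
exists s, n; split=> //.
  have /torus_projP : torus_proj (z0 + s p ^+ n) = torus_proj z by rewrite -sf.
  have spr : normc (s p) ^+ n < r.
    by have : (s @` chart_dom s) (s p) by [exists p]; rewrite simE.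
  move=> g; apply: gauss_close; last exact: lt_trans zr r1.
    by move: g; congr (is_true (gauss_int _)); ring.
  by rewrite normcX; exact: lt_trans r1.
move=> g0; apply: s1 => /= /torus_projP; by rewrite subr0.
Qed.

Lemma f_surj (z : Cplx R) : exists p, f p = torus_proj z.
Proof.
have [r [S [/andP[r0 r1] [[s n] Ssn] _ _ SP]]] := cover_f z.
have [_ /= n0 sim sf _] := SP _ Ssn; have : [set w : Cplx R | `|w ^+ n| < r%:C] 0.
  by rewrite /= expr0n -(prednK n0) normr0 ltcR.
rewrite -[X in X 0]sim => -[p /= sp sp0]; exists p.
by rewrite sf //= sp0 expr0n -(prednK n0) addr0.
Qed.

(** This is the continuity of [f] at [p], the torus being given without a
    topology. *)
Lemma f_near p (z : Cplx R) (e : R) : f p = torus_proj z -> 0 < e ->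
  \forall x \near p, exists2 w, normc (w - z) < e & f x = torus_proj w.
Proof.
move=> fp e0; have [r /andP[r0 _] /(_ z p)] := sheets z.
rewrite subrr normc0 => /(_ r0 fp)[s [n [[sch sp n0 _ sf] sp0 _]]].
have cs : (fun x => s x ^+ n) @ p --> s p ^+ n.
  have := chart_cvg sch sp; move: (s p) => q sq.
  elim: n {n0 sf sp0} => [|n IH]; first exact: cvg_cst.
  under eq_fun do rewrite exprS; rewrite exprS; exact: (@cvgM R[i] M (nbhs p) _ s _ _ _ sq IH).
have := nbhsI (chart_dom_near sch sp) (cs _ (near_planeW _ e0)).
apply: nbhsS => x [sx /=]; rewrite sp0 subr0 => xe.
by exists (z + s x ^+ n); rewrite ?sf // addrC addKr.
Qed.

Lemma f_inj_near p : ~ Sing p -> exists2 U : set M, nbhs p U &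
  forall x y, U x -> U y -> f x = f y -> x = y.
Proof.
move=> pS; have [z fp] := torus_proj_surj (f p).
have gz : ~ gauss_int z.
  by move=> g; apply/pS/sing_torus; rewrite fp; apply/torus_projP; rewrite subr0.
have [r /andP[r0 r1] /(_ z p)] := sheets z.
rewrite subrr normc0 => /(_ r0 fp)[s [n [[sch sp n0 sim sf] sp0 /(_ gz) n1]]].
subst n; exists (chart_dom s); first exact: chart_dom_near.
move=> x y sx sy; rewrite !sf // !expr1 => /torus_projP.
rewrite opprD addrACA subrr add0r => g.
have sr x' : chart_dom s x' -> normc (s x') < r.
  by move=> sx'; have : (s @` chart_dom s) (s x') by [exists x']; rewrite sim /= expr1.
have E : s x = s y by apply: gauss_close g _ _; apply: lt_trans r1; apply: sr.
by rewrite -(chart_invK sch sx) E chart_invK.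
Qed.

(** A pointwise form of even covering, convenient for continuing a lift. Lattice
    points are excluded from the disc so that sections avoid the singularities. *)
Definition sections_of_size (z : Cplx R) (r : R) :=
  forall p, f p = torus_proj z -> exists sg : Cplx R -> M,
    sg z = p /\ forall w, normc (w - z) < r ->
      [/\ ~ gauss_int w, f (sg w) = torus_proj w & sg x @[x --> w] --> sg w].

Lemma sections_near (z0 : Cplx R) : ~ gauss_int z0 -> exists2 r : R, 0 < r &
  forall z d, normc (z - z0) + d <= r -> 0 < d -> sections_of_size z d.
Proof.
move=> g0; have [r /andP[r0 r1] H] := sheets z0; have [e e0 eP] := gauss_avoid g0.
exists (Num.min r e); first by rewrite lt_min r0.
move=> z d; rewrite le_min => /andP[zd ze] d0 p fp.
have zr : normc (z - z0) < r by rewrite (lt_le_trans _ zd) // ltrDl.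
have [s [n [[sch sp n0 sim sf] sp0 /(_ g0) n1]]] := H z p zr fp; subst n.
exists (fun w => chart_inv s (w - z0)).
rewrite expr1 in sp0; split; first by rewrite -sp0 chart_invK.
move=> w wd.
have : (s @` chart_dom s) (w - z0).
  rewrite sim /= expr1; apply: lt_le_trans zd.
  by apply: (le_lt_trans (normc_triangle z _ _)); rewrite addrC ltrD2l.
move=> [x sx xE]; split.
- apply: eP; apply: lt_le_trans ze.
  by apply: (le_lt_trans (normc_triangle z _ _)); rewrite addrC ltrD2l.
- by rewrite -xE chart_invK // sf // xE expr1 addrC subrK.
have cw : (fun w' : Cplx R => w' - z0) @ w --> w - z0.
  apply: cvg_plane => e' e'0; have := near_planeW w e'0; apply: nbhsS => w' /=.
    by rewrite opprB addrA subrK.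
rewrite -xE (chart_invK sch sx); rewrite -xE in cw.
exact: (@cvg_comp _ _ _ (fun w' : Cplx R => w' - z0) (chart_inv s) _ _ _ cw
  (chart_inv_cvg sch sx)).
Qed.

(** A sheet [s] at a regular point is a chart with [ds = e omega], so [e s] is
    flat. To see it, [s] is compared with the primitive [F] of [primitive_near]:
    both lift [f], so that they differ by a constant. *)
Lemma flat_chart_exists p : ~ Sing p -> exists2 psi, flat_chart psi & chart_dom psi p.
Proof.
move=> pS; have [z0 fp] := torus_proj_surj (f p).
have gz : ~ gauss_int z0.
  by move=> g; apply/pS/sing_torus; rewrite fp; apply/torus_projP; rewrite subr0.
have [r0' /andP[r0'0 _] /(_ z0 p)] := sheets z0.
rewrite subrr normc0 => /(_ r0'0 fp)[s [n [[sch sp _ sim sf] sp0 /(_ gz) n1]]].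
subst n; rewrite expr1 in sp0.
have [c cA cp] := rs_cover p; have ch := rs_chart cA.
have [e [F [e1 [r r0 rP]]]] := primitive_near cA cp pS.
have ee : e * e = 1 by case: e1 => ->; rewrite ?mul1r ?mulN1r ?opprK.
have Fc : {for c p, continuous F}.
  have [|_ _ _ [D _]] := rP (c p); first by rewrite subrr normc0.
  exact: derivable_cont D.
have sc : (fun z => s (chart_inv c z)) @ c p --> s p.
  exact: (@cvg_comp _ _ _ (chart_inv c) s _ _ _ (chart_inv_cvg ch cp) (chart_cvg sch sp)).
have h4 : 0 < 4^-1 :> R by rewrite invr_gt0.
have near1 := cvg_plane_near Fc h4.
have near2 := cvg_plane_near sc h4.
have near3 := (chart_near _ ch cp).1 (chart_dom_near sch sp).
have := nbhsI (nbhsI near1 near2) (nbhsI near3 (near_planeW (c p) r0)).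
move=> /nbhs_planeP[q q0 qP].
pose k := F (c p) - s p.
have FE z : normc (z - c p) < q -> F z = s (chart_inv c z) + k.
  move=> zq; have [[n1 n2] [n3 n4]] := qP _ zq.
  have [_ _ f1 _] := rP _ n4.
  have [_ _ f2 _] : [/\ chart_dom c (chart_inv c (c p)), c (chart_inv c (c p)) = c p,
    f (chart_inv c (c p)) = torus_proj (F (c p)) &
    is_derive (c p) 1 F (e * ts_form M c (c p))] by apply: rP; rewrite subrr normc0.
  have g1 : gauss_int (F z - (z0 + s (chart_inv c z))).
    by apply/torus_projP; rewrite -f1 sf // expr1.
  have g2 : gauss_int (F (c p) - (z0 + s p)).
    by apply/torus_projP; rewrite -f2 chart_invK // sf // expr1.
  apply/eqP; rewrite -subr_eq0; apply/eqP/gauss_small.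
    by have := gaussB g1 g2; congr (is_true (gauss_int _)); rewrite /k; ring.
  rewrite (_ : _ - _ = (F z - F (c p)) - (s (chart_inv c z) - s p)); last first.
    by rewrite /k; ring.
  apply: le_lt_trans (le_normcD _ _) _; rewrite normcN.
  have : 4^-1 + 4^-1 < 1 :> R by lra.
  by apply: lt_trans; apply: ltrD.
pose N := interior [set x | [/\ chart_dom c x, chart_dom s x, ~ Sing x & normc (c x - c p) < q]].
have Ns : N `<=` chart_dom s by move=> x /interior_subset[].
have Np : N p.
  have := nbhsI (nbhsI (chart_dom_near ch cp) (chart_dom_near sch sp))
    (nbhsI (open_nbhs_nbhs (conj open_regular pS)) (chart_cvg ch cp (near_planeW (c p) q0))).
  by apply: nbhsS => x [[? ?] [? ?]].
pose psi := @Chart R M N (fun x => e * s x) (fun z => chart_inv s (e * z)).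
have eK z : e * (e * z) = z by rewrite mulrA ee mul1r.
exists psi; last exact: Np.
split.
- split; first exact: open_interior.
  + rewrite continuous_open_subspace; last exact: open_interior.
    move=> x; rewrite inE => Nx; apply: cvg_plane => d d0.
    have := cvg_plane_near (chart_cvg sch (Ns _ Nx)) d0.
    by apply: nbhsS => y /=; rewrite -mulrBr normc_sign.
  + by move=> x; rewrite inE => Nx; rewrite /= eK chart_invK //; apply: Ns.
  + move=> U oU UN.
    have -> : (fun x => e * s x) @` U = (fun z : Cplx R => e * z) @^-1` (s @` U).
      apply/seteqP; split=> [_ [x Ux <-]|z [x Ux xE]] /=; first by exists x; rewrite ?eK.
      by exists x => //=; rewrite xE eK.
    apply: open_comp; last by have [_ _ _] := sch; apply=> // x /UN /Ns.
    move=> z _; apply: cvg_plane => d d0; have := near_planeW z d0.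
    by apply: nbhsS => w /=; rewrite -mulrBr normc_sign.
- by move=> x /interior_subset[].
move=> c' x c'A c'x Nx; have ch' := rs_chart c'A.
have [cx sx _ xq] := interior_subset Nx.
have Tx := rs_holo c'A cA c'x cx.
have DT : is_derive (c' x) 1 (transition c' c) (derive1 (transition c' c) (c' x)).
  by rewrite derive1E; apply: derivableP.
have [_ _ _ DF] := rP _ (qP _ xq).2.2.
rewrite (form_change (ts_form M) c'A cA c'x cx).
have -> : ts_form M c (c x) = e * (e * ts_form M c (c x)) by rewrite eK.
have DF' : is_derive (c x) 1 (fun z => e * F z - e * k) (e * (e * ts_form M c (c x))).
  apply/derive_planeP => d d0; have [q' q'0 q'P] := (derive_planeP _ _ _).1 DF d d0.
  exists q' => // h /q'P; rewrite -[X in X <= _](normc_sign _ e1).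
  by congr (is_true (normc _ <= _)); ring.
have TE : transition c' c (c' x) = c x by rewrite /transition /comp chart_invK.
have DF'' : is_derive (transition c' c (c' x)) 1 (fun z => e * F z - e * k)
  (e * (e * ts_form M c (c x))) by rewrite TE.
apply: (near_eq_is_derive _ (is_derive_comp_plane DT DF'')).
have := nbhsI (nbhsI (chart_dom_near ch cx) (chart_dom_near ch' c'x))
  (chart_cvg ch cx (near_planeW (c x) (_ : 0 < q - normc (c x - c p)))).
rewrite subr_gt0 => /(_ xq) Hx.
apply: nbhsS ((chart_near _ ch' c'x).1 Hx) => z [[cz c'z] /=].
rewrite ltrBrDr => zq; rewrite /transition /= FE; first by rewrite chart_invK //; ring.
by apply: le_lt_trans zq; apply: normc_triangle.
Qed.

End FlatCharts.

(** * Lifting star-shaped sets through the covering *)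

Section Within.
Variables (X Y : topologicalType).
Implicit Types (A : set X) (g : X -> Y).

Lemma within_nbhs A g x (U : set Y) : {within A, continuous g} -> A x ->
  nbhs (g x) U -> nbhs x [set y | A y -> U (g y)].
Proof.
move=> /subspace_continuousP gc Ax Ux; have K := gc x Ax U Ux; exact: K.
Qed.

Lemma within_nbhsP A g :
  (forall x (U : set Y), A x -> nbhs (g x) U -> nbhs x [set y | A y -> U (g y)]) ->
  {within A, continuous g}.
Proof.
by move=> H; apply/subspace_continuousP => x Ax U Ux; have K := H x U Ax Ux; exact: K.
Qed.

Lemma within_sub A B g : A `<=` B -> {within B, continuous g} -> {within A, continuous g}.
Proof. by move=> AB; apply: continuous_subspaceW. Qed.

End Within.

Lemma within_comp (X Y Z : topologicalType) (A : set X) (B : set Y)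
    (h : X -> Y) (g : Y -> Z) :
  (forall x, A x -> B (h x)) -> (forall x, A x -> h y @[y --> x] --> h x) ->
  {within B, continuous g} -> {within A, continuous (fun x => g (h x))}.
Proof.
move=> hB hc gc; apply: within_nbhsP => x U Ax Ux.
have := hc x Ax _ (within_nbhs gc (hB x Ax) Ux).
by apply: nbhsS => y /= H Ay; apply: H; apply: hB.
Qed.

Section Affine.
Variable R : realType.
Implicit Types (z h a : Cplx R) (t l : R).

Lemma near_real t (e : R) : 0 < e -> \forall s \near t, `|s - t| < e.
Proof.
move=> e0; apply/nbhs_normP; exists e => //= s; by rewrite /ball_/= distrC.
Qed.

Lemma affine_cvg z h t : (fun s : R => z + s%:C * h) s @[s --> t] --> z + t%:C * h.
Proof.
apply: cvg_plane => e e0.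
have d0 : 0 < e / (normc h + 1) by rewrite divr_gt0 // ltr_wpDl ?normc_ge0.
have := near_real t d0; apply: nbhsS => s /=.
rewrite ltr_pdivlMr ?ltr_wpDl ?normc_ge0 //; apply: le_lt_trans.
rewrite opprD addrACA subrr add0r -mulrBl -rmorphB normcM normc_real.
by rewrite mulrDr mulr1 lerDl.
Qed.

Lemma unit_connected : connected [set t : R | 0 <= t <= 1].
Proof.
apply/connected_intervalP => x y /= /andP[x0 _] /andP[_ y1] z /andP[xz zy].
by rewrite (le_trans x0 xz) (le_trans zy y1).
Qed.

Lemma open_unit_connected : connected [set t : R | 0 < t < 1].
Proof.
apply/connected_intervalP => x y /= /andP[x0 _] /andP[_ y1] z /andP[xz zy].
by rewrite (lt_le_trans x0 xz) (le_lt_trans zy y1).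
Qed.

Lemma ltW01 t : 0 < t < 1 -> 0 <= t <= 1.
Proof. by case/andP => t0 t1; rewrite !ltW. Qed.

Lemma near_unit t : 0 < t < 1 -> \forall s \near t, 0 <= s <= 1.
Proof.
move=> t01; have : nbhs t [set` `]0, 1[] by apply: near_in_itvoo; rewrite in_itv.
by apply: nbhsS => s /=; rewrite in_itv /=; apply: ltW01.
Qed.

Lemma itv01 : [set` `[(0:R), 1]] = [set t | 0 <= t <= 1].
Proof. by apply/seteqP; split=> t; rewrite /= in_itv. Qed.

Lemma approach (t : R) (e : R) : 0 <= t <= 1 -> 0 < e ->
  exists2 s, 0 < s < 1 & `|s - t| < e.
Proof.
move=> /andP[t0 t1] e0; pose h := Num.min (e / 2) (4^-1 : R).
have h0 : 0 < h by rewrite lt_min divr_gt0 //= invr_gt0.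
have h4 : h <= 4^-1 by rewrite ge_min lexx orbT.
have he : h < e by rewrite gt_min ltr_pdivrMr // ltr_pMr // ltr1n.
have [t2|t2] := lerP t 2^-1.
  exists (t + h); last by rewrite addrC addKr gtr0_norm.
  by apply/andP; split; lra.
exists (t - h); last by rewrite addrC addKr normrN gtr0_norm.
by apply/andP; split; lra.
Qed.

Definition homoth a l z := a + l%:C * (z - a).

Lemma homoth0 a z : homoth a 0 z = a.
Proof. by rewrite /homoth mul0r addr0. Qed.

Lemma homoth1 a z : homoth a 1 z = z.
Proof. by rewrite /homoth mul1r addrC subrK. Qed.

Lemma homoth_id a l : homoth a l a = a.
Proof. by rewrite /homoth subrr mulr0 addr0. Qed.

Lemma homothB a l l' z : homoth a l z - homoth a l' z = (l - l')%:C * (z - a).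
Proof. by rewrite /homoth rmorphB /=; ring. Qed.

Lemma homoth_dist a l y z : 0 <= l <= 1 ->
  normc (homoth a l y - homoth a l z) <= normc (y - z).
Proof.
move=> /andP[l0 l1].
rewrite (_ : _ - _ = l%:C * (y - z)); last by rewrite /homoth; ring.
by rewrite normcM normc_real ger0_norm // ler_piMl ?normc_ge0.
Qed.

Lemma ball_convex x y c (d : R) t : normc (x - c) < d -> normc (y - c) < d ->
  0 <= t <= 1 -> normc (homoth x t y - c) < d.
Proof.
move=> xd yd /andP[t0 t1].
rewrite (_ : _ - _ = (1 - t)%:C * (x - c) + t%:C * (y - c)); last first.
  by rewrite /homoth rmorphB /=; ring.
apply: le_lt_trans (le_normcD _ _) _; rewrite !normcM !normc_real !ger0_norm ?subr_ge0 //.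
pose m := Num.max (normc (x - c)) (normc (y - c)).
apply: (@le_lt_trans _ _ m); last by rewrite gt_max xd yd.
have -> : m = (1 - t) * m + t * m by ring.
by apply: lerD; apply: ler_wpM2l; rewrite ?subr_ge0 // le_max lexx ?orbT.
Qed.

Definition star_shaped (K : set (Cplx R)) a :=
  forall z l, K z -> 0 <= l <= 1 -> K (homoth a l z).

End Affine.

Section Lifting.
Variables (R : realType) (M : translation_surface R) (f : M -> torus R).
Hypothesis cover_f : ramified_covering f [set torus_proj 0].
Hypothesis sing_f : ts_sing M = f @^-1` [set torus_proj 0].
Local Notation Sing := (ts_sing M).

Lemma nbhs_separate (p q : M) : p <> q -> exists (U V : set M),
  [/\ nbhs p U, nbhs q V & forall x, U x -> V x -> False].
Proof.
move=> pq; apply: contrapT => H; apply: pq; apply: (@rs_hausdorff R M p q).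
move=> U V pU qV; apply: contrapT => H'; apply: H; exists U, V; split=> // x Ux Vx.
by apply: H'; exists x.
Qed.

(** The points where the two lifts agree form an open set, as [f] is locally
    injective off the singularities, and a closed one, as [M] is separated. *)
Lemma lift_unique (X : topologicalType) (A : set X) (g1 g2 : X -> M) x0 :
  connected A -> {within A, continuous g1} -> {within A, continuous g2} ->
  (forall x, A x -> f (g1 x) = f (g2 x)) -> (forall x, A x -> ~ Sing (g1 x)) ->
  A x0 -> g1 x0 = g2 x0 -> forall x, A x -> g1 x = g2 x.
Proof.
move=> cA c1 c2 fE nS Ax0 E0 x Ax.
apply: (@connected_locally_constant X A (fun x => g1 x = g2 x) cA _ x0 x) => //.
move=> {E0 Ax} y Ay; have [E|NE] := pselect (g1 y = g2 y).
  have [U Uy Uinj] := f_inj_near cover_f sing_f (nS y Ay).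
  have U2 : nbhs (g2 y) U by rewrite -E.
  have := nbhsI (within_nbhs c1 Ay Uy) (within_nbhs c2 Ay U2).
  apply: nbhsS => z [h1 h2] Az; split=> // _.
  by apply: Uinj; [apply: h1|apply: h2|apply: fE].
have [U [V [Uy Vy UV]]] := nbhs_separate NE.
have := nbhsI (within_nbhs c1 Ay Uy) (within_nbhs c2 Ay Vy).
apply: nbhsS => z [h1 h2] Az; split=> // E; exfalso.
by apply: (UV (g1 z)); [apply: h1|rewrite E; apply: h2].
Qed.

Lemma regular_of_proj p w : f p = torus_proj w -> ~ gauss_int w -> ~ Sing p.
Proof.
by move=> fp gw /(sing_torus sing_f); rewrite fp => /torus_projP; rewrite subr0.
Qed.

Lemma lift_unique_segment (B1 B2 : set (Cplx R)) (s1 s2 : Cplx R -> M) (z w : Cplx R) :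
  {within B1, continuous s1} -> {within B2, continuous s2} ->
  (forall t : R, 0 <= t <= 1 ->
     [/\ B1 (homoth z t w), B2 (homoth z t w), ~ gauss_int (homoth z t w),
         f (s1 (homoth z t w)) = torus_proj (homoth z t w) &
         f (s2 (homoth z t w)) = torus_proj (homoth z t w)]) ->
  s1 z = s2 z -> s1 w = s2 w.
Proof.
move=> c1 c2 H E0.
have hc (t : R) : [set t : R | 0 <= t <= 1] t ->
    homoth z s w @[s --> t] --> homoth z t w by move=> _; apply: affine_cvg.
have := @lift_unique R [set t : R | 0 <= t <= 1] (fun t => s1 (homoth z t w))
  (fun t => s2 (homoth z t w)) 0 (@unit_connected R).
move=> /(_ _ _ _ _ _ _ 1); rewrite /= homoth1; apply; rewrite ?homoth0 ?lexx ?ler01 //.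
- by apply: (within_comp _ hc c1) => t /H[].
- by apply: (within_comp _ hc c2) => t /H[].
- by move=> t /H[_ _ _ -> ->].
- by move=> t /H[_ _ g1 /regular_of_proj h _]; apply: h.
Qed.

(** A Lebesgue number for the discs of [sections_near]. *)
Lemma uniform_sections (K : set (Cplx R)) : compact K -> (forall z, K z -> ~ gauss_int z) ->
  exists2 d : R, 0 < d & forall z, K z -> sections_of_size f z d.
Proof.
move=> /compact_near_coveringP cK gK.
have := cK R (nbhs 0^'+) (fun d z => 0 < d -> sections_of_size f z d) _.
case=> [x Kx|d /= d0 dP].
  have [r r0 rP] := sections_near cover_f (gK x Kx).
  have r2 : 0 < r / 2 by rewrite divr_gt0.
  exists ([set z | normc (z - x) < r / 2], [set d : R | d < r / 2]) => /=.
    by split; [exact: near_planeW | exact: nbhs_right_lt].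
  move=> [z d] /= [zx dr] d0; apply: rP => //.
  by rewrite (splitr r) lerD ?ltW.
exists (d / 2); first by rewrite divr_gt0.
have d2 : 0 < d / 2 by rewrite divr_gt0.
move=> z Kz; apply: (dP (d / 2)) => //=.
by rewrite sub0r normrN gtr0_norm // ltr_pdivrMr // ltr_pMr // ltr1n.
Qed.

Lemma section_within (z : Cplx R) (r : R) (sg : Cplx R -> M) :
  (forall w : Cplx R, normc (w - z) < r -> [/\ ~ gauss_int w, f (sg w) = torus_proj w &
     sg x @[x --> w] --> sg w]) ->
  {within [set w | normc (w - z) < r], continuous sg}.
Proof.
move=> H; apply: within_nbhsP => x U /H[_ _ sc] Ux.
by have K : nbhs x (sg @^-1` U) := sc U Ux; move: K; apply: nbhsS => y Uy _.
Qed.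

(** The homotheties of centre [a] shrink [K] to [a], where the lift is constant.
    The ratio is increased from 0 to 1 by steps so small that each point moves
    inside a disc carrying a section of [f], along which the lift is continued. *)
Lemma lift_compact (K : set (Cplx R)) (a : Cplx R) p (L : R) :
  compact K -> K a -> star_shaped K a -> (forall z, K z -> ~ gauss_int z) ->
  (forall z, K z -> normc (z - a) < L) -> f p = torus_proj a ->
  exists phi : Cplx R -> M, [/\ phi a = p, {within K, continuous phi} &
    forall z, K z -> f (phi z) = torus_proj z].
Proof.
move=> cK Ka stK gK KL fp.
have [d d0 dP] := uniform_sections cK gK.
have L0 : 0 < L by have := KL a Ka; rewrite subrr normc0.
pose lift l := exists phi : Cplx R -> M, [/\ phi a = p, {within K, continuous phi} &
    forall z, K z -> f (phi z) = torus_proj (homoth a l z)].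
suff : lift 1.
  by case=> phi [pa pc pf]; exists phi; split=> // z Kz; rewrite pf // homoth1.
have step l l' : 0 <= l <= 1 -> 0 <= l' <= 1 -> `|l' - l| * L < d -> lift l -> lift l'.
  move=> l01 l'01 ll' [phi [pa pc pf]].
  have /choice[sg sgP] : forall z, exists s : Cplx R -> M, K z ->
      s (homoth a l z) = phi z /\ forall w, normc (w - homoth a l z) < d ->
      [/\ ~ gauss_int w, f (s w) = torus_proj w & s x @[x --> w] --> s w].
    move=> z; have [Kz|nKz] := pselect (K z); last by exists (fun=> p).
    by have [s sP] := dP _ (stK z l Kz l01) _ (pf z Kz); exists s.
  have close z : K z -> normc (homoth a l' z - homoth a l z) < d.
    move=> Kz; rewrite homothB normcM normc_real; apply: le_lt_trans ll'.
    by apply: ler_wpM2l => //; apply: ltW; apply: KL.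
  exists (fun z => sg z (homoth a l' z)); split.
  - rewrite homoth_id; have [+ _] := sgP a Ka; rewrite homoth_id => ->; exact: pa.
  - apply: within_nbhsP => y U Ky Uy.
    have [sy0 syP] := sgP y Ky.
    have [_ fsy csy] := syP _ (close y Ky).
    have [gy fy cy] : [/\ ~ gauss_int (homoth a l y),
        f (sg y (homoth a l y)) = torus_proj (homoth a l y) &
        sg y x @[x --> homoth a l y] --> sg y (homoth a l y)].
      by apply: syP; rewrite subrr normc0.
    have [V Vy Vinj] := f_inj_near cover_f sing_f (regular_of_proj (pf y Ky) gy).
    have hc m : 0 <= m <= 1 -> homoth a m x @[x --> y] --> homoth a m y.
      move=> m01; apply: cvg_plane => e e0; have := near_planeW y e0; apply: nbhsS => x /=.
      by apply: le_lt_trans; apply: homoth_dist.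
    have n1 := within_nbhs pc Ky Vy.
    have n2 : nbhs y [set z | V (sg y (homoth a l z))].
      have Vy' : nbhs (sg y (homoth a l y)) V by rewrite sy0.
      have K1 := hc l l01 _ (cy _ Vy'); exact: K1.
    have n3 : nbhs y [set z | U (sg y (homoth a l' z))].
      have K1 := hc l' l'01 _ (csy _ Uy); exact: K1.
    have e0 : 0 < d - normc (homoth a l' y - homoth a l y) by rewrite subr_gt0 close.
    have n4 := near_planeW y e0.
    have := nbhsI (nbhsI n1 n2) (nbhsI n3 n4); apply: nbhsS => z [[h1 h2] [h3 h4]] Kz /=.
    rewrite /= in h1 h2 h3 h4.
    (* The sections chosen at [z] and at [y] agree at [homoth a l z], hence on
       the whole segment to [homoth a l' z]: continuity is that of one section. *)
    suff -> : sg z (homoth a l' z) = sg y (homoth a l' z) by [].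
    have [sz0 szP] := sgP z Kz.
    have lz : normc (homoth a l z - homoth a l y) < d.
      apply: le_lt_trans (homoth_dist _ _ _ l01) _; apply: lt_le_trans h4 _.
      by rewrite lerBlDr lerDl normc_ge0.
    have l'z : normc (homoth a l' z - homoth a l y) < d.
      apply: le_lt_trans (normc_triangle (homoth a l' y) _ _) _.
      rewrite -ltrBrDr; apply: le_lt_trans (homoth_dist _ _ _ l'01) h4.
    apply: (lift_unique_segment (section_within szP) (section_within syP)
      (z := homoth a l z)); last first.
      rewrite sz0; apply: Vinj; [exact: h1|exact: h2|].
      by rewrite pf //; have [_ -> _] := syP _ lz.
    move=> t t01 /=.
    have b1 : normc (homoth (homoth a l z) t (homoth a l' z) - homoth a l z) < d.
      by apply: ball_convex => //; rewrite ?subrr ?normc0 //; apply: close.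
    have b2 : normc (homoth (homoth a l z) t (homoth a l' z) - homoth a l y) < d.
      exact: ball_convex.
    by split=> //; [have [] := szP _ b1|have [_ + _] := szP _ b1|have [_ + _] := syP _ b2].
  - by move=> z Kz; have [_ szP] := sgP z Kz; have [_ + _] := szP _ (close z Kz).
pose N := (Num.truncn (L / d)).+1.
have N0 : 0 < N%:R :> R by rewrite ltr0n.
have LN : L / N%:R < d.
  by rewrite ltr_pdivrMr // -ltr_pdivrMl // mulrC; apply: truncnS_gt.
suff H k : (k <= N)%N -> lift (k%:R / N%:R) by have := H N (leqnn N); rewrite divff ?gt_eqF.
have bnd j : (j <= N)%N -> 0 <= j%:R / N%:R :> R /\ j%:R / N%:R <= 1 :> R.
  by move=> jN; split; [exact: divr_ge0|rewrite ler_pdivrMr // mul1r ler_nat].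
elim: k => [_|k IH kN].
  rewrite mul0r; exists (fun=> p); split=> // [|z _]; last by rewrite homoth0.
  apply: within_nbhsP => x U _ /nbhs_singleton Up.
  have K1 : nbhs x setT by exact: filterT.
  by move: K1; apply: nbhsS => y ? ?.
have [k0 k1] := bnd _ (ltnW kN); have [k0' k1'] := bnd _ kN.
apply: (step (k%:R / N%:R)); rewrite ?k0 ?k1 ?k0' ?k1' //; last exact: IH (ltnW kN).
rewrite -mulrBl -natrB // subSnn mul1r ger0_norm ?invr_ge0 ?(ltW N0) //.
by rewrite mulrC.
Qed.

(** The lifts over the compact pieces [K] agree where they overlap, since both
    are determined along the segment from [a]. *)
Lemma lift_exhaust (A : set (Cplx R)) (a : Cplx R) p :
  A a -> f p = torus_proj a -> (forall z, A z -> ~ gauss_int z) ->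
  (forall y, A y -> exists K L, [/\ compact K, star_shaped K a, K `<=` A,
     forall z, K z -> normc (z - a) < L & nbhs y [set z | A z -> K z]]) ->
  exists phi : Cplx R -> M, [/\ phi a = p, {within A, continuous phi} &
    forall z, A z -> f (phi z) = torus_proj z].
Proof.
move=> Aa fp gA exh.
have /choice[phi phiP] : forall y, exists g : Cplx R -> M, A y ->
    exists2 K, star_shaped K a /\ K `<=` A & [/\ nbhs y [set z | A z -> K z], g a = p,
      {within K, continuous g} & forall z, K z -> f (g z) = torus_proj z].
  move=> y; have [Ay|nAy] := pselect (A y); last by exists (fun=> p).
  have [K [L [cK stK KA KL nK]]] := exh y Ay.
  have Ky : K y := nbhs_singleton nK Ay.
  have Ka : K a by rewrite -(homoth0 a y); apply: stK => //; rewrite lexx ler01.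
  have [g [ga gc gf]] := lift_compact cK Ka stK (fun z Kz => gA z (KA z Kz)) KL fp.
  by exists g => _; exists K.
exists (fun z => phi z z); split.
- by have [K _ []] := phiP a Aa.
- apply: within_nbhsP => y U Ay Uy.
  have [K [stK KA] [nK ga gc gf]] := phiP y Ay.
  have Ky : K y := nbhs_singleton nK Ay.
  have := nbhsI nK (within_nbhs gc Ky Uy); apply: nbhsS => z [h1 h2] Az.
  have Kz := h1 Az.
  have [K' [stK' KA'] [nK' ga' gc' gf']] := phiP z Az.
  have Kz' : K' z := nbhs_singleton nK' Az.
  suff -> : phi z z = phi y z by exact: h2.
  apply: (lift_unique_segment gc' gc (z := a)); last by rewrite ga ga'.
  move=> t t01; have k1 := stK' z t Kz' t01; have k2 := stK z t Kz t01.
  by split=> //; [apply/gA/KA|apply: gf'|apply: gf].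
- move=> z Az; have [K [stK KA] [nK ga gc gf]] := phiP z Az.
  by apply: gf; exact: nbhs_singleton nK Az.
Qed.

(** Near a lattice point [q] the set is connected, so that the lift stays in a
    single sheet [s]. There [|s| ^+ n = |z - q|], which tends to 0: the lift
    converges to the centre of the sheet, whatever the branch of the root. *)
Lemma puncture_limit (A : set (Cplx R)) (q : Cplx R) (phi : Cplx R -> M) :
  gauss_int q -> {within A, continuous phi} ->
  (forall z, A z -> f (phi z) = torus_proj z) ->
  (forall r : R, 0 < r -> (A `&` [set z | normc (z - q) < r]) !=set0) ->
  (forall r : R, 0 < r -> connected (A `&` [set z | normc (z - q) < r])) ->
  exists2 P, Sing P & forall U : set M, nbhs P U -> nbhs q [set z | A z -> U (phi z)].
Proof.
move=> gq pc pf ne cn.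
have [r [S [/andP[r0 r1] _ SE tS SP]]] := cover_f q.
pose B := A `&` [set z | normc (z - q) < r].
have inS z : B z -> exists2 s, S s & chart_dom s.1 (phi z).
  move=> [Az zr]; suff : (f @^-1` (@torus_proj R @` ball (q : Cplx R) r%:C)) (phi z).
    by rewrite SE.
  by exists z; [apply/ball_planeP|rewrite pf].
have [z0 Bz0] := ne r r0; have [s0 Ss0 s0z0] := inS z0 Bz0.
have inS0 z : B z -> chart_dom s0.1 (phi z).
  move=> Bz; apply: (@connected_locally_constant _ B (fun z => chart_dom s0.1 (phi z))
    (cn r r0) _ z0 z) => // {z Bz} z Bz.
  have [s Ss sz] := inS z Bz; have [[sch _] _ _ _ _] := SP s Ss.
  have pcB : {within B, continuous phi} by apply: within_sub pc; move=> x [].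
  have := within_nbhs pcB Bz (chart_dom_near sch sz).
  apply: nbhsS => w sw Bw; split=> h.
    have -> : s0 = s by apply: tS => //; exists (phi w); split=> //; apply: sw.
    by [].
  have -> : s0 = s by apply: tS => //; exists (phi z).
  exact: sw.
have [[sch _] n0 sim sf _] := SP _ Ss0.
have [P sP sP0] : (s0.1 @` chart_dom s0.1) 0.
  by rewrite sim /= expr0n -(prednK n0) normr0 ltcR.
exists P.
  apply/(sing_torus sing_f); rewrite sf // sP0 expr0n -(prednK n0) addr0.
  by apply/torus_projP; rewrite subr0.
move=> U UP.
have /nbhs_planeP[d d0 dP] : nbhs (0 : Cplx R) [set w | U (chart_inv s0.1 w)].
  by rewrite -sP0; have K := chart_inv_cvg sch sP UP; exact: K.
have m0 : 0 < Num.min r (d ^+ s0.2) by rewrite lt_min r0 exprn_gt0.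
have := near_planeW q m0; apply: nbhsS => z /=; rewrite lt_min => /andP[zr zd] Az.
have Bz : B z by split.
have sz := inS0 z Bz.
rewrite -(chart_invK sch sz); apply: dP; rewrite subr0.
suff E : s0.1 (phi z) ^+ s0.2 = z - q.
  by rewrite -E normcX ltr_pXn2r ?nnegrE ?normc_ge0 ?(ltW d0) in zd.
have /torus_projP g : torus_proj (q + s0.1 (phi z) ^+ s0.2) = torus_proj z.
  by rewrite -sf // pf.
have spr : normc (s0.1 (phi z) ^+ s0.2) < r.
  have : (s0.1 @` chart_dom s0.1) (s0.1 (phi z)) by exists (phi z).
  by rewrite sim /= norm_normc ltcR.
apply: gauss_close; [|exact: lt_trans r1|exact: lt_trans zr r1].
by move: g; congr (is_true (gauss_int _)); ring.
Qed.

End Lifting.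

(** * Developing paths into the plane *)

Section TriangleCoordinates.
Variable R : realType.
Implicit Types (p q z u v : Cplx R) (a b c t : R).

Lemma comb_inj u v b c b' c' : cross u v != 0 ->
  b%:C * u + c%:C * v = b'%:C * u + c'%:C * v -> b = b' /\ c = c'.
Proof.
move=> uv E; split.
  by apply: (mulIf uv); rewrite -(cross_comb u v b c) E cross_comb.
by apply: (mulIf uv); rewrite -(cross_comb_r u v b c) E cross_comb_r.
Qed.

Definition tri_point p0 p1 p2 b c := p0 + (b%:C * (p1 - p0) + c%:C * (p2 - p0)).

Definition tri_coord b c := [/\ 0 <= b, 0 <= c & b + c <= 1].

Definition tri_vertex b c := [\/ b = 0 /\ c = 0, b = 1 /\ c = 0 | b = 0 /\ c = 1].

Lemma non_collinearE p0 p1 p2 :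
  non_collinear p0 p1 p2 = (cross (p1 - p0) (p2 - p0) != 0).
Proof. by rewrite /non_collinear /cross subr_eq0. Qed.

Lemma triangleP p0 p1 p2 z : triangle p0 p1 p2 z <->
  exists b c, tri_coord b c /\ z = tri_point p0 p1 p2 b c.
Proof.
split=> [[a [b [c [a0 b0 c0 abc ->]]]]|[b [c [[b0 c0 bc] ->]]]].
  exists b, c; split.
    by split=> //; rewrite -abc -addrA lerDr.
  have -> : a = 1 - b - c by rewrite -abc; ring.
  by rewrite /tri_point !rmorphB rmorph1; ring.
exists (1 - b - c), b, c; split=> //; first by rewrite -addrA -opprD subr_ge0.
  by ring.
by rewrite /tri_point !rmorphB rmorph1; ring.
Qed.

Lemma tri_point_vertex p0 p1 p2 b c : non_collinear p0 p1 p2 ->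
  [set p0; p1; p2] (tri_point p0 p1 p2 b c) <-> tri_vertex b c.
Proof.
rewrite non_collinearE => nc; set u := p1 - p0 in nc *; set v := p2 - p0 in nc *.
have E z b' c' : z - p0 = b'%:C * u + c'%:C * v ->
    tri_point p0 p1 p2 b c = z -> b = b' /\ c = c'.
  move=> zE tE; apply: (comb_inj nc); rewrite -zE -tE /tri_point.
  by rewrite [p0 + _]addrC addrK.
split.
  move=> [[]|] tE.
  - by apply: Or31; apply: (E _ _ _ _ tE); rewrite subrr !mul0r addr0.
  - by apply: Or32; apply: (E _ _ _ _ tE); rewrite mul1r mul0r addr0.
  - by apply: Or33; apply: (E _ _ _ _ tE); rewrite mul1r mul0r add0r.
rewrite /tri_point -/u -/v; case=> [][-> ->].
- by left; left; rewrite /= !mul0r !addr0.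
- by left; right; rewrite /= mul1r mul0r addr0 /u addrC subrK.
- by right; rewrite /= mul1r mul0r add0r /v addrC subrK.
Qed.

Lemma tri_regularP p0 p1 p2 z : non_collinear p0 p1 p2 ->
  (triangle p0 p1 p2 `\` [set p0; p1; p2]) z <->
  exists b c, [/\ tri_coord b c, ~ tri_vertex b c & z = tri_point p0 p1 p2 b c].
Proof.
move=> nc; split=> [[/triangleP[b [c [bc ->]]] nv]|[b [c [bc nv ->]]]].
  by exists b, c; split=> // /(tri_point_vertex _ _ nc).
by split; [apply/triangleP; exists b, c|move=> /(tri_point_vertex _ _ nc)].
Qed.

Lemma tri_homoth p0 p1 p2 b c t :
  homoth p0 t (tri_point p0 p1 p2 b c) = tri_point p0 p1 p2 (t * b) (t * c).
Proof. by rewrite /homoth /tri_point !rmorphM /=; ring. Qed.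

End TriangleCoordinates.

Section Development.
Variables (R : realType) (M : translation_surface R) (f : M -> torus R).
Hypothesis cover_f : ramified_covering f [set torus_proj 0].

(** The pair of the sign [e] and the class of [k] modulo the lattice is locally
    constant by [sign_rigid], hence constant on the open interval; the ends
    follow since the lattice is closed. *)
Lemma development (theta : R -> M) (v : Cplx R) : v != 0 ->
  {within `[0, 1], continuous theta} ->
  (forall t : R, 0 < t < 1 -> exists e k : Cplx R, (e = 1 \/ e = -1) /\
     \forall s \near t, f (theta s) = torus_proj (e * (s%:C * v) + k)) ->
  exists e k : Cplx R, (e = 1 \/ e = -1) /\
    forall t : R, 0 <= t <= 1 -> f (theta t) = torus_proj (e * (t%:C * v) + k).
Proof.
rewrite itv01 => v0 tc loc.
have h2 : 0 < (2^-1 : R) < 1 by rewrite invr_gt0 ltr0n invf_lt1 // ltr1n.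
have [e [k [e1 ek]]] := loc _ h2; exists e, k; split=> //.
pose P (t : R) := \forall s \near t, f (theta s) = torus_proj (e * (s%:C * v) + k).
have PI t : 0 < t < 1 -> P t.
  move=> t01; have cI := @open_unit_connected R.
  apply: (connected_locally_constant (P := P) cI _ h2 t01 ek) => {t01} t t01.
  have [e' [k' [e1' ek']]] := loc t t01.
  have [Pt|nPt] := pselect (P t).
    by have := nbhs_nbhs Pt; apply: nbhsS => y Py _; split.
  have := nbhs_nbhs ek'; apply: nbhsS => y yt _; split=> [Py|//].
  have E : \forall s \near y, gauss_int (e * (s%:C * v) - e' * (s%:C * v) + (k - k')).
    have := nbhsI Py yt; apply: nbhsS => s [h1 h3].
    have /torus_projP : torus_proj (e * (s%:C * v) + k) = torus_proj (e' * (s%:C * v) + k').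
      by rewrite -h1 h3.
    by congr (is_true (gauss_int _)); ring.
  have ee := sign_rigid v0 e1 e1' E; subst e'.
  have := ek'; apply: nbhsS => s ->; apply/torus_projP.
  have := gaussN (nbhs_singleton E); congr (is_true (gauss_int _)); ring.
move=> t t01; have [w fw] := torus_proj_surj (f (theta t)).
rewrite fw; apply/torus_projP; apply: gauss_limit => d d0.
have d2 : 0 < d / 2 by rewrite divr_gt0.
have n1 := within_nbhs tc t01 (f_near cover_f fw d2).
have n2 := cvg_plane_near (@affine_cvg R 0 v t) d2.
have /nbhs_normP[r /= r0 rP] := nbhsI n1 n2.
have [s s01 sr] := approach t01 r0.
have [|+ n4] := rP s; first by rewrite /ball_ /= distrC.
have s01' := ltW01 s01.
move=> /(_ s01')[w' ww' fw'].
have /torus_projP g : torus_proj w' = torus_proj (e * (s%:C * v) + k).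
  by have /nbhs_singleton <- := PI s s01; rewrite fw'.
exists (w' - (e * (s%:C * v) + k)) => //.
rewrite (_ : _ - _ = (w' - w) - e * ((0 + s%:C * v) - (0 + t%:C * v))); last by ring.
rewrite (splitr d); apply: le_lt_trans (le_normcD _ _) _.
by rewrite normcN (normc_sign _ e1); apply: ltrD.
Qed.

End Development.

(** * Saddle connections, affine homeomorphisms and embedded triangles *)

Section MatrixAction.
Variable R : realType.
Implicit Types (A : 'M[R]_2) (z w : Cplx R).

Lemma mx_actD A z w : mx_act A (z + w) = mx_act A z + mx_act A w.
Proof.
by case: z => a b; case: w => c d; apply/eqP; rewrite eq_complex /=; apply/andP;
  split; apply/eqP; ring.
Qed.

Lemma mx_actZ A (t : R) z : mx_act A (t%:C * z) = t%:C * mx_act A z.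
Proof.
by case: z => a b; apply/eqP; rewrite eq_complex /=; apply/andP; split; apply/eqP; ring.
Qed.

Lemma mx_act_sign A (e z : Cplx R) : e = 1 \/ e = -1 -> mx_act A (e * z) = e * mx_act A z.
Proof.
case=> ->; rewrite ?mul1r // !mulN1r; case: z => a b.
by apply/eqP; rewrite eq_complex /=; apply/andP; split; apply/eqP; ring.
Qed.

Lemma slope_sign (v w : Cplx R) : v = w \/ v = - w -> slope v = slope w.
Proof.
case=> -> //; case: w => a b; rewrite /slope /= oppr_eq0; case: ifP => // b0.
by rewrite invrN mulrNN.
Qed.

End MatrixAction.

Section Paths.
Variables (R : realType) (M : translation_surface R) (f : M -> torus R).
Hypothesis cover_f : ramified_covering f [set torus_proj 0].
Hypothesis sing_f : ts_sing M = f @^-1` [set torus_proj 0].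
Hypothesis pull_f : pullback_dz2 f (ts_form M).
Local Notation Sing := (ts_sing M).
Local Notation form_sign := (form_sign f).

(** A flat chart is open, so [e psi] and [e' psi] cannot differ by lattice
    points in it unless [e = e']. *)
Lemma form_sign_unique p e e' : ~ Sing p -> e = 1 \/ e = -1 -> e' = 1 \/ e' = -1 ->
  form_sign e p -> form_sign e' p -> e = e'.
Proof.
move=> pS e1 e1' ep e'p.
have [psi fpsi psip] := flat_chart_exists cover_f sing_f pull_f pS.
have [k nk] := ep psi fpsi psip; have [k' nk'] := e'p psi fpsi psip.
have pch : is_chart psi by case: fpsi.
have N : \forall z \near psi p, gauss_int (e * z - e' * z + (k - k')).
  have := nbhsI ((chart_near _ pch psip).1 (nbhsI nk nk')) (chart_inv_near pch psip).
  apply: nbhsS => z [[h1 h2] [zd zE]]; rewrite /= zE in h1 h2.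
  have /torus_projP : torus_proj (e * z + k) = torus_proj (e' * z + k') by rewrite -h1 -h2.
  by congr (is_true (gauss_int _)); ring.
have c1 : (1 : Cplx R) != 0 by apply: oner_neq0.
apply: (@sign_rigid R 1 (e * psi p - e' * psi p + (k - k')) e e' 0 c1 e1 e1').
have cv : (fun s : R => psi p + s%:C * 1) s @[s --> (0 : R)] --> psi p.
  by have := @affine_cvg R (psi p) 1 0; rewrite mul0r addr0.
have K : nbhs (0 : R) [set s |
    gauss_int (e * (psi p + s%:C * 1) - e' * (psi p + s%:C * 1) + (k - k'))].
  have K := cv _ N; exact: K.
by move: K; apply: nbhsS => s /=; congr (is_true (gauss_int _)); ring.
Qed.

(** If [f] maps the path or surface [g] to [G], then [G] is also the development
    of [g] in a flat chart, up to sign and translation: [e psi + k] and [G] differ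
    by a lattice point that varies continuously. *)
Lemma flat_development (X : topologicalType) (A : set X) (g : X -> M)
    (G : X -> Cplx R) x psi e :
  A x -> {within A, continuous g} ->
  (forall d : R, 0 < d -> \forall y \near x, A y -> normc (G y - G x) < d) ->
  (forall y, A y -> f (g y) = torus_proj (G y)) ->
  flat_chart psi -> chart_dom psi (g x) -> e = 1 \/ e = -1 -> form_sign e (g x) ->
  exists k, \forall y \near x, A y -> psi (g y) = e * G y + k.
Proof.
move=> Ax gc Gc fg fpsi psix e1 ex; have [k0 nk0] := ex psi fpsi psix.
have pch : is_chart psi by case: fpsi.
pose D y := e * psi (g y) + k0 - G y.
exists (e * (D x - k0)).
have h2 : (0 : R) < 2^-1 by rewrite invr_gt0.
have n1 := within_nbhs gc Ax nk0.
have n2 := within_nbhs gc Ax (cvg_plane_near (chart_cvg pch psix) h2).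
have n3 := Gc _ h2.
have gD y : f (g y) = torus_proj (e * psi (g y) + k0) -> f (g y) = torus_proj (G y) ->
    gauss_int (D y) by move=> h1 h3; apply/torus_projP; rewrite -h1 -h3.
have gDx : gauss_int (D x) by apply: gD; [exact: nbhs_singleton nk0|apply: fg].
have := nbhsI (nbhsI n1 n2) n3; apply: nbhsS => y [[h1 h3] h4] Ay.
have gDy : gauss_int (D y) by apply: gD; [apply: h1|apply: fg].
have DE : D y = D x.
  apply/eqP; rewrite -subr_eq0; apply/eqP/gauss_small; first exact: gaussB.
  rewrite (_ : _ - _ = e * (psi (g y) - psi (g x)) - (G y - G x)); last by rewrite /D; ring.
  apply: le_lt_trans (le_normcD _ _) _; rewrite normcN (normc_sign _ e1).
  by have -> : 1 = 2^-1 + 2^-1 :> R by [field]; apply: ltrD; [apply: h3|apply: h4].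
rewrite -DE /D.
rewrite -[LHS]mul1r -(sign_sqr e1); ring.
Qed.

(** In each flat chart the velocity is [v] or [- v]; the sign is given by
    [form_sign], which is locally constant, so that it is the same all along. *)
Lemma path_saddle (gamma : R -> M) (c v : Cplx R) : v != 0 ->
  {within `[0, 1], continuous gamma} -> Sing (gamma 0) -> Sing (gamma 1) ->
  (forall t, 0 < t < 1 -> ~ Sing (gamma t)) ->
  (forall t, 0 <= t <= 1 -> f (gamma t) = torus_proj (c + t%:C * v)) ->
  exists2 e : Cplx R, e = 1 \/ e = -1 & saddle_connection gamma (e * v).
Proof.
move=> v0 gc s0 s1 reg fg; have gc' := gc; rewrite itv01 in gc'.
have w01 := @ltW01 R.
have h2 : 0 < (2^-1 : R) < 1 by rewrite invr_gt0 ltr0n invf_lt1 // ltr1n.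
have [e e1 ne] := form_sign_near pull_f (reg _ h2).
exists e => //.
have eI t : 0 < t < 1 -> form_sign e (gamma t).
  move=> t01; have cI := @open_unit_connected R.
  apply: (connected_locally_constant (P := fun t => form_sign e (gamma t)) cI _ h2 t01
    (nbhs_singleton ne)) => {t01} t t01.
  have [e' e1' ne'] := form_sign_near pull_f (reg _ t01).
  have := within_nbhs gc' (w01 _ t01) ne'; apply: nbhsS => y + y01.
  move=> /(_ (w01 _ y01)) ey; have ex := nbhs_singleton ne'.
  split=> h.
    by rewrite (form_sign_unique (reg _ y01) e1 e1' h ey).
  by rewrite (form_sign_unique (reg _ t01) e1 e1' h ex).
split=> //.
  by rewrite mulf_eq0 (negbTE v0) orbF; case: e1 => ->; rewrite ?oppr_eq0 oner_eq0.
move=> t psi t01 fpsi psit.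
have [] := @flat_development R [set t : R | 0 <= t <= 1] gamma (fun s => c + s%:C * v) t psi e
  (w01 _ t01) gc' _ fg fpsi psit e1 (eI t t01).
  move=> d d0; have := cvg_plane_near (@affine_cvg R c v t) d0.
  by apply: nbhsS => y.
move=> k nk; have kt : psi (gamma t) = e * (c + t%:C * v) + k.
  by apply: (nbhs_singleton nk); apply: w01.
have n01 := near_unit t01.
have := nbhsI n01 nk; apply: nbhsS => s [s01 /(_ s01) ->].
by rewrite kt rmorphB /=; ring.
Qed.

(** The image of the path under [h] has velocity plus or minus [mx_act A v] and
    joins singularities, so [f] maps it to a straight closed path. *)
Lemma veech_path (A : 'M[R]_2) (h : M -> M) (gamma : R -> M) (v : Cplx R) :
  affine_homeo A h -> mx_act A v != 0 ->
  {within `[0, 1], continuous gamma} -> Sing (gamma 0) -> Sing (gamma 1) ->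
  (forall t, 0 < t < 1 -> ~ Sing (gamma t)) ->
  (forall t, 0 <= t <= 1 -> f (gamma t) = torus_proj (t%:C * v)) ->
  gauss_int (mx_act A v).
Proof.
move=> [[hc [h' [_ hK _]]] hS hA] v0 gc s0 s1 reg fg.
have hSing x : Sing (h x) <-> Sing x.
  split=> [|Sx]; last by rewrite -hS; exists x.
  by rewrite -{1}hS => -[y Sy /(can_inj hK) <-].
have w01 := @ltW01 R.
have gc' := gc; rewrite itv01 in gc'.
have [||e [k [e1 ek]]] := @development R M f cover_f (fun t => h (gamma t)) (mx_act A v) v0.
- rewrite itv01; apply: within_nbhsP => t U t01 Ut.
  have K : nbhs (gamma t) (h @^-1` U) := hc (gamma t) U Ut.
  exact: (within_nbhs gc' t01 K).
- move=> t t01; have gS := reg t t01.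
  have hgS : ~ Sing (h (gamma t)) by move=> /hSing.
  have [psi fpsi psit] := flat_chart_exists cover_f sing_f pull_f gS.
  have [psi' fpsi' psit'] := flat_chart_exists cover_f sing_f pull_f hgS.
  have [e [k [e1 nk]]] := hA _ _ _ fpsi fpsi' psit psit'.
  have [e0 e01 /nbhs_singleton n0] := form_sign_near pull_f gS.
  have [e' e1' /nbhs_singleton n'] := form_sign_near pull_f hgS.
  have [k' nk'] := n' _ fpsi' psit'.
  have [] := @flat_development R [set t : R | 0 <= t <= 1] gamma (fun s => s%:C * v) t psi e0
    (w01 _ t01) gc' _ fg fpsi psit e01 n0.
    move=> d d0; have := cvg_plane_near (@affine_cvg R 0 v t) d0.
    by apply: nbhsS => y; rewrite !add0r.
  move=> k0 nk0.
  exists (e' * e * e0), (e' * (e * mx_act A k0 + k) + k'); split.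
    by apply: sign_mul => //; apply: sign_mul.
  have m1 := within_nbhs gc' (w01 _ t01) nk.
  have Kh : nbhs (gamma t) (h @^-1` [set y | f y = torus_proj (e' * psi' y + k')]).
    exact: (hc (gamma t) _ nk').
  have m2 := within_nbhs gc' (w01 _ t01) Kh.
  have n01 := near_unit t01.
  have := nbhsI (nbhsI m1 m2) (nbhsI n01 nk0).
  apply: nbhsS => s [[q1 q2] [s01 q3]]; rewrite (q2 s01) (q1 s01) (q3 s01).
  by rewrite mx_actD mx_act_sign // mx_actZ; congr torus_proj; ring.
have gk : gauss_int k.
  have E0 := ek 0; rewrite lexx ler01 mul0r mulr0 add0r in E0.
  have /(sing_torus sing_f) : Sing (h (gamma 0)) by apply/hSing.
  by rewrite E0 // => /torus_projP; rewrite subr0.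
have E1 := ek 1; rewrite lexx ler01 mul1r in E1.
have /(sing_torus sing_f) : Sing (h (gamma 1)) by apply/hSing.
rewrite E1 // => /torus_projP; rewrite subr0 => /gaussB/(_ gk).
by rewrite addrK gauss_sign.
Qed.

(** Along the segment from [p0] to [z] the triangle develops with constant
    velocity [z - p0] up to sign, starting from a lattice point. *)
Lemma triangle_sing p0 p1 p2 (phi : Cplx R -> M) : embedded_triangle p0 p1 p2 phi ->
  forall z, triangle p0 p1 p2 z -> (Sing (phi z) <-> gauss_int (z - p0)).
Proof.
move=> [nc pc pv [[_ _ _] preg] pflat] z Tz.
pose T := triangle p0 p1 p2.
have p0v : Sing (phi p0) by apply: pv; exists p0 => //; left; left.
have [->|zp0] := eqVneq z p0; first by rewrite subrr gauss0.
have v0 : z - p0 != 0 by rewrite subr_eq0.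
have [b [c [[b0 c0 bc] zE]]] := (triangleP _ _ _ _).1 Tz.
have hT t : 0 <= t <= 1 -> T (homoth p0 t z).
  move=> /andP[t0 t1]; apply/triangleP; exists (t * b), (t * c); split.
    split; [exact: mulr_ge0|exact: mulr_ge0|].
    by rewrite -mulrDr mulr_ile1 // addr_ge0.
  by rewrite zE tri_homoth.
have hA t : 0 < t < 1 -> (T `\` [set p0; p1; p2]) (homoth p0 t z).
  move=> /andP[t0 t1]; apply/tri_regularP => //; exists (t * b), (t * c); split.
  - split; [exact/mulr_ge0/b0/ltW|exact/mulr_ge0/c0/ltW|].
    by rewrite -mulrDr mulr_ile1 // ?addr_ge0 // ltW.
  - have lt1 : t * b + t * c < 1.
      by rewrite -mulrDr; apply: le_lt_trans t1; rewrite ler_piMr // ltW.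
    case=> [[/eqP + /eqP]|[tb tc]|[tb tc]].
    + rewrite !mulf_eq0 (gt_eqF t0) /= => /eqP b00 /eqP c00.
      move: zp0; rewrite zE b00 c00 /tri_point !mul0r !addr0 eqxx //.
    + by rewrite tb tc addr0 ltxx in lt1.
    + by rewrite tb tc add0r ltxx in lt1.
  - by rewrite zE tri_homoth.
have [||e [k [e1 ek]]] := @development R M f cover_f
    (fun t => phi (homoth p0 t z)) (z - p0) v0.
- rewrite itv01; apply: (within_comp (B := T)) pc; first exact: hT.
  by move=> t _; apply: affine_cvg.
- move=> t t01; have At := hA t t01.
  have rS : ~ Sing (phi (homoth p0 t z)) by apply: preg; exists (homoth p0 t z).
  have [psi fpsi psit] := flat_chart_exists cover_f sing_f pull_f rS.
  have [e' [k' [e1' nk']]] := pflat _ _ At fpsi psit.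
  have [e e1 /nbhs_singleton n1] := form_sign_near pull_f rS.
  have [k nk] := n1 psi fpsi psit.
  exists (e * e'), (e * (e' * p0 + k') + k); split; first exact: sign_mul.
  have m1 := within_nbhs pc At.1 nk.
  have K : nbhs t [set s | T (homoth p0 s z) ->
      f (phi (homoth p0 s z)) = torus_proj (e * (e' * homoth p0 s z + k') + k)].
    have cv := @affine_cvg R p0 (z - p0) t.
    have K := cv _ (nbhsI m1 nk'); move: K; apply: nbhsS => s [q1 q2] Ts.
    by rewrite q1 // q2.
  have n01 := near_unit t01.
  have := nbhsI n01 K; apply: nbhsS => s [s01 q]; rewrite q; last exact: hT.
  by rewrite /homoth; congr torus_proj; ring.
have gk : gauss_int k.
  have E0 := ek 0; rewrite lexx ler01 mul0r mulr0 add0r homoth0 in E0.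
  have /(sing_torus sing_f) := p0v.
  by rewrite E0 // => /torus_projP; rewrite subr0.
have E1 := ek 1; rewrite lexx ler01 mul1r homoth1 in E1.
split=> [/(sing_torus sing_f)|g].
  rewrite E1 // => /torus_projP; rewrite subr0 => /gaussB/(_ gk).
  by rewrite addrK gauss_sign.
apply/(sing_torus sing_f); rewrite E1 //; apply/torus_projP; rewrite subr0.
by apply: gaussD => //; rewrite gauss_sign.
Qed.

(** The period of a side is read near its midpoint, in one flat chart. *)
Lemma side_slope p0 p1 p2 (phi : Cplx R -> M) p q v : embedded_triangle p0 p1 p2 phi ->
  (triangle p0 p1 p2 `\` [set p0; p1; p2]) (homoth p 2^-1 q) ->
  (forall t, 0 <= t <= 1 -> triangle p0 p1 p2 (homoth p t q)) ->
  saddle_connection (side phi p q) v -> v = q - p \/ v = - (q - p).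
Proof.
move=> [nc pc pv [_ preg] pflat] Am hT [_ _ _ v0 vP].
have h2 : 0 < (2^-1 : R) < 1 by rewrite invr_gt0 ltr0n invf_lt1 // ltr1n.
have sideE t : side phi p q t = phi (homoth p t q).
  by rewrite /side /homoth; congr phi; rewrite rmorphB rmorph1; ring.
have rS : ~ Sing (phi (homoth p 2^-1 q)) by apply: preg; exists (homoth p 2^-1 q).
have [psi fpsi psit] := flat_chart_exists cover_f sing_f pull_f rS.
have [e [k [e1 nk]]] := pflat _ _ Am fpsi psit.
have := vP 2^-1 psi h2 fpsi; rewrite sideE => /(_ psit) n1.
have cv := @affine_cvg R p (q - p) 2^-1.
have n2 : nbhs (2^-1 : R) [set s | triangle p0 p1 p2 (homoth p s q) ->
   psi (phi (homoth p s q)) = e * homoth p s q + k] by have K := cv _ nk; exact: K.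
have n01 := near_unit h2.
have n3 := nbhsI n1 (nbhsI n2 n01).
have /nbhs_normP[r /= r0 rP] := n3.
have [q1 [q2 _]] := nbhs_singleton n3.
have r2 : r / 2 != 0 by rewrite mulf_neq0 ?gt_eqF // invr_eq0 pnatr_eq0.
have [|q3 [q4 q5]] := rP (2^-1 + r / 2).
  rewrite /ball_ /= opprD addrA subrr add0r normrN gtr0_norm ?divr_gt0 //.
  by rewrite ltr_pdivrMr // ltr_pMr // ltr1n.
have q2' := q2 Am.1; have q4' := q4 (hT _ q5).
rewrite sideE q4' q2' in q3.
suff -> : v = e * (q - p) by case: e1 => ->; rewrite ?mul1r ?mulN1r; [left|right].
have rc : (r / 2)%:C != 0 :> R[i] by rewrite eq_complex /= negb_and r2.
apply: (mulfI rc).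
have -> : (r / 2)%:C * v = (2^-1 + r / 2 - 2^-1)%:C * v by rewrite addrAC subrr add0r.
apply: (addrI (e * homoth p 2^-1 q + k)); rewrite -q3 /homoth rmorphD /=; ring.
Qed.

Lemma periodic_triangle_unimodular (D : set (Cplx R)) : periodic_triangles M D ->
  exists u v, [/\ gauss_int u, gauss_int v, cross u v ^+ 2 = 1 &
    D = ideal_triangle (slope (v - u)) (slope (- v)) (slope u)].
Proof.
move=> [p0 [p1 [p2 [phi [v0 [v1 [v2 [emb s0 s1 s2 ->]]]]]]]].
have nc : non_collinear p0 p1 p2 by case: emb.
have TS := triangle_sing emb.
have pv : phi @` [set p0; p1; p2] `<=` Sing by case: emb.
have preg : phi @` (triangle p0 p1 p2 `\` [set p0; p1; p2]) `<=` ~` Sing by case: emb => _ _ _ [].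
pose u := p1 - p0; pose v := p2 - p0.
have tp b c : tri_coord b c -> triangle p0 p1 p2 (tri_point p0 p1 p2 b c).
  by move=> bc; apply/triangleP; exists b, c.
have E0 : p0 = tri_point p0 p1 p2 0 0 by rewrite /tri_point !mul0r !addr0.
have E1 : p1 = tri_point p0 p1 p2 1 0 by rewrite /tri_point mul1r mul0r addr0 addrC subrK.
have E2 : p2 = tri_point p0 p1 p2 0 1 by rewrite /tri_point mul1r mul0r add0r addrC subrK.
have c0 : tri_coord (0 : R) 0 by split; rewrite ?addr0.
have c1 : tri_coord (1 : R) 0 by split; rewrite ?addr0.
have c2 : tri_coord (0 : R) 1 by split; rewrite ?add0r.
have T1 : triangle p0 p1 p2 p1 by have := tp 1 0 c1; rewrite -E1.
have T2 : triangle p0 p1 p2 p2 by have := tp 0 1 c2; rewrite -E2.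
have gu : gauss_int u by apply/(TS _ T1)/pv; exists p1 => //; left; right.
have gv : gauss_int v by apply/(TS _ T2)/pv; exists p2 => //; right.
have ncr : cross u v != 0 by rewrite -non_collinearE.
exists u, v; split=> //.
  apply: empty_triangle_unimodular => // b c pb pc bc g.
  apply: contrapT => nv.
  have Az : (triangle p0 p1 p2 `\` [set p0; p1; p2]) (tri_point p0 p1 p2 b c).
    by apply/tri_regularP => //; exists b, c.
  apply: (preg (phi (tri_point p0 p1 p2 b c))); first by exists (tri_point p0 p1 p2 b c).
  by apply/TS; [case: Az|rewrite /tri_point addrC addKr].
have line b c b' c' t : homoth (tri_point p0 p1 p2 b c) t (tri_point p0 p1 p2 b' c') =
    tri_point p0 p1 p2 ((1 - t) * b + t * b') ((1 - t) * c + t * c').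
  by rewrite /homoth /tri_point !rmorphD !rmorphM !rmorphB !rmorph1 /=; ring.
have coord b c b' c' t : tri_coord b c -> tri_coord b' c' -> 0 <= t <= 1 ->
    tri_coord ((1 - t) * b + t * b') ((1 - t) * c + t * c').
  by move=> [? ? ?] [? ? ?] /andP[? ?]; split; nra.
have half : 0 <= (2^-1 : R) <= 1 by rewrite invr_ge0 ler0n invf_le1 // ler1n.
have slopes p q w b c b' c' : p = tri_point p0 p1 p2 b c -> q = tri_point p0 p1 p2 b' c' ->
    tri_coord b c -> tri_coord b' c' ->
    ~ tri_vertex ((1 - 2^-1) * b + 2^-1 * b') ((1 - 2^-1) * c + 2^-1 * c') ->
    saddle_connection (side phi p q) w -> slope w = slope (q - p).
  move=> -> -> bc bc' nv sw; apply: slope_sign; apply: (side_slope emb _ _ sw).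
    rewrite line; apply/tri_regularP => //.
    by exists ((1 - 2^-1) * b + 2^-1 * b'), ((1 - 2^-1) * c + 2^-1 * c'); split=> //; apply: coord.
  by move=> t t01; rewrite line; apply: tp; apply: coord.
congr (ideal_triangle _ _ _).
- rewrite (slopes p1 p2 v0 1 0 0 1) //; first by congr slope; rewrite /u /v; ring.
  by case=> [] []; lra.
- rewrite (slopes p2 p0 v1 0 1 0 0) //; first by congr slope; rewrite /v; ring.
  by case=> [] []; lra.
- rewrite (slopes p0 p1 v2 0 0 1 0) //.
  by case=> [] []; lra.
Qed.

End Paths.

(** * Embedded triangles over unimodular triangles *)

Section Convexity.
Variable R : realType.
Implicit Types (z w u v : Cplx R) (b c t eps : R).

Lemma convex_connected (B : set (Cplx R)) :
  (forall z w t, B z -> B w -> 0 <= t <= 1 -> B (homoth z t w)) -> connected B.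
Proof.
move=> cB; have [->|/set0P[z0 Bz0]] := eqVneq B set0; first exact: connected0.
pose S w := (fun t => homoth z0 t w) @` [set t : R | 0 <= t <= 1].
have -> : B = \bigcup_(w in B) S w.
  apply/seteqP; split=> [w Bw|_ [w Bw [t t01 <-]]]; last exact: cB.
  by exists w => //; exists 1; [rewrite /= lexx ler01|rewrite homoth1].
apply: bigcup_connected.
  by exists z0 => w Bw; exists 0; [rewrite /= lexx ler01|rewrite homoth0].
move=> w Bw; apply: connected_continuous_connected; first exact: unit_connected.
by apply: continuous_subspaceT => t; apply: affine_cvg.
Qed.

Lemma cross_bound z w : `|cross z w| <= 2 * normc z * normc w.
Proof.
rewrite /cross; apply: le_trans (ler_normB _ _) _; rewrite !normrM.
have -> : 2 * normc z * normc w = normc z * normc w + normc z * normc w by ring.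
by apply: lerD; apply: ler_pM; rewrite ?normc_Re ?normc_Im.
Qed.

(** Coordinates of the triangle with vertices 0, [u], [v] from which corners of
    size [eps] are removed: compact sets exhausting the triangle without its
    vertices when [eps] tends to 0, and the whole triangle for [eps = 0]. *)
Definition cut_coord eps : set (R * R) := [set x |
  [/\ 0 <= x.1, 0 <= x.2 & x.1 + x.2 <= 1] /\
  [/\ x.1 <= 1 - eps, x.2 <= 1 - eps & eps <= x.1 + x.2]].

Definition comb u v (x : R * R) : Cplx R := x.1%:C * u + x.2%:C * v.

Lemma compact_cut u v eps : compact (comb u v @` cut_coord eps).
Proof.
apply: continuous_compact.
  apply: continuous_subspaceT => x; apply: cvg_plane => e e0.
  have K0 : 0 < normc u + normc v + 1 by rewrite ltr_wpDl // addr_ge0 ?normc_ge0.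
  have d0 : 0 < e / (normc u + normc v + 1) by rewrite divr_gt0.
  exists ([set s | `|s - x.1| < e / (normc u + normc v + 1)],
          [set s | `|s - x.2| < e / (normc u + normc v + 1)]).
    by split; apply: near_real.
  move=> [s t] /= [sx tx].
  rewrite (_ : _ - _ = (s - x.1)%:C * u + (t - x.2)%:C * v); last first.
    by rewrite /comb /= !rmorphB /=; ring.
  apply: le_lt_trans (le_normcD _ _) _; rewrite !normcM !normc_real.
  apply: (@le_lt_trans _ _ (e / (normc u + normc v + 1) * (normc u + normc v))).
    by rewrite mulrDr; apply: lerD; apply: ler_wpM2r; rewrite ?normc_ge0 // ltW.
  rewrite -mulrA gtr_pMr // mulrC ltr_pdivrMr // mul1r ltrDl //.
have c1 : continuous (fun x : R * R => x.1) by move=> x; exact: cvg_fst.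
have c2 : continuous (fun x : R * R => x.2) by move=> x; exact: cvg_snd.
have c12 : continuous (fun x : R * R => x.1 + x.2).
  by move=> x; apply: cvgD; [exact: c1|exact: c2].
have sq := compact_setX (@segment_compact R 0 1) (@segment_compact R 0 1).
apply: (subclosed_compact _ sq); last first.
  move=> x [[x1 x2 x12] _]; split; rewrite /= in_itv /= ?x1 ?x2 /=; lra.
rewrite (_ : cut_coord eps = ((fun x : R * R => x.1) @^-1` [set t | 0 <= t]
   `&` (fun x : R * R => x.2) @^-1` [set t | 0 <= t]
   `&` (fun x : R * R => x.1 + x.2) @^-1` [set t | t <= 1])
   `&` ((fun x : R * R => x.1) @^-1` [set t | t <= 1 - eps]
   `&` (fun x : R * R => x.2) @^-1` [set t | t <= 1 - eps]
   `&` (fun x : R * R => x.1 + x.2) @^-1` [set t | eps <= t])); last first.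
  by apply/seteqP; split=> x /=; [case=> [[? ? ?] [? ? ?]]|case=> [[[? ?] ?] [[? ?] ?]]].
have cl (g : R * R -> R) (D : set R) : continuous g -> closed D -> closed (g @^-1` D).
  by move=> gc cD; apply: closed_comp => // x _; apply: gc.
have ge t : closed [set s : R | t <= s] by apply: closed_ge.
have le t : closed [set s : R | s <= t] by apply: closed_le.
apply: closedI; apply: closedI; [apply: closedI| |apply: closedI|]; exact: cl.
Qed.

End Convexity.

Section UnimodularTriangle.
Variables (R : realType) (u v : Cplx R).
Hypotheses (gu : gauss_int u) (gv : gauss_int v) (uv1 : cross u v ^+ 2 = 1).
Implicit Types (z w : Cplx R) (b c t : R) (x y : R * R).

(** The triangle without its vertices, described by linear inequalities so that
    its convexity is a matter of linear arithmetic. *)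
Definition reg_coord : set (R * R) := [set x |
  [/\ 0 <= x.1, 0 <= x.2 & x.1 + x.2 <= 1] /\ [/\ x.1 < 1, x.2 < 1 & 0 < x.1 + x.2]].

Let T := comb u v @` cut_coord 0.
Let A := comb u v @` reg_coord.

Lemma uv0 : cross u v != 0.
Proof. by apply: contra_eq_neq uv1 => ->; rewrite expr0n /= eq_sym oner_eq0. Qed.

Lemma triangle_comb : triangle 0 u v = T.
Proof.
apply/seteqP; split=> [z /triangleP[b [c [[b0 c0 bc] ->]]]|_ [x [[b0 c0 bc] _] <-]].
  exists (b, c); last by rewrite /comb /tri_point /= !subr0 add0r.
  by split; split=> //=; lra.
by apply/triangleP; exists x.1, x.2; split; rewrite // /tri_point !subr0 add0r.
Qed.

Lemma regular_comb : triangle 0 u v `\` [set 0; u; v] = A.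
Proof.
have nc : non_collinear 0 u v by rewrite non_collinearE !subr0 uv0.
apply/seteqP; split=> [z /(tri_regularP _ nc)|_ [x [[b0 c0 bc] [b1 c1 bc0]] <-]].
  move=> [b [c [[b0 c0 bc] nv ->]]]; exists (b, c).
    split; split=> //=; rewrite lt_neqAle; apply/andP; split; try lra.
    - by apply/eqP => E; apply: nv; apply: Or32; split=> //; lra.
    - by apply/eqP => E; apply: nv; apply: Or33; split=> //; lra.
    - by apply/eqP => E; apply: nv; apply: Or31; split; lra.
  by rewrite /comb /tri_point /= !subr0 add0r.
apply/(tri_regularP _ nc); exists x.1, x.2; split=> //.
  by case=> [] []; lra.
by rewrite /tri_point !subr0 add0r.
Qed.

Lemma regular_nongauss z : A z -> ~ gauss_int z.
Proof.
move=> [x [[b0 c0 bc] [b1 c1 bc0]] <-] g.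
have [/int_small bI /int_small cI] := unimodular_coord gu gv uv1 g.
move: bc0; rewrite bI ?ger0_norm // cI ?ger0_norm //.
by rewrite addr0 ltxx.
Qed.

Lemma regular_inj z w : A z -> A w -> gauss_int (z - w) -> z = w.
Proof.
move=> [x [[b0 c0 bc] [b1 c1 bc0]] <-] [y [[b0' c0' bc'] [b1' c1' bc0']] <-] g.
have [|/int_small bI /int_small cI] := @unimodular_coord _ u v (x.1 - y.1) (x.2 - y.2) gu gv uv1.
  by move: g; congr (is_true (gauss_int _)); rewrite /comb !rmorphB /=; ring.
have -> : x = y; last by [].
rewrite [x]surjective_pairing [y]surjective_pairing; congr (_, _).
  by apply/eqP; rewrite -subr_eq0 bI // ltr_norml; apply/andP; split; lra.
by apply/eqP; rewrite -subr_eq0 cI // ltr_norml; apply/andP; split; lra.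
Qed.

Lemma comb_coord x : x.1 = cross (comb u v x) v / cross u v /\
  x.2 = cross u (comb u v x) / cross u v.
Proof. by rewrite /comb cross_comb cross_comb_r !mulfK ?uv0. Qed.

Lemma homoth_comb x y t :
  homoth (comb u v x) t (comb u v y) =
  comb u v ((1 - t) * x.1 + t * y.1, (1 - t) * x.2 + t * y.2).
Proof. by rewrite /homoth /comb /= !rmorphD !rmorphM !rmorphB !rmorph1 /=; ring. Qed.

Lemma coord_near z (e : R) : 0 < e -> forall x, comb u v x = z ->
  \forall w \near z, forall y, comb u v y = w -> `|y.1 - x.1| < e /\ `|y.2 - x.2| < e.
Proof.
move=> e0 x xz; pose K := 2 * normc u + 2 * normc v + 1.
have u0 := normc_ge0 u; have v0 := normc_ge0 v.
have K0 : 0 < K by rewrite /K; lra.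
have d0 : 0 < e / K by rewrite divr_gt0.
have := near_planeW z d0; apply: nbhsS => w wz y yw /=.
have nD : `|(cross u v)^-1| = 1.
  have /eqP := uv1; rewrite normfV sqrf_eq1 => /orP[]/eqP ->; rewrite ?normrN ?normr1 invr1 //.
have := cross_bound (w - z) v; have := cross_bound u (w - z).
have wz0 := normc_ge0 (w - z).
have wK : normc (w - z) * K < e by rewrite -ltr_pdivlMr.
move=> h2 h1.
have [x1 x2] := comb_coord x; have [y1 y2] := comb_coord y.
have lin1 : cross (w - z) v = cross w v - cross z v.
  by rewrite /cross; case: (w) (z) => p q [p' q'] /=; ring.
have lin2 : cross u (w - z) = cross u w - cross u z.
  by rewrite /cross; case: (w) (z) => p q [p' q'] /=; ring.
split.
  rewrite y1 x1 yw xz -mulrBl normrM nD mulr1 -lin1.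
  by rewrite /K in wK; nra.
rewrite y2 x2 yw xz -mulrBl normrM nD mulr1 -lin2.
by rewrite /K in wK; nra.
Qed.

Variables (M : translation_surface R) (f : M -> torus R).
Hypothesis cover_f : ramified_covering f [set torus_proj 0].
Hypothesis sing_f : ts_sing M = f @^-1` [set torus_proj 0].
Hypothesis pull_f : pullback_dz2 f (ts_form M).
Local Notation Sing := (ts_sing M).

Let bary := comb u v (3^-1, 3^-1).

Lemma bary_regular : A bary.
Proof. by exists (3^-1, 3^-1) => //; split; split=> /=; lra. Qed.

(** The truncated triangles [cut_coord eps] with [eps <= 1/2] contain the
    barycentre and are compact, as [lift_exhaust] demands. *)
Lemma lift_regular : exists phi : Cplx R -> M,
  {within A, continuous phi} /\ forall z, A z -> f (phi z) = torus_proj z.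
Proof.
have [p fp] := f_surj cover_f bary.
suff [phi [_ pc pf]] : exists phi : Cplx R -> M, [/\ phi bary = p,
    {within A, continuous phi} & forall z, A z -> f (phi z) = torus_proj z].
  by exists phi.
apply: (lift_exhaust cover_f sing_f bary_regular fp regular_nongauss).
move=> _ [x [[b0 c0 bc] [b1 c1 bc0]] <-].
have [eps [e0 e1 xe]] : exists eps, [/\ 0 < eps, eps <= 2^-1 &
    [/\ x.1 < 1 - eps, x.2 < 1 - eps & eps < x.1 + x.2]].
  (* Half the distance to the corners, in barycentric coordinates. *)
  exists (Num.min (Num.min (2^-1 * (1 - x.1)) (2^-1 * (1 - x.2))) (2^-1 * (x.1 + x.2))).
  set m := Num.min _ _.
  have m1 : m <= 2^-1 * (1 - x.1) by rewrite !ge_min lexx.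
  have m2 : m <= 2^-1 * (1 - x.2) by rewrite !ge_min lexx orbT.
  have m3 : m <= 2^-1 * (x.1 + x.2) by rewrite !ge_min lexx !orbT.
  have m0 : 0 < m by rewrite !lt_min; apply/andP; split; [apply/andP; split|]; lra.
  by split; [|lra|split; lra].
pose K := comb u v @` cut_coord eps.
exists K, (normc u + normc v + normc bary + 1).
split.
- exact: compact_cut.
- move=> _ t [y [[y1 y2 y12] [y1' y2' y12']] <-] /andP[t0 t1]; rewrite homoth_comb.
  eexists; last by []; split; split=> /=; nra.
- move=> _ [y [[y1 y2 y12] [y1' y2' y12']] <-]; exists y => //.
  by split; split=> //; lra.
- move=> _ [y [[y1 y2 y12] [y1' y2' y12']] <-].
  have nu := normc_ge0 u; have nv := normc_ge0 v.
  apply: le_lt_trans (le_normcD _ _) _; rewrite normcN.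
  have : normc (comb u v y) <= normc u + normc v.
    apply: le_trans (le_normcD _ _) _; rewrite !normcM !normc_real !ger0_norm //.
    by apply: lerD; rewrite ler_piMl //; lra.
  lra.
- move: xe => [e2 e3 e4].
  pose d := Num.min (Num.min (1 - eps - x.1) (1 - eps - x.2)) (2^-1 * (x.1 + x.2 - eps)).
  have d0 : 0 < d by rewrite !lt_min; apply/andP; split; [apply/andP; split|]; lra.
  have d1 : d <= 1 - eps - x.1 by rewrite !ge_min lexx.
  have d2 : d <= 1 - eps - x.2 by rewrite !ge_min lexx orbT.
  have d3 : d <= 2^-1 * (x.1 + x.2 - eps) by rewrite !ge_min lexx !orbT.
  have := coord_near d0 (erefl (comb u v x)); apply: nbhsS => w H.
  move=> [y [[y1 y2 y12] _] yw]; exists y => //.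
  have [] := H y yw; rewrite !ltr_norml => /andP[h1 h2] /andP[h3 h4].
  by split; split=> //; lra.
Qed.

Let V : set (Cplx R) := [set 0; u; v].

Lemma vertex_coord q : V q -> exists x, tri_vertex x.1 x.2 /\ q = comb u v x.
Proof.
move=> [[]|] ->; [exists (0, 0)|exists (1, 0)|exists (0, 1)]; rewrite /comb /=
  ?mul0r ?mul1r ?addr0 ?add0r; split=> //; [exact: Or31|exact: Or32|exact: Or33].
Qed.

Lemma vertexP q : V q -> gauss_int q /\
  exists x, [/\ 0 <= x.1, 0 <= x.2, x.1 + x.2 <= 1 & q = comb u v x].
Proof.
move=> Vq; split; first by move: Vq => [[]|] -> //; exact: gauss0.
have [x [xv qx]] := vertex_coord Vq; exists x; split=> //.
all: by case: xv => [][E1 E2]; rewrite ?E1 ?E2; lra.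
Qed.

Lemma punctured_disc q (r : R) : V q -> 0 < r ->
  (A `&` [set z | normc (z - q) < r]) !=set0 /\
  connected (A `&` [set z | normc (z - q) < r]).
Proof.
move=> Vq r0; have [_ [x [b0 c0 bc ->]]] := vertexP Vq; split.
  pose N := normc (bary - comb u v x) + 1.
  have N0 : 0 < N by rewrite ltr_wpDl ?normc_ge0.
  pose t := Num.min 1 (r / (2 * N)).
  have t0 : 0 < t by rewrite lt_min ltr01 divr_gt0 // mulr_gt0.
  have t1 : t <= 1 by rewrite ge_min lexx.
  have t2 : t <= r / (2 * N) by rewrite ge_min lexx orbT.
  exists (homoth (comb u v x) t bary); split.
    rewrite homoth_comb; eexists; last by [].
    by split; split=> /=; nra.
  rewrite /= /homoth addrC addKr normcM normc_real gtr0_norm //.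
  rewrite ler_pdivlMr ?mulr_gt0 // in t2.
  have := normc_ge0 (bary - comb u v x); rewrite /N in t2 *; nra.
apply: convex_connected => _ _ t [[y [[y1 y2 y12] [y1' y2' y12']] <-] yr]
  [[z [[z1 z2 z12] [z1' z2' z12']] <-] zr] t01; split; last exact: ball_convex.
rewrite homoth_comb; move/andP: t01 => [t0 t1]; eexists; last by [].
have [->|tn0] := eqVneq t 0.
  by split; split=> /=; rewrite ?subr0 ?mul1r ?mul0r ?addr0.
have tp : 0 < t by rewrite lt_def tn0.
by split; split=> /=; nra.
Qed.

(** At a vertex the value is the limit given by [puncture_limit]. *)
Lemma lift_triangle : exists phi : Cplx R -> M,
  [/\ {within T, continuous phi}, forall q, V q -> Sing (phi q) &
      forall z, T z -> f (phi z) = torus_proj z].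
Proof.
have [phi [pc pf]] := lift_regular.
have /choice[P PP] : forall q, exists P, V q ->
    Sing P /\ forall U : set M, nbhs P U -> nbhs q [set z | A z -> U (phi z)].
  move=> q; have [Vq|nVq] := pselect (V q); last by exists (phi 0).
  have [gq _] := vertexP Vq.
  have [P SP nP] := puncture_limit cover_f sing_f gq pc pf
    (fun r r0 => (punctured_disc Vq r0).1) (fun r r0 => (punctured_disc Vq r0).2).
  by exists P.
have VA z : V z -> A z -> False by move=> Vz; rewrite -regular_comb => -[].
have TA z : T z -> V z \/ A z.
  rewrite -regular_comb -triangle_comb => Tz.
  by have [Vz|nVz] := pselect (V z); [left|right].
pose phi' z := if pselect (V z) then P z else phi z.
have phiV z : V z -> phi' z = P z by rewrite /phi'; case: pselect.
have phiA z : A z -> phi' z = phi z by rewrite /phi'; case: pselect => // Vz /(VA _ Vz).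
exists phi'; split.
- apply: within_nbhsP => z U Tz Uz.
  have nV : nbhs z [set w | V w -> w = z].
    have far q : nbhs z [set w | w = q -> w = z].
      have [->|qz] := eqVneq q z; first by apply: nbhsT => w /=.
      have d0 : 0 < normc (q - z) by rewrite normc_gt0 subr_eq0.
      have := near_planeW z d0; apply: nbhsS => w /= h wq.
      by move: h; rewrite wq ltxx.
    have := nbhsI (nbhsI (far 0) (far u)) (far v).
    by apply: nbhsS => w [[h1 h2] h3] [[]|] //.
  have nA : nbhs z [set w | A w -> U (phi w)].
    have [Vz|Az] := TA z Tz.
      by have [_ H] := PP z Vz; apply: H; rewrite -phiV.
    by have Uz' : nbhs (phi z) U; [rewrite -(phiA z Az)|exact: within_nbhs pc Az Uz'].
  have := nbhsI nV nA; apply: nbhsS => w [h1 h2] Tw.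
  have [Vw|Aw] := TA w Tw; last by rewrite phiA //; apply: h2.
  by rewrite (h1 Vw); apply: nbhs_singleton Uz.
- by move=> q Vq; rewrite phiV //; have [] := PP q Vq.
- move=> z Tz; have [Vz|Az] := TA z Tz; last by rewrite phiA // pf.
  rewrite phiV //; have [/(sing_torus sing_f) -> _] := PP z Vz.
  by apply/torus_projP; rewrite sub0r; apply: gaussN; have [] := vertexP Vz.
Qed.

(** Injectivity holds because congruent points of the triangle other than its
    vertices are equal. The lift is an embedding because the triangle is compact
    and [M] is separated: the complement of the image of a closed part is open. *)
Lemma unimodular_triangle : exists phi : Cplx R -> M,
  [/\ embedded_triangle 0 u v phi,
      forall q, V q -> Sing (phi q) &
      forall z, triangle 0 u v z -> f (phi z) = torus_proj z].
Proof.
have [phi [pc pV pf]] := lift_triangle.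
exists phi; rewrite /embedded_triangle /= regular_comb triangle_comb; split=> //.
have AT : A `<=` T by rewrite -regular_comb -triangle_comb => z [].
have reg z : A z -> ~ Sing (phi z).
  move=> Az; apply: (regular_of_proj sing_f (pf z (AT z Az))); exact: regular_nongauss.
have TA z : T z -> ~ Sing (phi z) -> A z.
  by rewrite -regular_comb -triangle_comb => Tz nS; split=> // /pV.
have inj : {in A &, injective phi}.
  move=> z w; rewrite !inE => Az Aw E; apply: regular_inj => //.
  by apply/torus_projP; rewrite -!pf ?E //; apply: AT.
split=> //.
- by rewrite non_collinearE !subr0 uv0.
- by move=> _ [q Vq <-]; apply: pV.
- split; last by move=> _ [z Az <-]; apply: reg.
  split=> //; first exact: within_sub pc.
  move=> U oU; exists (~` (phi @` (T `&` ~` U))).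
    apply: closed_openC; apply: compact_closed; first exact: rs_hausdorff.
    apply: continuous_compact; first by apply: within_sub pc => z [].
    by apply: compact_closedI; [exact: compact_cut|exact: open_closedC].
  apply/seteqP; split=> [_ [z [Az Uz] <-]|_ [[z Az <-] H]].
    split; first by exists z.
    move=> [w [Tw nUw] E]; apply: nUw.
    have Aw : A w by apply: TA => //; rewrite E; apply: reg.
    by rewrite (inj w z) ?inE.
  exists z => //; split=> //; apply: contrapT => nU; apply: H; exists z => //.
  by split=> //; apply: AT.
move=> z psi Az' fpsi psiz.
have Az : A z by rewrite -regular_comb triangle_comb.
have [e e1 /nbhs_singleton n1] := form_sign_near pull_f (reg z Az).
have [] := flat_development (G := id) (AT z Az) pc _ pf fpsi psiz e1 n1.
  by move=> d d0; have := near_planeW z d0; apply: nbhsS.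
by move=> k nk; exists e, k.
Qed.

Lemma unimodular_side p q (phi : Cplx R -> M) : V p -> V q -> p <> q ->
  embedded_triangle 0 u v phi -> (forall q, V q -> Sing (phi q)) ->
  (forall z, triangle 0 u v z -> f (phi z) = torus_proj z) ->
  [/\ {within `[0, 1], continuous (side phi p q)},
     forall t, 0 < t < 1 -> ~ Sing (side phi p q t) &
     forall t, 0 <= t <= 1 -> f (side phi p q t) = torus_proj (p + t%:C * (q - p))].
Proof.
move=> Vp Vq pq emb pV pf.
have [_ [x [x1 x2 x12 pE]]] := vertexP Vp; have [_ [y [y1 y2 y12 qE]]] := vertexP Vq.
have sideE : side phi p q = fun t => phi (homoth p t q).
  by apply/funext => t; rewrite /side /homoth; congr phi; rewrite rmorphB rmorph1; ring.
rewrite sideE.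
have hT t : 0 <= t <= 1 -> triangle 0 u v (homoth p t q).
  move=> /andP[t0 t1]; rewrite triangle_comb pE qE homoth_comb; eexists; last by [].
  by split; split=> /=; nra.
have hA t : 0 < t < 1 -> (triangle 0 u v `\` [set 0; u; v]) (homoth p t q).
  move=> /andP[t0 t1]; rewrite regular_comb.
  have [x' [x'v pE']] := vertex_coord Vp; have [y' [y'v qE']] := vertex_coord Vq.
  rewrite pE' qE' homoth_comb; eexists; last by [].
  have ne : ~ (x'.1 = y'.1 /\ x'.2 = y'.2).
    by move=> [E1 E2]; apply: pq; rewrite pE' qE' /comb E1 E2.
  by case: x'v => [][E1 E2]; case: y'v => [][E3 E4]; rewrite E1 E2 E3 E4 in ne *;
    first [exfalso; exact: ne|split; split=> /=; lra].
case: emb => _ pc _ [_ reg] _; split.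
- rewrite itv01; apply: (within_comp (B := triangle 0 u v)) pc; first exact: hT.
  by move=> t _; apply: affine_cvg.
- by move=> t /hA At; apply: reg; exists (homoth p t q).
- by move=> t /hT; apply: pf.
Qed.

End UnimodularTriangle.

(** * Moebius action on slopes and ideal triangles *)

Section Matrices.
Variable R : realType.
Implicit Types (A B : 'M[R]_2).

Definition mx22 (a b c d : R) : 'M[R]_2 :=
  \matrix_(i, j) if i == 0 then (if j == 0 then a else b) else (if j == 0 then c else d).

Lemma mx22E a b c d : [/\ mx22 a b c d 0 0 = a, mx22 a b c d 0 1 = b,
  mx22 a b c d 1 0 = c & mx22 a b c d 1 1 = d].
Proof. by rewrite !mxE. Qed.

Lemma ord2 (i : 'I_2) : i = 0 \/ i = 1.
Proof. by case: i => [[|[|//]] Hi]; [left|right]; apply/val_inj. Qed.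

Lemma mx22P A B : [/\ A 0 0 = B 0 0, A 0 1 = B 0 1, A 1 0 = B 1 0 & A 1 1 = B 1 1] ->
  A = B.
Proof.
by move=> [h1 h2 h3 h4]; apply/matrixP => i j; case: (ord2 i) => ->; case: (ord2 j) => ->.
Qed.

Lemma mulmx22 A B i j : (A *m B) i j = A i 0 * B 0 j + A i 1 * B 1 j.
Proof.
rewrite mxE !big_ord_recl big_ord0 addr0; congr (_ * _ + A i _ * B _ j);
  exact/val_inj.
Qed.

Lemma det22 A : \det A = A 0 0 * A 1 1 - A 0 1 * A 1 0.
Proof.
rewrite (expand_det_row _ 0) !big_ord_recl big_ord0 addr0 /cofactor !det_mx11 !mxE /=.
have e1 : lift (0 : 'I_2) (0 : 'I_1) = 1 by apply/val_inj.
have e2 : lift (1 : 'I_2) (0 : 'I_1) = 0 by apply/val_inj.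
by rewrite !e1 !e2 /= expr0 expr1 mul1r mulN1r mulrN.
Qed.

Lemma det22N A : \det (- A) = \det A.
Proof. by rewrite !det22 !mxE; ring. Qed.

Definition inv22 A := mx22 (A 1 1) (- A 0 1) (- A 1 0) (A 0 0).

Lemma det_inv22 A : \det (inv22 A) = \det A.
Proof.
rewrite !det22 /inv22.
by have [-> -> -> ->] := mx22E (A 1 1) (- A 0 1) (- A 1 0) (A 0 0); ring.
Qed.

Lemma mul22V A : \det A = 1 -> A *m inv22 A = 1%:M.
Proof.
rewrite det22 => D; apply: mx22P; rewrite !mulmx22 /inv22.
have [-> -> -> ->] := mx22E (A 1 1) (- A 0 1) (- A 1 0) (A 0 0).
rewrite !mxE /=; split; rewrite -?D; ring.
Qed.

Lemma mul22VK A : \det A = 1 -> inv22 A *m A = 1%:M.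
Proof.
rewrite det22 => D; apply: mx22P; rewrite !mulmx22 /inv22.
have [-> -> -> ->] := mx22E (A 1 1) (- A 0 1) (- A 1 0) (A 0 0).
rewrite !mxE /=; split; rewrite -?D; ring.
Qed.

Lemma inv22K A : inv22 (inv22 A) = A.
Proof.
by apply: mx22P; rewrite /inv22 !mxE /= ?mxE /= ?opprK.
Qed.

End Matrices.

Section Boundary.
Variable R : realType.
Implicit Types (A B : 'M[R]_2) (k a b c : bdH R) (w : Cplx R).

Lemma bdH_vec_neq0 k : bdH_vec k != 0.
Proof. by case: k => [s|]; rewrite eq_complex /= oner_eq0 ?andbF. Qed.

Lemma slope_vec k : slope (bdH_vec k) = k.
Proof. by case: k => [s|]; rewrite /slope /= ?oner_eq0 ?divr1 ?eqxx. Qed.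

Lemma vec_slope w : w != 0 -> exists2 l : R, l != 0 & bdH_vec (slope w) = l%:C * w.
Proof.
case: w => x y; rewrite eq_complex /= /slope /=; have [->|y0] := eqVneq y 0.
  rewrite andbT => x0; exists x^-1; first by rewrite invr_eq0.
  by apply/eqP; rewrite eq_complex /= !mul0r mulVf // subr0 mulr0 addr0 !eqxx.
move=> _; exists y^-1; first by rewrite invr_eq0.
apply/eqP; rewrite eq_complex /= !mul0r subr0 addr0 mulVf // eqxx andbT.
by rewrite mulrC.
Qed.

Lemma slopeZ (l : R) w : l != 0 -> slope (l%:C * w) = slope w.
Proof.
case: w => x y l0; rewrite /slope /= !mul0r subr0 addr0 mulf_eq0 (negbTE l0) /=.
by case: eqVneq => // y0; rewrite invfM mulrACA divff // mul1r.
Qed.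

Lemma slope_eq w w' : w != 0 -> w' != 0 -> (slope w = slope w') <-> cross w w' = 0.
Proof.
move=> w0 w'0; split=> [E|].
  have [l l0 lE] := vec_slope w0; have [l' l'0 l'E] := vec_slope w'0.
  rewrite E l'E in lE; have wE : w = (l^-1 * l')%:C * w'.
    by rewrite rmorphM -mulrA lE mulrA -rmorphM mulVf // mul1r.
  by rewrite wE /cross; case: (w') => x y /=; ring.
case: w w0 => x y; case: w' w'0 => x' y'; rewrite !eq_complex /cross /slope /=.
have [->|y0] := eqVneq y 0; have [->|y'0] := eqVneq y' 0 => //=.
- by rewrite andbT mul0r subr0 => _ x0 /eqP; rewrite mulf_eq0 (negbTE x0) (negbTE y'0).
- by rewrite andbT mulr0 sub0r => x0 _ /eqP; rewrite oppr_eq0 mulf_eq0 (negbTE x0) (negbTE y0).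
move=> _ _ /eqP; rewrite subr_eq0 => /eqP E; congr Some.
by apply/eqP; rewrite eqr_div // E mulrC.
Qed.

Lemma bdH_detE a b : bdH_det a b = cross (bdH_vec a) (bdH_vec b).
Proof. by []. Qed.

Lemma bdH_det_neq0 a b : a <> b -> bdH_det a b != 0.
Proof.
move=> ab; rewrite bdH_detE; apply/eqP => E; apply: ab.
by rewrite -(slope_vec a) -(slope_vec b); apply/slope_eq; rewrite ?bdH_vec_neq0.
Qed.

Lemma mx_act_mul A B w : mx_act (A *m B) w = mx_act A (mx_act B w).
Proof.
by rewrite /mx_act /= !mulmx22; congr (_ +i* _); ring.
Qed.

Lemma mx_act1 w : mx_act 1%:M w = w.
Proof. by case: w => x y; rewrite /mx_act !mxE /= !mul0r !mul1r addr0 add0r. Qed.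

Lemma cross_mx_act A w w' : cross (mx_act A w) (mx_act A w') = \det A * cross w w'.
Proof. by rewrite det22 /cross /mx_act /=; ring. Qed.

Lemma mx_act_neq0 A w : \det A = 1 -> w != 0 -> mx_act A w != 0.
Proof.
move=> D w0; apply: contra_neq w0 => E.
rewrite -(mx_act1 w) -(mul22VK D) mx_act_mul E /mx_act /= !mulr0 !addr0 //.
Qed.

Lemma mobius_bdE A w : \det A = 1 -> w != 0 -> mobius_bd A (slope w) = slope (mx_act A w).
Proof.
move=> D w0; have [l l0 lE] := vec_slope w0.
by rewrite /mobius_bd lE mx_actZ slopeZ.
Qed.

Lemma mobius_bd_mul A B k : \det A = 1 -> \det B = 1 ->
  mobius_bd (A *m B) k = mobius_bd A (mobius_bd B k).
Proof.
move=> DA DB; rewrite {1}/mobius_bd mx_act_mul -mobius_bdE //.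
by apply: mx_act_neq0 => //; apply: bdH_vec_neq0.
Qed.

Lemma mobius_bd1 k : mobius_bd 1%:M k = k.
Proof. by rewrite /mobius_bd mx_act1 slope_vec. Qed.

Lemma mobius_bd_inj A : \det A = 1 -> injective (mobius_bd A).
Proof.
move=> D k l E; rewrite -(mobius_bd1 k) -(mobius_bd1 l) -(mul22VK D).
by rewrite !mobius_bd_mul ?det_inv22 // E.
Qed.

End Boundary.

Section HyperbolicPlane.
Variable R : realType.
Implicit Types (A B : 'M[R]_2) (k a b c : bdH R) (z w : Cplx R).
Local Notation H := (upper_half_plane (R := R)).

Definition mobius_den A z : Cplx R := (A 1 0)%:C * z + (A 1 1)%:C.

Lemma mobius_den_neq0 A z : \det A = 1 -> H z -> mobius_den A z != 0.
Proof.
rewrite det22; case: z => x y; rewrite /upper_half_plane /= => D y0.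
rewrite /mobius_den eq_complex /= !mul0r subr0 !addr0; apply/negP => /andP[/eqP h1 /eqP].
move=> /eqP; rewrite mulf_eq0 (gt_eqF y0) orbF => /eqP h2.
move: h1 D; rewrite h2 mul0r add0r => ->; rewrite !mulr0 subr0 => /eqP.
by rewrite eq_sym oner_eq0.
Qed.

Lemma mobius_mul A B z : \det A = 1 -> \det B = 1 -> H z ->
  mobius (A *m B) z = mobius A (mobius B z).
Proof.
move=> DA DB Hz; have dB := mobius_den_neq0 DB Hz.
have dAB : mobius_den (A *m B) z != 0.
  by apply: mobius_den_neq0 => //; rewrite det_mulmx DA DB mulr1.
rewrite /mobius_den in dB dAB.
rewrite /mobius; rewrite !mulmx22 !rmorphD !rmorphM /= in dAB *.
field; rewrite dB /=; apply: contra_neq dAB => E; rewrite -E; ring.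
Qed.

Lemma mobius1 z : mobius 1%:M z = z.
Proof. by rewrite /mobius !mxE /= mul1r mul0r addr0 add0r divr1. Qed.

Lemma mobius_upper A z : \det A = 1 -> H z -> H (mobius A z).
Proof.
move=> D Hz; have := mobius_den_neq0 D Hz; rewrite det22 in D; move: Hz.
case: z => x y; rewrite /upper_half_plane /mobius_den /= => y0.
set p := A 1 0 * x + A 1 1; set q := A 1 0 * y => d0.
have n0 : 0 < p ^+ 2 + q ^+ 2.
  rewrite lt_def addr_ge0 ?sqr_ge0 // andbT paddr_eq0 ?sqr_ge0 // !sqrf_eq0.
  by move: d0; rewrite eq_complex /= !mul0r subr0 !addr0.
rewrite /= !mul0r !subr0 !addr0 -/p -/q.
rewrite (_ : _ + _ = y / (p ^+ 2 + q ^+ 2)); first by rewrite divr_gt0.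
rewrite -[y in RHS]mul1r -D /p /q; field.
by rewrite -/p -/q gt_eqF.
Qed.

Definition vec_form w z : Cplx R := (complex.Im w)%:C * z - (complex.Re w)%:C.

Lemma vec_formZ (l : R) w z : vec_form (l%:C * w) z = l%:C * vec_form w z.
Proof.
by case: w => x y; rewrite /vec_form /= !mul0r subr0 addr0 !rmorphM /=; ring.
Qed.

Lemma vec_form_mobius A w z : \det A = 1 -> H z ->
  vec_form (mx_act A w) (mobius A z) = vec_form w z / mobius_den A z.
Proof.
move=> D Hz; have d0 := mobius_den_neq0 D Hz; rewrite det22 in D.
apply: (mulIf d0); rewrite divfK //.
have mE : mobius A z * mobius_den A z = (A 0 0)%:C * z + (A 0 1)%:C by rewrite divfK.
rewrite /vec_form mulrBl -mulrA mE /mobius_den /mx_act /=.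
have DC : (A 0 0)%:C * (A 1 1)%:C - (A 0 1)%:C * (A 1 0)%:C = 1 :> R[i].
  by rewrite -!rmorphM -rmorphB D.
case: w => x y /=; rewrite !rmorphD !rmorphM /=.
rewrite -[RHS]mul1r -DC; ring.
Qed.

(** Under [A] the two linear forms are divided by the denominator [c z + d] and
    the determinants are preserved; the representatives [bdH_vec] of the slopes
    are rescaled by nonzero reals [la], [lb], [lc]. The defining expression of the
    half-plane is multiplied by the square of [la lb lc / |c z + d|]. *)
Lemma mobius_half_plane A a b c z : \det A = 1 -> H z ->
  half_plane (mobius_bd A a) (mobius_bd A b) (mobius_bd A c) (mobius A z) <->
  half_plane a b c z.
Proof.
move=> D Hz; have d0 := mobius_den_neq0 D Hz.
have VE k : exists2 l : R, l != 0 & bdH_vec (mobius_bd A k) = l%:C * mx_act A (bdH_vec k).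
  by apply: vec_slope; apply: mx_act_neq0 => //; apply: bdH_vec_neq0.
have [la la0 aE] := VE a; have [lb lb0 bE] := VE b; have [lc lc0 cE] := VE c.
pose d := mobius_den A z; pose rho := complex.Re d^-1 ^+ 2 + complex.Im d^-1 ^+ 2.
have rho0 : 0 < rho.
  rewrite lt_def addr_ge0 ?sqr_ge0 // andbT paddr_eq0 ?sqr_ge0 // !sqrf_eq0.
  by have : d^-1 != 0 by [rewrite invr_eq0]; case: d^-1 => p q; rewrite eq_complex.
have formE k l : bdH_vec (mobius_bd A k) = l%:C * mx_act A (bdH_vec k) ->
    bdH_form (mobius_bd A k) (mobius A z) = l%:C * (bdH_form k z * d^-1).
  by move=> E; rewrite /bdH_form E -/(vec_form _ _) vec_formZ vec_form_mobius.
have detE k l lk ll : bdH_vec (mobius_bd A k) = lk%:C * mx_act A (bdH_vec k) ->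
    bdH_vec (mobius_bd A l) = ll%:C * mx_act A (bdH_vec l) ->
    bdH_det (mobius_bd A k) (mobius_bd A l) = lk * ll * bdH_det k l.
  move=> Ek El; rewrite !bdH_detE Ek El -[cross (bdH_vec k) (bdH_vec l)]mul1r -D.
  rewrite -cross_mx_act /cross; case: (mx_act A (bdH_vec k)) => p q.
  by case: (mx_act A (bdH_vec l)) => p' q' /=; ring.
have -> : half_plane (mobius_bd A a) (mobius_bd A b) (mobius_bd A c) (mobius A z) <->
   H (mobius A z) /\ 0 <= rho * (la * lb * lc) ^+ 2 *
      (complex.Re (bdH_form a z * (bdH_form b z)^*) * (bdH_det a c * bdH_det b c)).
  rewrite /half_plane /= (formE _ _ aE) (formE _ _ bE) (detE _ _ _ _ aE cE) (detE _ _ _ _ bE cE).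
  rewrite [X in 0 <= X](_ : _ = rho * (la * lb * lc) ^+ 2 *
      (complex.Re (bdH_form a z * (bdH_form b z)^*) * (bdH_det a c * bdH_det b c))) //.
  rewrite /rho; case: (d^-1) => p q; case: (bdH_form a z) => r s.
  by case: (bdH_form b z) => r' s' /=; ring.
rewrite pmulr_rge0; last by rewrite mulr_gt0 // exprn_even_gt0 //= !mulf_neq0.
by split=> -[h1 h2]; split=> //; apply: mobius_upper.
Qed.

Lemma mobius_ideal_triangle A a b c : \det A = 1 ->
  mobius A @` ideal_triangle a b c =
  ideal_triangle (mobius_bd A a) (mobius_bd A b) (mobius_bd A c).
Proof.
move=> D; apply/seteqP; split=> [_ [z [[h1 h2] h3] <-]|w [[h1 h2] h3]].
  have Hz : H z by case: h1.
  by split; [split|]; apply/mobius_half_plane.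
have Hw : H w by case: h1.
have D' : \det (inv22 A) = 1 by rewrite det_inv22.
have Hz := mobius_upper D' Hw.
have wE : w = mobius A (mobius (inv22 A) w) by rewrite -mobius_mul // mul22V // mobius1.
exists (mobius (inv22 A) w) => //; rewrite wE in h1 h2 h3.
by split; [split|]; apply/(mobius_half_plane _ _ _ D Hz).
Qed.

Lemma half_planeC a b c : half_plane a b c = half_plane b a c.
Proof.
have E z : complex.Re (bdH_form a z * (bdH_form b z)^*) * (bdH_det a c * bdH_det b c) =
    complex.Re (bdH_form b z * (bdH_form a z)^*) * (bdH_det b c * bdH_det a c).
  by case: (bdH_form a z) => p q; case: (bdH_form b z) => r s /=; ring.
by apply/seteqP; split=> z [Hz h]; split=> //; [rewrite -E|rewrite E].
Qed.

Lemma ideal_triangle_rot a b c : ideal_triangle a b c = ideal_triangle b c a.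
Proof. by rewrite /ideal_triangle -setIA setIC. Qed.

Lemma ideal_triangleC a b c : ideal_triangle a b c = ideal_triangle b a c.
Proof.
rewrite /ideal_triangle (half_planeC a b c) (half_planeC b c a) (half_planeC c a b).
by rewrite setIAC.
Qed.

Local Notation det := bdH_det.

(** The points [s + 1 / (c - i t)] lie on the geodesic from [s] to [a] for the
    constant [c] below, and tend to [s] as [t] grows. *)
Lemma ideal_triangle_accum s a b (e : R) :
  Some s <> a -> Some s <> b -> 0 < e ->
  exists2 z, ideal_triangle (Some s) a b z & normc (z - s%:C) < e.
Proof.
move=> sa sb e0.
have da0 : det a (Some s) != 0 by apply: bdH_det_neq0 => E; apply: sa.
have db0 : det b (Some s) != 0 by apply: bdH_det_neq0 => E; apply: sb.
pose al := complex.Im (bdH_vec a); pose ar := complex.Re (bdH_vec a).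
pose bl := complex.Im (bdH_vec b); pose br := complex.Re (bdH_vec b).
have daE : det a (Some s) = ar - al * s by rewrite /bdH_det /= mulr1.
have dbE : det b (Some s) = br - bl * s by rewrite /bdH_det /= mulr1.
set da := det a (Some s) in da0 daE; set db := det b (Some s) in db0 dbE.
pose c := al / da.
pose K := da * db * ((da * bl + db * al) * c - al * bl).
(* Large enough for the point to be close to [s] and on the right side of the
   geodesic from [a] to [b]. *)
pose q := `|K| / (da * db) ^+ 2; pose t := e^-1 + 1 + q.
have dd0 : 0 < (da * db) ^+ 2 by rewrite exprn_even_gt0 //= mulf_neq0.
have q0 : 0 <= q by rewrite divr_ge0 // ltW.
have e'0 : 0 < e^-1 by rewrite invr_gt0.
have te : e^-1 < t by rewrite /t; lra.
have t0 : 0 < t by apply: lt_trans te.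
have t1 : 1 <= t by rewrite /t; lra.
have tK : `|K| <= (da * db) ^+ 2 * t ^+ 2.
  rewrite mulrC -ler_pdivrMr //; apply: (@le_trans _ _ t).
    by rewrite -/q /t; lra.
  by rewrite expr2 ler_pMr.
pose n := c ^+ 2 + t ^+ 2.
have n0 : 0 < n by rewrite ltr_wpDl ?sqr_ge0 // exprn_gt0.
pose x := c / n; pose y := t / n.
have xy : x ^+ 2 + y ^+ 2 = n^-1.
  by rewrite /x /y; move: n0; rewrite /n => n0; field; rewrite gt_eqF.
have y0 : 0 < y by rewrite divr_gt0.
have tn : n^-1 <= t ^- 2 by rewrite lef_pV2 ?posrE ?exprn_gt0 // lerDr sqr_ge0.
exists ((s + x) +i* y); last first.
  rewrite [X in normc X](_ : _ = x +i* y); last first.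
    by apply/eqP; rewrite eq_complex /=; apply/andP; split; apply/eqP; ring.
  rewrite /= xy; apply: (@le_lt_trans _ _ (Num.sqrt (t ^- 2))); first exact: ler_wsqrtr.
  by rewrite -exprVn sqrtr_sqr gtr0_norm ?invr_gt0 // -[e]invrK ltf_pV2 // posrE.
have fs : bdH_form (Some s) ((s + x) +i* y) = x +i* y.
  by rewrite /bdH_form /=; apply/eqP; rewrite eq_complex /=; apply/andP; split; apply/eqP; ring.
have fa : bdH_form a ((s + x) +i* y) = (al * x - da) +i* (al * y).
  rewrite /bdH_form -/al -/ar daE.
  by apply/eqP; rewrite eq_complex /=; apply/andP; split; apply/eqP; ring.
have fb : bdH_form b ((s + x) +i* y) = (bl * x - db) +i* (bl * y).
  rewrite /bdH_form -/bl -/br dbE.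
  by apply/eqP; rewrite eq_complex /=; apply/andP; split; apply/eqP; ring.
have Hz : H ((s + x) +i* y) by [].
have xE : da * x = al * (x ^+ 2 + y ^+ 2) by rewrite xy /x /c; field; rewrite da0 gt_eqF.
split; [split|].
- split=> //; rewrite fs fa /=.
  rewrite [X in 0 <= X](_ : _ = (al * (x ^+ 2 + y ^+ 2) - da * x) *
    (det (Some s) b * det a b)); last by ring.
  by rewrite xE subrr mul0r.
- split=> //; rewrite fa fb /= -/da -/db.
  rewrite [X in 0 <= X](_ : _ = n^-1 * ((da * db) ^+ 2 * n - K)); last first.
    transitivity (da * db * (al * bl * (x ^+ 2 + y ^+ 2) - (al * db + bl * da) * x + da * db)).
      by ring.
    by rewrite xy /x /K; field; rewrite gt_eqF.
  rewrite mulr_ge0 ?invr_ge0 ?(ltW n0) // subr_ge0; apply: le_trans (ler_norm _) _.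
  by apply: le_trans tK _; rewrite ler_pM2l // lerDr sqr_ge0.
- split=> //; rewrite fb fs /=.
  rewrite [X in 0 <= X](_ : _ = det a b ^+ 2 * n^-1).
    by rewrite mulr_ge0 ?sqr_ge0 // invr_ge0 ltW.
  have abE : det a b = ar * bl - al * br by [].
  have baE : det b a = - det a b by rewrite abE /bdH_det -/al -/ar -/bl -/br; ring.
  have saE : det (Some s) a = - da by rewrite daE /bdH_det -/al -/ar /=; ring.
  transitivity (det a b * (bl * (da * (x ^+ 2 + y ^+ 2)) - db * (da * x))).
    by rewrite baE saE; ring.
  by rewrite xE xy; rewrite abE daE dbE; ring.
Qed.

Definition base_triangle : set (Cplx R) := ideal_triangle None (Some 0) (Some 1).

Lemma base_triangleP z : base_triangle z -> [/\ 0 <= complex.Re z, complex.Re z <= 1 &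
  0 <= complex.Re z * (complex.Re z - 1) + complex.Im z ^+ 2].
Proof.
case: z => x y [[[_ h1] [_ h2]] [_ h3]]; move: h1 h2 h3.
rewrite /bdH_form /bdH_det /=.
rewrite ?(mul0r, mul1r, mulr0, mulr1, subr0, sub0r, addr0, add0r, oppr0, mulrN, mulNr, opprK).
by move=> h1 h2 h3; split; lra.
Qed.

(** A finite ideal vertex [s] is a limit of points of the triangle
    ([ideal_triangle_accum]). The strip gives [0 <= s <= 1] and the half-circle
    gives [s (s - 1) >= 0]. *)
Lemma base_triangle_vertex k : ideal_vertex k base_triangle ->
  [\/ k = None, k = Some 0 | k = Some 1].
Proof.
case: k => [s|]; last by move=> _; apply: Or31.
move=> [a [b [sa sb ab DE]]].
have acc (e : R) : 0 < e -> exists2 z, base_triangle z & normc (z - s%:C) < e.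
  by rewrite DE; apply: ideal_triangle_accum.
have near (e : R) : 0 < e -> exists x y : R, [/\ 0 <= x, x <= 1, 0 <= x * (x - 1) + y ^+ 2,
     `|x - s| < e & `|y| < e].
  move=> /acc[[x y] /base_triangleP /= [h1 h2 h3] h4]; exists x, y; split=> //.
    by have := normc_Re ((x +i* y) - s%:C); move=> /le_lt_trans/(_ h4).
  by have := normc_Im ((x +i* y) - s%:C); move=> /le_lt_trans/(_ h4); rewrite /= subr0.
have s0 : 0 <= s.
  rewrite leNgt; apply/negP => s0; have [|x [y [h1 _ _ + _]]] := near (- s).
    by rewrite oppr_gt0.
  by rewrite ltr_norml => /andP[_]; lra.
have s1 : s <= 1.
  rewrite leNgt; apply/negP => s1; have [|x [y [_ h1 _ + _]]] := near (s - 1).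
    by rewrite subr_gt0.
  by rewrite ltr_norml => /andP[+ _]; lra.
have [->|sn0] := eqVneq s 0; first by apply: Or32.
have [->|sn1] := eqVneq s 1; first by apply: Or33.
exfalso; pose m := s * (1 - s); clear DE acc sa sb ab.
have sp : 0 < s by rewrite lt_def sn0.
have sl : s < 1 by rewrite lt_neqAle sn1.
have m0 : 0 < m by rewrite mulr_gt0 // subr_gt0.
have [|x [y [h1 h2 h3]]] := near (m / 4); first by rewrite divr_gt0.
rewrite !ltr_norml => /andP[h4 h5] /andP[h6 h7].
have m1 : m <= 1 by rewrite /m; nra.
have y2 : y ^+ 2 < m / 4 by nra.
clear near; rewrite /m in h4 h5 y2 m0 m1; nra.
Qed.

End HyperbolicPlane.

Arguments base_triangle : clear implicits.

(** * Flags of the Farey tessellation *)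

Section Farey.
Variable R : realType.
Implicit Types (A B C : 'M[R]_2) (k : bdH R).

Definition SL2Z : set 'M[R]_2 :=
  [set A | \det A = 1 /\ forall i j, A i j \is a Num.int].

Definition edge0 : bdH R * set (Cplx R) := (None, base_triangle R).

Lemma SL2Z_mul A B : SL2Z A -> SL2Z B -> SL2Z (A *m B).
Proof.
move=> [DA IA] [DB IB]; split; first by rewrite det_mulmx DA DB mulr1.
by move=> i j; rewrite mulmx22 rpredD ?rpredM.
Qed.

Lemma SL2Z_inv A : SL2Z A -> SL2Z (inv22 A).
Proof.
move=> [DA IA]; split; first by rewrite det_inv22.
have [h1 h2 h3 h4] := mx22E (A 1 1) (- A 0 1) (- A 1 0) (A 0 0).
by move=> i j; case: (ord2 i) => ->; case: (ord2 j) => ->;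
  rewrite /inv22 ?h1 ?h2 ?h3 ?h4 ?rpredN.
Qed.

Lemma SL2Z_mx22 (a b c d : R) : a * d - b * c = 1 ->
  a \is a Num.int -> b \is a Num.int -> c \is a Num.int -> d \is a Num.int ->
  SL2Z (mx22 a b c d).
Proof.
move=> D Ia Ib Ic Id; have [h1 h2 h3 h4] := mx22E a b c d.
split; first by rewrite det22 h1 h2 h3 h4.
by move=> i j; case: (ord2 i) => ->; case: (ord2 j) => ->; rewrite ?h1 ?h2 ?h3 ?h4.
Qed.

Lemma base_triangle_upper : base_triangle R `<=` @upper_half_plane R.
Proof. by move=> z [[[]]]. Qed.

Lemma edge_act_mul A B (e : bdH R * set (Cplx R)) : \det A = 1 -> \det B = 1 ->
  e.2 `<=` @upper_half_plane R ->
  edge_act (A *m B) e = edge_act A (edge_act B e).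
Proof.
move=> DA DB eH; rewrite /edge_act /= mobius_bd_mul //; congr (_, _).
apply/seteqP; split=> [_ [z ez <-]|_ [_ [z ez <-] <-]].
  by exists (mobius B z); [exists z|rewrite mobius_mul //; apply: eH].
by exists z => //; rewrite mobius_mul //; apply: eH.
Qed.

Lemma edge_act1 e : edge_act (1%:M : 'M[R]_2) e = e.
Proof.
case: e => k D; rewrite /edge_act mobius_bd1; congr (_, _) => /=.
apply/seteqP; split=> [_ [z Dz <-]|z Dz]; first by rewrite mobius1.
by exists z => //; rewrite mobius1.
Qed.

Lemma edge_actN A e : edge_act (- A) e = edge_act A e.
Proof.
case: e => k D; rewrite /edge_act /=; congr (_, _).
  rewrite /mobius_bd; apply: slope_sign; right.
  by apply/eqP; rewrite eq_complex /= !mxE; apply/andP; split; apply/eqP; ring.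
have E z : mobius (- A) z = mobius A z.
  by rewrite /mobius !mxE !rmorphN /= !mulNr -!opprD invrN mulrNN.
by apply/seteqP; split=> _ [z Dz <-]; exists z.
Qed.

Lemma ideal_vertex_mobius A k (D : set (Cplx R)) : \det A = 1 ->
  ideal_vertex k D -> ideal_vertex (mobius_bd A k) (mobius A @` D).
Proof.
move=> DA [a [b [ka kb ab ->]]]; exists (mobius_bd A a), (mobius_bd A b).
by split; rewrite ?mobius_ideal_triangle // => /(mobius_bd_inj DA).
Qed.

Lemma base_vertex_infty : ideal_vertex None (base_triangle R).
Proof.
exists (Some 0), (Some 1); split=> // -[] /eqP; by rewrite eq_sym oner_eq0.
Qed.

(** The rotation of order three of the base triangle: infinity goes to 0, 0 to
    1 and 1 to infinity. *)
Definition rot : 'M[R]_2 := mx22 0 (-1) 1 (-1).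

Lemma SL2Z_rot : SL2Z rot.
Proof. by apply: SL2Z_mx22; rewrite ?rpredN ?rpred0 ?rpred1 //; ring. Qed.

Lemma det_rot : \det rot = 1. Proof. by case: SL2Z_rot. Qed.

Lemma rot_bd : [/\ mobius_bd rot None = Some 0, mobius_bd rot (Some 0) = Some 1 &
  mobius_bd rot (Some 1) = None].
Proof.
have n1 : (-1 : R) != 0 by rewrite oppr_eq0 oner_eq0.
have n2 : (1 : R) != 0 by rewrite oner_eq0.
rewrite /mobius_bd /mx_act /rot; have [-> -> -> ->] := mx22E (0 : R) (-1) 1 (-1).
split=> /=.
- transitivity (slope (0 +i* 1 : Cplx R)); first by congr slope; congr (_ +i* _); ring.
  by rewrite /slope /= (negbTE n2) mul0r.
- transitivity (slope (-1 +i* -1 : Cplx R)); first by congr slope; congr (_ +i* _); ring.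
  by rewrite /slope /= (negbTE n1) divff.
- transitivity (slope (-1 +i* 0 : Cplx R)); first by congr slope; congr (_ +i* _); ring.
  by rewrite /slope /= eqxx.
Qed.

Lemma rot_base_triangle : mobius rot @` base_triangle R = base_triangle R.
Proof.
rewrite /base_triangle mobius_ideal_triangle ?det_rot //; have [-> -> ->] := rot_bd.
by rewrite -ideal_triangle_rot.
Qed.

(** Up to the matrix [A] the vertex is infinity, 0 or 1, and a power of [rot]
    brings it from infinity. *)
Lemma vertex_of_image A k : SL2Z A -> ideal_vertex k (mobius A @` base_triangle R) ->
  exists2 B, SL2Z B & (k, mobius A @` base_triangle R) = edge_act B edge0.
Proof.
move=> SA kv; have [DA IA] := SA; have SA' := SL2Z_inv SA; have [DA' _] := SA'.
have kE : k = mobius_bd A (mobius_bd (inv22 A) k).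
  by rewrite -mobius_bd_mul // mul22V // mobius_bd1.
have : ideal_vertex (mobius_bd (inv22 A) k) (base_triangle R).
  have := ideal_vertex_mobius DA' kv; congr (ideal_vertex _ _).
  have := edge_act_mul (e := edge0) DA' DA base_triangle_upper.
  by rewrite mul22VK // edge_act1 => -[_ <-].
have [r1 r2 r3] := rot_bd; have Sr := SL2Z_rot; have Dr := det_rot.
have key B : SL2Z B -> mobius B @` base_triangle R = base_triangle R ->
    mobius_bd (inv22 A) k = mobius_bd B None ->
    exists2 B, SL2Z B & (k, mobius A @` base_triangle R) = edge_act B edge0.
  move=> SB BD E; exists (A *m B); first exact: SL2Z_mul.
  have [DB _] := SB.
  by rewrite edge_act_mul //; [rewrite /edge_act /= BD -E -kE|exact: base_triangle_upper].
case/base_triangle_vertex => E.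
- apply: (key 1%:M); rewrite ?mobius_bd1 //.
    split; first exact: det1.
    by move=> i j; rewrite mxE; case: (i == j); rewrite ?rpred0 ?rpred1.
  by have := edge_act1 edge0 => -[].
- by apply: (key rot) => //; [exact: rot_base_triangle|rewrite r1].
- apply: (key (rot *m rot)); first exact: SL2Z_mul.
    have := edge_act_mul (e := edge0) Dr Dr base_triangle_upper => -[_ ->].
    by rewrite !rot_base_triangle.
  by rewrite mobius_bd_mul // r1 r2.
Qed.

(** A matrix fixing infinity is a translation by an integer [n] up to sign; it
    maps the vertices 0 and 1 to [n] and [n + 1], which must again be vertices. *)
Lemma edge0_stab C : SL2Z C -> edge_act C edge0 = edge0 -> C = 1%:M \/ C = - 1%:M.
Proof.
move=> [DC IC] [E1 E2].
have c10 : C 1 0 = 0.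
  have : slope (mx_act C 1) = slope (1 : Cplx R) by rewrite (slope_vec None).
  move/(slope_eq _ _); rewrite mx_act_neq0 ?oner_neq0 // => /(_ isT isT).
  by rewrite /cross /mx_act /= !mulr0 !mulr1 !addr0 sub0r => /eqP; rewrite oppr_eq0 => /eqP.
have D := DC; rewrite det22 c10 mulr0 subr0 in D.
have c11 : C 1 1 != 0.
  by apply/eqP => E; move: D; rewrite E mulr0 => /eqP; rewrite eq_sym oner_eq0.
pose n := C 0 1 / C 1 1.
have vtx k : ideal_vertex k (base_triangle R) ->
    [\/ mobius_bd C k = None, mobius_bd C k = Some 0 | mobius_bd C k = Some 1].
  by move=> kv; apply: base_triangle_vertex; rewrite -{1}E2; apply: ideal_vertex_mobius.
have v0 : ideal_vertex (Some 0) (base_triangle R).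
  exists (Some 1), None; split=> //; last by rewrite /base_triangle ideal_triangle_rot.
  by move=> [] /eqP; rewrite eq_sym oner_eq0.
have v1 : ideal_vertex (Some 1) (base_triangle R).
  exists None, (Some 0); split=> //; last by rewrite /base_triangle -ideal_triangle_rot.
  by move=> [] /eqP; rewrite oner_eq0.
have C0 : mobius_bd C (Some 0) = Some n.
  rewrite /mobius_bd /slope /mx_act /= c10 !mulr0 !add0r !mulr1 (negbTE c11) //.
have C1 : mobius_bd C (Some 1) = Some (C 0 0 / C 1 1 + n).
  rewrite /mobius_bd /slope /mx_act /= c10 !mulr1 !add0r (negbTE c11) /n mulrDl //.
have := vtx _ v0; have := vtx _ v1; rewrite C0 C1.
have I00 := IC 0 0; have I11 := IC 1 1.
have n00 : C 0 0 != 0.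
  by apply/eqP => E; move: D; rewrite E mul0r => /eqP; rewrite eq_sym oner_eq0.
have [a1 b1] : `|C 0 0| >= 1 /\ `|C 1 1| >= 1 by split; apply: norm_intr_ge1.
have ab : `|C 0 0| * `|C 1 1| = 1 by rewrite -normrM D normr1.
have sq : C 1 1 ^+ 2 = 1.
  rewrite -(real_normK (num_real _)); apply/eqP; rewrite sqrf_eq1; apply/orP; left.
  by apply/eqP; nra.
have d1 : C 0 0 / C 1 1 = 1.
  have -> : C 0 0 = C 1 1.
    by rewrite -[C 0 0]mulr1 -sq expr2 mulrA D mul1r.
  by rewrite divff.
rewrite d1 => h1 h2.
have n0 : n = 0.
  by case: h1 => [//|[]|[]]; case: h2 => [//|[]|[]]; lra.
have c01 : C 0 1 = 0.
  by move/eqP: n0; rewrite /n mulf_eq0 invr_eq0 (negbTE c11) orbF => /eqP.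
have c00 : C 0 0 = C 1 1 by rewrite -[C 0 0]mulr1 -sq expr2 mulrA D mul1r.
move/eqP: sq; rewrite sqrf_eq1 => /orP[]/eqP E; [left|right];
  by apply: mx22P; rewrite !mxE /= c10 c01 c00 E ?oppr0.
Qed.

Lemma edge_free A B : SL2Z A -> SL2Z B -> edge_act A edge0 = edge_act B edge0 ->
  A = B \/ A = - B.
Proof.
move=> SA SB E; have [DA _] := SA; have [DB _] := SB; have [DB' _] := SL2Z_inv SB.
have /edge0_stab : SL2Z (inv22 B *m A) by apply: SL2Z_mul => //; apply: SL2Z_inv.
rewrite edge_act_mul ?E //; last exact: base_triangle_upper.
rewrite -edge_act_mul //; last exact: base_triangle_upper.
rewrite mul22VK // edge_act1 => /(_ erefl).
by case=> H; [left|right]; rewrite -[A]mul1mx -(mul22V DB) -mulmxA H ?mulmxN mulmx1.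
Qed.

Lemma image_base_triangle (u v : Cplx R) : cross u v = 1 ->
  mobius (mx22 (complex.Re u) (complex.Re v) (complex.Im u) (complex.Im v)) @` base_triangle R =
  ideal_triangle (slope u) (slope v) (slope (u + v)).
Proof.
move=> D; have DA : \det (mx22 (complex.Re u) (complex.Re v) (complex.Im u) (complex.Im v)) = 1.
  rewrite det22.
  have [-> -> -> ->] := mx22E (complex.Re u) (complex.Re v) (complex.Im u) (complex.Im v).
  by rewrite -D /cross; ring.
rewrite /base_triangle mobius_ideal_triangle // /mobius_bd /mx_act.
have [-> -> -> ->] := mx22E (complex.Re u) (complex.Re v) (complex.Im u) (complex.Im v).
rewrite /= !mulr1 !mulr0 !addr0 !add0r.
by case: (u) (v) => a b [c d].
Qed.

(** The columns of [A] are two of the sides, in the order that makes the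
    determinant 1. *)
Lemma farey_triangle (u v : Cplx R) : gauss_int u -> gauss_int v -> cross u v ^+ 2 = 1 ->
  exists2 A, SL2Z A &
    ideal_triangle (slope (v - u)) (slope (- v)) (slope u) = mobius A @` base_triangle R.
Proof.
move=> gu gv uv1.
have sv : slope (- v) = slope v by apply: slope_sign; right.
have gw := gaussB gv gu.
have cE : cross (v - u) u = - cross u v.
  by rewrite /cross; case: (u) (v) => a b [c d] /=; ring.
have int (a b : Cplx R) : gauss_int a -> gauss_int b -> cross a b = 1 ->
    SL2Z (mx22 (complex.Re a) (complex.Re b) (complex.Im a) (complex.Im b)).
  by move=> /andP[? ?] /andP[? ?] ab; apply: SL2Z_mx22 => //; rewrite -ab /cross; ring.
have vE : v - u + u = v by rewrite subrK.
move/eqP: uv1; rewrite sqrf_eq1 => /orP[]/eqP D.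
  have D' : cross u (v - u) = 1 by rewrite crossC cE opprK.
  eexists; first exact: int gu gw D'.
  have vE' : u + (v - u) = v by rewrite addrC subrK.
  by rewrite image_base_triangle // vE' sv [RHS]ideal_triangle_rot.
have D' : cross (v - u) u = 1 by rewrite cE D opprK.
eexists; first exact: int gw gu D'.
by rewrite image_base_triangle // vE sv [RHS]ideal_triangleC [RHS]ideal_triangle_rot.
Qed.

End Farey.

(** * Orbits of edges and cosets *)

Section Cosets.
Variables (R : realType) (M : translation_surface R).
Implicit Types (A B C : 'M[R]_2).

Lemma pslP A B : psl A = psl B <-> A = B \/ A = - B.
Proof.
split=> [E|[->//|->]].
  by have : psl A A by [left]; rewrite E.
by apply/seteqP; split=> C [] ->; rewrite /psl /= ?opprK; [right|left|right|left].
Qed.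

Lemma psl_mulE A B : psl_mul (psl A) (psl B) = psl (A *m B).
Proof.
apply/seteqP; split=> [_ [A' hA [B' hB <-]]|C [] ->].
- by case: hA => ->; case: hB => ->; rewrite ?mulmxN ?mulNmx ?opprK; [left|right|right|left].
- by exists A; [left|exists B; [left|]].
- by exists (- A); [right|exists B; [left|rewrite mulNmx]].
Qed.

Lemma PSL2ZP A : PSL2Z R (psl A) <-> SL2Z A.
Proof.
split=> [[B [DB IB] /pslP[<-//|E]]|[DA IA]]; last by exists A.
have -> : A = - B by rewrite E opprK.
split; first by rewrite det22N.
by move=> i j; rewrite mxE rpredN.
Qed.

Lemma affine_homeoN A (h : M -> M) : affine_homeo A h -> affine_homeo (- A) h.
Proof.
move=> [h1 h2 h3]; split=> // p psi psi' fp fp' dp dp'.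
have [e [k [e1 nk]]] := h3 p psi psi' fp fp' dp dp'.
exists (- e), k; split; first by case: e1 => ->; [right|left; rewrite opprK].
apply: nbhsS nk => x ->; congr (_ + k).
rewrite mulNr -mulrN; congr (e * _).
by apply/eqP; rewrite eq_complex /= !mxE; apply/andP; split; apply/eqP; ring.
Qed.

Lemma veechP A : veech_group M (psl A) <->
  \det A = 1 /\ exists h : M -> M, affine_homeo A h.
Proof.
split=> [[B [DB [h hB]] /pslP[<-|E]]|H]; last by exists A.
  by split=> //; exists h.
have -> : A = - B by rewrite E opprK.
split; first by rewrite det22N.
by exists h; apply: affine_homeoN.
Qed.

Lemma veech_inv A : veech_group M (psl A) -> veech_group M (psl (inv22 A)).
Proof.
move=> /veechP[DA [h [[hc [g [gc hK gK]]] hS hA]]]; apply/veechP.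
split; first by rewrite det_inv22.
exists g; split.
- by split=> //; exists h.
- apply/seteqP; split=> [_ [x Sx <-]|x Sx].
    by move: Sx; rewrite -{1}hS => -[y Sy <-]; rewrite hK.
  by exists (h x); [rewrite -hS; exists x|rewrite hK].
move=> p psi psi' fp fp' dp dp'.
have [|e [k [e1 nk]]] := hA (g p) psi' psi fp' fp dp'; first by rewrite gK.
have ee := sign_sqr e1.
exists e, (- (e * mx_act (inv22 A) k)); split=> //.
have K : nbhs p (g @^-1` [set x | psi (h x) = e * mx_act A (psi' x) + k]) := gc p _ nk.
move: K; apply: nbhsS => x /=; rewrite gK => ->.
rewrite mx_actD mx_act_sign // -mx_act_mul mul22VK // mx_act1.
by rewrite mulrDr mulrA ee mul1r addrK.
Qed.

(** As [A edge0] corresponds to the element [A] of PSL(2, Z), an orbit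
    corresponds to a right coset; the inverse makes it a left coset. *)
Definition orbit_coset (O : set (bdH R * set (Cplx R))) : set (set 'M[R]_2) :=
  [set g | exists C, [/\ SL2Z C, g = psl C & O (edge_act (inv22 C) (edge0 R))]].

Hypothesis veech_int : veech_group M `<=` PSL2Z R.

Lemma veech_SL2Z A : veech_group M (psl A) -> SL2Z A.
Proof. by move=> /veech_int/PSL2ZP. Qed.

Lemma inv22_mul A B : \det A = 1 -> \det B = 1 -> inv22 (A *m B) = inv22 B *m inv22 A.
Proof.
move=> DA DB; apply: mx22P; rewrite !mulmx22 /inv22 !mulmx22 !mxE /=.
by split; ring.
Qed.

Lemma orbit_cosetE B : SL2Z B ->
  orbit_coset (veech_orbit M (edge_act B (edge0 R))) =
  [set psl_mul (psl (inv22 B)) h | h in veech_group M].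
Proof.
move=> SB; have [DB _] := SB; have SB' := SL2Z_inv SB; have [DB' _] := SB'.
have H := @base_triangle_upper R.
apply/seteqP; split=> [_ [C [SC -> [A gA E]]]|_ [h gh <-]].
  have SA := veech_SL2Z gA; have [DA _] := SA.
  exists (psl (inv22 A)); first exact: veech_inv.
  rewrite psl_mulE -inv22_mul //; apply/pslP.
  rewrite -edge_act_mul // in E; have := edge_free (SL2Z_mul SA SB) (SL2Z_inv SC) E.
  case=> ->; rewrite ?inv22K; first by left.
  right; apply: mx22P; rewrite /inv22 !mxE /= ?mxE /= ?opprK //.
have [A _ hE] := gh; subst h; have gA := veech_inv gh.
have SA := veech_SL2Z gh; have [DA _] := SA.
rewrite psl_mulE; exists (inv22 B *m A); split=> //; first exact: SL2Z_mul.
exists (inv22 A) => //.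
by rewrite inv22_mul // inv22K edge_act_mul // det_inv22.
Qed.

(** An orbit is recovered from its coset, whence the injectivity of
    [orbit_coset]. *)
Lemma orbit_cosetK B : SL2Z B ->
  veech_orbit M (edge_act B (edge0 R)) =
  [set e | exists E, [/\ SL2Z E, e = edge_act E (edge0 R) &
     orbit_coset (veech_orbit M (edge_act B (edge0 R))) (psl (inv22 E))]].
Proof.
move=> SB; have [DB _] := SB; have H := @base_triangle_upper R.
apply/seteqP; split=> [e [A gA <-]|e [E [SE -> [C [SC /pslP EC OC]]]]].
  have SA := veech_SL2Z gA; have [DA _] := SA.
  have E0 := edge_act_mul (e := edge0 R) DA DB H.
  exists (A *m B); split; [exact: SL2Z_mul|by rewrite E0|].
  exists (inv22 (A *m B)); split=> //; first by apply/SL2Z_inv/SL2Z_mul.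
  by rewrite inv22K; exists A.
suff <- : edge_act (inv22 C) (edge0 R) = edge_act E (edge0 R) by [].
case: EC => EC; first by rewrite -EC inv22K.
rewrite -(inv22K E) EC -edge_actN; congr edge_act.
by apply: mx22P; rewrite /inv22 !mxE /= ?mxE /= ?opprK.
Qed.

Lemma quotient_edges_cosets :
  (forall e, graph_edges M e <-> exists2 A, SL2Z A & e = edge_act A (edge0 R)) ->
  (quotient_edges M #= left_cosets (PSL2Z R) (veech_group M))%card.
Proof.
move=> edges; apply/card_set_bijP; exists orbit_coset; split.
- move=> _ [e /edges[B SB ->] <-]; rewrite orbit_cosetE //.
  by exists (psl (inv22 B)) => //; apply/PSL2ZP; apply: SL2Z_inv.
- move=> O O'; rewrite !inE => -[e /edges[B SB ->] <-] [e' /edges[B' SB' ->] <-] E.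
  by rewrite orbit_cosetK // E -orbit_cosetK.
- move=> _ [g [B [DB IB] <-] <-]; have SB : SL2Z B by [].
  exists (veech_orbit M (edge_act (inv22 B) (edge0 R))).
    exists (edge_act (inv22 B) (edge0 R)) => //.
    by apply/edges; exists (inv22 B) => //; apply: SL2Z_inv.
  by rewrite orbit_cosetE ?inv22K //; apply: SL2Z_inv.
Qed.

End Cosets.

(** * Translation covers of the torus *)

Section TranslationCover.
Variables (R : realType) (M : translation_surface R) (f : M -> torus R).
Hypothesis cover_f : ramified_covering f [set torus_proj 0].
Hypothesis sing_f : ts_sing M = f @^-1` [set torus_proj 0].
Hypothesis pull_f : pullback_dz2 f (ts_form M).

(** The sides from 0 to 1 and from 0 to i of the lifted triangle yield saddle
    connections to which [veech_path] applies. *)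
Lemma veech_integral : veech_group M `<=` PSL2Z R.
Proof.
move=> _ [A [DA [h hA]] <-]; apply/PSL2ZP.
pose i : Cplx R := 0 +i* 1.
have g1 : gauss_int (1 : Cplx R) by rewrite /gauss_int /= rpred0 rpred1.
have gi : gauss_int i by rewrite /gauss_int /= rpred0 rpred1.
have u1 : cross 1 i ^+ 2 = 1 by rewrite /cross /= mulr1 mul0r subr0 expr1n.
have [phi [emb pV pf]] := unimodular_triangle g1 gi u1 cover_f sing_f pull_f.
have gA w : [set 0; 1; i] w -> 0 <> w -> w != 0 -> gauss_int (mx_act A w).
  move=> Vw nw w0; have V0 : [set 0; 1; i] (0 : Cplx R) by left; left.
  have [pc reg fp] := unimodular_side g1 gi u1 V0 Vw nw emb pV pf.
  have e0 : side phi 0 w 0 = phi 0 by rewrite /side subr0 mul0r addr0 mulr0.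
  have e1 : side phi 0 w 1 = phi w by rewrite /side subrr mul0r add0r mul1r.
  apply: (veech_path cover_f sing_f pull_f hA (mx_act_neq0 DA w0) pc) => //.
  - by rewrite e0; apply: pV.
  - by rewrite e1; apply: pV.
  - by move=> t t01; rewrite fp // subr0 add0r.
have i0 : i != 0 by rewrite eq_complex /= oner_eq0 andbF.
have V1 : [set 0; 1; i] 1 by left; right.
have Vi : [set 0; 1; i] i by right.
have /andP[I00 I10] := gA 1 V1 (fun E => elimN eqP (oner_neq0 _) (esym E)) (oner_neq0 _).
have /andP[I01 I11] := gA i Vi (fun E => elimN eqP i0 (esym E)) i0.
rewrite /= !mulr0 !mulr1 ?add0r ?addr0 in I00 I10 I01 I11.
by split=> // a b; case: (ord2 a) => ->; case: (ord2 b) => ->.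
Qed.

(** The sides of the lifted triangle are saddle connections. *)
Lemma unimodular_periodic (u v : Cplx R) : gauss_int u -> gauss_int v ->
  cross u v ^+ 2 = 1 ->
  periodic_triangles M (ideal_triangle (slope (v - u)) (slope (- v)) (slope u)).
Proof.
move=> gu gv uv1; have [phi [emb pV pf]] := unimodular_triangle gu gv uv1 cover_f sing_f pull_f.
have uv0' := uv0 uv1.
have saddle p q : [set 0; u; v] p -> [set 0; u; v] q -> p <> q ->
    exists2 e : Cplx R, e = 1 \/ e = -1 & saddle_connection (side phi p q) (e * (q - p)).
  move=> Vp Vq pq; have [pc reg fp] := unimodular_side gu gv uv1 Vp Vq pq emb pV pf.
  have e0 : side phi p q 0 = phi p by rewrite /side subr0 mul0r addr0 mul1r.
  have e1 : side phi p q 1 = phi q by rewrite /side subrr mul0r add0r mul1r.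
  apply: (path_saddle cover_f sing_f pull_f _ pc _ _ reg fp).
  - by rewrite subr_eq0; apply/eqP => E; apply: pq.
  - by rewrite e0; apply: pV.
  - by rewrite e1; apply: pV.
have V0 : [set 0; u; v] 0 by left; left.
have Vu : [set 0; u; v] u by left; right.
have Vv : [set 0; u; v] v by right.
have nuv : u <> v by move=> E; move: uv0'; rewrite E /cross mulrC subrr eqxx.
have nv0 : v <> 0 by move=> E; move: uv0'; rewrite E /cross /= !mulr0 subrr eqxx.
have n0u : 0 <> u by move=> E; move: uv0'; rewrite -E /cross /= !mul0r subrr eqxx.
have [e0 e01 s0] := saddle u v Vu Vv nuv.
have [e1 e11 s1] := saddle v 0 Vv V0 nv0.
have [e2 e21 s2] := saddle 0 u V0 Vu n0u.
exists 0, u, v, phi, (e0 * (v - u)), (e1 * (0 - v)), (e2 * (u - 0)); split=> //.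
have sl (e w : Cplx R) : e = 1 \/ e = -1 -> slope (e * w) = slope w.
  by move=> e'; apply: slope_sign; case: e' => ->; rewrite ?mul1r ?mulN1r; [left|right].
by rewrite !sl // sub0r subr0.
Qed.

Lemma periodic_trianglesP (D : set (Cplx R)) :
  periodic_triangles M D <-> exists2 A, SL2Z A & D = mobius A @` base_triangle R.
Proof.
split=> [pD|[A [DA IA] ->]].
  have [u [v [gu gv uv1 ->]]] := periodic_triangle_unimodular cover_f sing_f pull_f pD.
  exact: farey_triangle.
pose a : Cplx R := A 0 0 +i* A 1 0; pose b : Cplx R := A 0 1 +i* A 1 1.
have ab : cross a b = 1 by rewrite /cross /= -DA det22; ring.
have -> : A = mx22 (complex.Re a) (complex.Re b) (complex.Im a) (complex.Im b).
  by apply: mx22P; rewrite !mxE.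
rewrite image_base_triangle //.
have ga : gauss_int a by apply/andP; split; apply: IA.
have gb : gauss_int b by apply/andP; split; apply: IA.
have := @unimodular_periodic b (a + b) gb (gaussD ga gb) _.
rewrite addrK (slope_sign (v := - (a + b)) (w := a + b)); last by right.
rewrite [X in periodic_triangles M X](_ : _ = ideal_triangle (slope a) (slope b) (slope (a + b))).
  have bE : cross b (a + b) = - cross a b by rewrite /cross /=; ring.
  by apply; rewrite bE ab sqrrN expr1n.
by rewrite [LHS]ideal_triangleC [LHS]ideal_triangle_rot.
Qed.

Lemma graph_edgesP e : graph_edges M e <->
  exists2 A, SL2Z A & e = edge_act A (edge0 R).
Proof.
case: e => k D; split=> [[_ /= /periodic_trianglesP[A SA ->] kv]|[A SA ->]].
  exact: vertex_of_image.
have [DA _] := SA.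
have pD : periodic_triangles M (mobius A @` base_triangle R) by apply/periodic_trianglesP; exists A.
have kv := ideal_vertex_mobius DA (base_vertex_infty R).
by split=> //; exists (mobius A @` base_triangle R).
Qed.

End TranslationCover.

(* The index is the cardinality of the set of left cosets. *)
Theorem corollary1p10 (R : realType) (M : translation_surface R) :
  translation_cover M ->
  veech_group M `<=` PSL2Z R /\
  (quotient_edges M #= left_cosets (PSL2Z R) (veech_group M))%card.
Proof.
move=> [f [cover_f sing_f pull_f]].
have int := veech_integral cover_f sing_f pull_f.
by split=> //; apply: quotient_edges_cosets => // e; apply: graph_edgesP.
Qed.
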